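(* Let $\epsilon\in(0,1/5)$ and $\gamma>0$. Let $\Omega_N$, $\mathcal B_{N,\omega}$ be the exceptional sets for the intervals $[-N,N]$, with localization intervals $I(x,\omega,E_j^{[-N,N]}(x,\omega))\subset[-N,N]$, as specified in the context. Set $\hat\Omega_{N_*}=\bigcup_{N\ge N_*}\Omega_N$ and $\hat{\mathcal B}_{N_*,\omega}=\bigcup_{N\ge N_*}\mathcal B_{N,\omega}$. There is a constant $C(V,a,b,\gamma,\epsilon)$ such that the following statements hold for any $N_*\ge C(V,a,b,\gamma,\epsilon)$, any $\omega\in\mathbb T^d(a,b)\setminus\hat\Omega_{N_*}$ and any $x\in\mathbb T^d\setminus\hat{\mathcal B}_{N_*,\omega}$. (a) Let $N\ge N_*$ and $N_k=N^{2^k}$ for $k\ge0$. If $L(\omega,E_j^{[-N,N]}(x,\omega))>2\gamma$ and $I=I(x,\omega,E_j^{[-N,N]}(x,\omega))\subset[-N/2,N/2]$, then, setting $j_0=j$, for each $k\ge1$ there exists $j_k$ (and a choice of the normalized eigenvector $\psi_{j_k}^{[-N_k,N_k]}(x,\omega)$) such that $$\left|E_{j_k}^{[-N_k,N_k]}(x,\omega)-E_j^{[-N,N]}(x,\omega)\right|<\exp\left(-\frac{\gamma}{10}N\right),$$ $$\left\|\psi_{j_k}^{[-N_k,N_k]}(x,\omega)-\psi_j^{[-N,N]}(x,\omega)\right\|<\exp\left(-\frac{\gamma}{10}N\right),$$ $$\left|\psi_{j_k}^{[-N_k,N_k]}(x,\omega;n)\right|<\exp\left(-\frac{\gamma}{20}\operatorname{dist}(n,I)\right),\qquad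 3N/4\le|n|\le N_k.$$ Furthermore, for any $k'\ge k\ge0$, $$\left|E_{j_{k'}}^{[-N_{k'},N_{k'}]}(x,\omega)-E_{j_k}^{[-N_k,N_k]}(x,\omega)\right|<\exp\left(-\frac{\gamma}{10}N_k\right),$$ $$\left\|\psi_{j_{k'}}^{[-N_{k'},N_{k'}]}(x,\omega)-\psi_{j_k}^{[-N_k,N_k]}(x,\omega)\right\|<\exp\left(-\frac{\gamma}{10}N_k\right).$$ In particular the limits $$E(x,\omega):=\lim_{k\to\infty}E_{j_k}^{[-N_k,N_k]}(x,\omega),\qquad \psi(x,\omega;n):=\lim_{k\to\infty}\psi_{j_k}^{[-N_k,N_k]}(x,\omega;n),\ n\in\mathbb Z,$$ exist, $\|\psi\|=1$, and $$|\psi(x,\omega;n)|<\exp\left(-\frac{\gamma}{20}\operatorname{dist}(n,I)\right),\qquad |n|\ge 3N/4.$$ (b) If $L(\omega,E)>3\gamma$ for all $E\in[E',E'']$, then $P([E',E''])H(x,\omega)P([E',E''])$ (considered on the range of $P([E',E''])$) has purely pure point spectrum, and all of its eigenpairs, with unit eigenvector, can be obtained as limits $(E(x,\omega),\psi(x,\omega))$ from (a) (for some $N\ge N_*$ and some $j$ satisfying the hypotheses of (a)).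
   Context: Let $d\ge 1$, $\mathbb T=\mathbb R/\mathbb Z$, and let $V:\mathbb T^d\to\mathbb R$ be a fixed real-analytic function; it extends to a bounded complex-analytic function on $\{x+iy:x\in\mathbb T^d,\ y\in\mathbb R^d,\ |y|<\rho\}$ for some $\rho=\rho(V)>0$. For $x,\omega\in\mathbb T^d$ let $[H(x,\omega)\psi](n)=-\psi(n+1)-\psi(n-1)+V(x+n\omega)\psi(n)$ on $\ell^2(\mathbb Z)$; $P(\cdot)$ denotes the spectral projections of $H(x,\omega)$. For fixed $a>0$, $b>d$ let $\mathbb T^d(a,b)$ be the set of $\omega\in\mathbb T^d$ with $\|k\cdot\omega\|\ge a|k|^{-b}$ for all $k\in\mathbb Z^d\setminus\{0\}$ ($\|\cdot\|$ is the distance to the nearest integer, $|k|$ the sup-norm). Intervals in $\mathbb Z$ are integer intervals, $|\Lambda|$ is the number of elements. For an interval $\Lambda\subset\mathbb Z$, $H_\Lambda(x,\omega)$ is the restriction of $H(x,\omega)$ to $\Lambda$ with Dirichlet boundary conditions, $f_\Lambda(x,\omega,E)=\det(H_\Lambda(x,\omega)-E)$, $f_N=f_{[1,N]}$; $E_j^\Lambda(x,\omega)$ are the eigenvalues of $H_\Lambda(x,\omega)$ (in increasing order), $\psi_j^\Lambda(x,\omega)$ corresponding eigenvectors of unit $\ell^2$ norm (defined up to a unimodular factor), with entries $\psi_j^\Lambda(x,\omega;n)$, extended by zero outside $\Lambda$ whenever vectors on different intervals are compared. Norms of vectors are $\ell^2$ norms. $M_N(x,\omega,E)=\prod_{n=N}^{1}\begin{bmatrix}V(x+n\omega)-E&-1\\1&0\end{bmatrix}$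 (factor $n=N$ leftmost), $L_N(\omega,E)=\frac1N\int_{\mathbb T^d}\log\|M_N(x,\omega,E)\|\,dx$, $L(\omega,E)=\lim_N L_N(\omega,E)=\inf_N L_N(\omega,E)$. Constants written $C(\cdots)$, $N_0(\cdots)$ depend only on the listed quantities and $d$ (uniformly for $E$ in bounded sets). Constants $\sigma,\tau$: $\sigma=\sigma(a,b),\tau=\tau(a,b)\in(0,1)$ are fixed constants for which the large deviation theorem (LDT) holds: for $\omega\in\mathbb T^d(a,b)$, $E\in\mathbb C$, $N\ge N_0(V,a,b,|E|)$, $\operatorname{mes}\{x\in\mathbb T^d:|\log\|M_N(x,\omega,E)\|-NL_N(\omega,E)|>N^{1-\tau}\}<\exp(-N^\sigma)$; and if moreover $L(\omega,E)>\gamma>0$, $N\ge N_0(V,a,b,|E|,\gamma)$, the same with $\log|f_N(x,\omega,E)|$ in place of $\log\|M_N(x,\omega,E)\|$. The same estimates hold on $\mathbb T^d+iy$, $|y|<\rho(V)$, with $L_N(y,\omega,E)=\frac1N\int\log\|M_N(x+iy,\omega,E)\|dx$ and correspondingly $L(y,\omega,E)=\lim_N L_N(y,\omega,E)$. Exceptional sets on $[-N,N]$. Write $\bar N=2N+1$. For every sufficiently large $N$ (depending on $V,a,b,\gamma,\epsilon$), $\Omega_N\subset\mathbb T^d$ and, for $\omega\in\mathbb T^d(a,b)\setminus\Omega_N$, $\mathcal B_{N,\omega}\subset\mathbb T^d$ are sets with $\operatorname{mes}(\Omega_N)<\exp(-(\log\bar N)^{\epsilon\sigma})$, $\operatorname{mes}(\mathcal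 B_{N,\omega})<\exp(-\exp((\log\bar N)^{\epsilon\sigma}))$, having the following properties for all $\omega\in\mathbb T^d(a,b)\setminus\Omega_N$ and $x\in\mathbb T^d\setminus\mathcal B_{N,\omega}$ (the paper proves that such sets exist). (i) Elimination: let $E\in\mathbb R$ with $L(\omega,E)>\gamma$ and let $m_0\in[-N,N]$ be such that $\log|f_\Lambda(x,\omega,E)|\le|\Lambda|L_{|\Lambda|}(\omega,E)-|\Lambda|^{1-\tau/4}$ for all intervals $\Lambda\subset[-N,N]$ with $\operatorname{dist}(m_0,[-N,N]\setminus\Lambda)>|\Lambda|/100$ and $|\Lambda|\ge(\log\bar N)^\epsilon$. Then for any integer $\bar\ell\ge\exp((\log\bar N)^{3\epsilon\sigma/2})$, $\log|f_{\bar\ell}(x+(m-1)\omega,\omega,E)|>\bar\ell L_{\bar\ell}(\omega,E)-\bar\ell^{1-\tau/2}$ for any $m\in[-N,N-\bar\ell+1]$ with $|m-m_0|\ge\bar\ell+2\exp(\ell^2)$, $\ell=\lceil(\log\bar N)^{2\epsilon}\rceil$. (ii) Localization and separation: for every eigenvalue $E=E_j^{[-N,N]}(x,\omega)$ with $L(\omega,E)>\gamma$ there is a (nonempty) interval $I=I(x,\omega,E)\subset[-N,N]$, $|I|<\exp((\log\bar N)^{5\epsilon})$, such that $|\psi_j^{[-N,N]}(x,\omega;m)|<\exp(-\frac\gamma4\operatorname{dist}(m,I))$ whenever $\operatorname{dist}(m,I)>\exp((\log\bar N)^{2\epsilon\sigma})$, and $|E_k^{[-N,N]}(x,\omega)-E_j^{[-N,N]}(x,\omega)|>\exp(-C(V)|I|)$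 for all $k\neq j$. For such eigenvalues $I(x,\omega,E)$ denotes this interval. *)

(* Defs.v *)
From HB Require Import structures.
From mathcomp Require Import all_boot all_order all_algebra.
From mathcomp Require Import complex.
From mathcomp Require Import all_classical all_reals all_analysis.

Set Implicit Arguments.
Unset Strict Implicit.
Unset Printing Implicit Defensive.

Import Order.TTheory GRing.Theory Num.Theory.
Import numFieldNormedType.Exports.

Local Open Scope classical_set_scope.
Local Open Scope ring_scope.

Section torus.
Context {R : realType}.

(* A point of T^d = R^d / Z^d is represented by its unique representative in
   [0,1)^d; functions on T^d are Z^d-periodic functions on R^d, so that the
   translates x + n omega need not be reduced modulo Z^d. *)
Definition torus (d : nat) : set 'rV[R]_d :=
  [set x | forall i, 0 <= x 0 i < 1].

Definition tcons (d : nat)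
    (p : measurableTypeR R * d.-tuple (measurableTypeR R)) :
    d.+1.-tuple (measurableTypeR R) := [the d.+1.-tuple _ of p.1 :: p.2].

Lemma measurable_tcons (d : nat) : measurable_fun setT (@tcons d).
Proof. exact: (measurable_cons measurable_fst measurable_snd). Qed.

HB.instance Definition _ (d : nat) :=
  isMeasurableFun.Build _ _ _ _ (@tcons d) (@measurable_tcons d).

(* d-fold product of the uniform probability on [0,1], that is, the normalized
   Haar measure of T^d.  It is carried by tuples because these are what the
   library equips with a product sigma-algebra. *)
Fixpoint haar (d : nat) : probability (d.-tuple (measurableTypeR R)) R :=
  match d with
  | 0 => \d_ [tuple]
  | d'.+1 => distribution
      ((uniform_prob (@ltr01 R) \x haar d')%E
        : probability (measurableTypeR R * d'.-tuple (measurableTypeR R))%type R)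
      (@tcons d')
  end.

Definition pt (d : nat) (t : d.-tuple (measurableTypeR R)) : 'rV[R]_d :=
  \row_i tnth t i.

(* Outer measure, so that it is meaningful for every subset; it is the Lebesgue
   measure on all Lebesgue measurable sets, not only on Borel sets. *)
Definition mes (d : nat) (A : set 'rV[R]_d) : \bar R :=
  ereal_inf [set haar d B | B in
    [set B | measurable B /\ (@pt d) @^-1` A `<=` B]].

Definition distZ (t : R) : R := inf [set `|t - m%:~R| | m in [set: int]].

Definition supnormZ (d : nat) (k : 'rV[int]_d) : nat :=
  (\max_(i < d) `|k ord0 i|)%N.

Definition diophantine (d : nat) (a b : R) : set 'rV[R]_d :=
  [set omega | torus omega /\ forall k : 'rV[int]_d, k != 0 ->
    a * (supnormZ k)%:R `^ (- b)
      <= distZ (\sum_(i < d) (k 0 i)%:~R * omega 0 i)].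

End torus.

(* {zlo, ..., zlo + zlen - 1} *)
Record zitv := ZItv { zlo : int ; zlen : nat }.

Definition zset (L : zitv) : set int :=
  [set n | zlo L <= n < zlo L + (zlen L)%:Z].

(* [-N, N] *)
Definition symm (N : nat) : zitv := ZItv (- N%:Z) N.*2.+1.

Definition zdist {R : realType} (m : int) (A : set int) : \bar R :=
  ereal_inf [set ((`|m - n|)%:~R)%:E | n in A].

Section operators.
Context {R : realType}.
Local Notation C := R[i].
Local Notation cabs := (@ComplexField.Normc.normc R).

Definition colnorm (n : nat) (u : 'cV[C]_n) : R :=
  Num.sqrt (\sum_i cabs (u i 0) ^+ 2).

Definition opnorm (n : nat) (M : 'M[C]_n) : R :=
  sup [set colnorm (M *m u) | u in [set u | colnorm u <= 1]].

(* In this section v : int -> C is the potential along an orbit. *)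

Fixpoint transfer (v : int -> C) (E : C) (N : nat) : 'M[C]_(1 + 1) :=
  match N with
  | 0 => 1%:M
  | n.+1 => block_mx (v n.+1%:Z - E)%:M (- 1)%:M 1%:M 0 *m transfer v E n
  end.

Definition dirichlet (v : int -> C) (L : zitv) : 'M[C]_(zlen L) :=
  \matrix_(i, j)
    if i == j then v (zlo L + (i : nat)%:Z)
    else if (i.+1 == j :> nat) || (j.+1 == i :> nat) then - 1 else 0.

Definition fdet (v : int -> C) (L : zitv) (E : C) : C :=
  \det (dirichlet v L - E%:M).

(* Roots of the characteristic polynomial with multiplicity, in increasing
   order, indexed from 0; for a real v the matrix is Hermitian, so that taking
   real parts loses nothing. *)
Definition eigvals (v : int -> C) (L : zitv) : seq R :=
  sort <=%R [seq complex.Re z |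
    z <- sval (closed_field_poly_normal (char_poly (dirichlet v L)))].

Definition eigval (v : int -> C) (L : zitv) (j : nat) : R :=
  nth 0 (eigvals v L) j.

Definition sqnorm (phi : int -> C) : \bar R :=
  \esum_(n in [set: int]) ((cabs (phi n)) ^+ 2)%:E.

Definition l2 : set (int -> C) := [set phi | (sqnorm phi < +oo)%E].

Definition l2norm (phi : int -> C) : R := Num.sqrt (fine (sqnorm phi)).

Definition ip (phi psi : int -> C) : C :=
  limn ((fun N : nat => \sum_(i < N.*2.+1)
    (phi ((i : nat)%:Z - N%:Z))^* * psi ((i : nat)%:Z - N%:Z)) : nat -> C^o).

(* Eigenvectors of H_L are extended by zero to the whole of Z. *)
Definition unit_eigvec (v : int -> C) (L : zitv) (lam : R) (psi : int -> C) :
    Prop :=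
  let u := \col_(i < zlen L) psi (zlo L + (i : nat)%:Z) in
  [/\ forall n, ~ zset L n -> psi n = 0,
      dirichlet v L *m u = lam%:C%C *: u &
      l2norm psi = 1].

Definition schrodinger (v : int -> C) (psi : int -> C) : int -> C :=
  fun n => - psi (n + 1) - psi (n - 1) + v n * psi n.

(* P is the projection-valued measure of the bounded self-adjoint operator T on
   l^2(Z): each P A is an orthogonal projection, A |-> <phi, P A phi> is a
   measure, and T = \int t dP(t) as a quadratic form.  By the spectral theorem
   there is exactly one such P (up to its values on non-Borel sets A and on
   sequences outside l^2). *)
Definition spectral_resolution (T : (int -> C) -> int -> C)
    (P : set R -> (int -> C) -> int -> C) : Prop :=
  (forall A : set R, measurable A ->
    [/\ forall phi, l2 phi -> l2 (P A phi),
        forall (c : C) phi psi, l2 phi -> l2 psi ->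
          P A (fun n => c * phi n + psi n)
            = (fun n => c * P A phi n + P A psi n),
        forall phi, l2 phi -> P A (P A phi) = P A phi &
        forall phi psi, l2 phi -> l2 psi ->
          ip phi (P A psi) = ip (P A phi) psi]) /\
  (forall phi, l2 phi -> P setT phi = phi) /\
  (forall phi, l2 phi ->
    exists mu : {measure set (measurableTypeR R) -> \bar R},
      [/\ forall A : set R, measurable A -> mu A = sqnorm (P A phi),
          mu.-integrable setT (fun t => t%:E) &
          ip phi (T phi) = (\int[mu]_(t in setT) t)%:C%C]).

Definition eigenpair (K : set (int -> C)) (T : (int -> C) -> int -> C)
    (lam : R) (psi : int -> C) : Prop :=
  [/\ K psi, l2norm psi = 1 & T psi = (fun n => lam%:C%C * psi n)].

(* The closed linear span of the eigenvectors of T in K is K. *)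
Definition pure_point (K : set (int -> C)) (T : (int -> C) -> int -> C) :
    Prop :=
  forall phi, K phi -> forall delta : R, 0 < delta ->
    exists (m : nat) (c : 'I_m -> C) (e : 'I_m -> int -> C),
      (forall i, exists lam, eigenpair K T lam (e i)) /\
      l2norm (fun n => phi n - \sum_(i < m) c i * e i n) < delta.

End operators.

Section quasiperiodic.
Context {R : realType} {d : nat}.
Local Notation C := R[i].
Local Notation cabs := (@ComplexField.Normc.normc R).
Implicit Types (V : 'rV[R]_d -> R) (W : 'rV[C]_d -> C)
  (x y omega : 'rV[R]_d).

Definition cpoint x y : 'rV[C]_d := \row_i Complex (x 0 i) (y 0 i).

(* W is the bounded complex-analytic extension of V to the strip of width rho;
   `|y| is the sup-norm and differentiable is complex differentiability. *)
Record analytic_potential V (rho : R) W : Prop := AnalyticPotential {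
  ap_rho : 0 < rho ;
  ap_per : forall x (k : 'rV[int]_d), V (x + map_mx intr k) = V x ;
  ap_ext : forall x, W (cpoint x 0) = (V x)%:C%C ;
  ap_extper : forall x y (k : 'rV[int]_d), `|y| < rho ->
    W (cpoint (x + map_mx intr k) y) = W (cpoint x y) ;
  ap_bound : exists M : R, forall x y, `|y| < rho ->
    cabs (W (cpoint x y)) <= M ;
  ap_holo : forall x y, `|y| < rho ->
    differentiable (W : 'rV[C^o]_d -> C^o) (cpoint x y : 'rV[C^o]_d)
}.

Definition potential V omega x : int -> C := fun n => (V (x + omega *~ n))%:C%C.

Definition cpotential W y omega x : int -> C :=
  fun n => W (cpoint (x + omega *~ n) y).

(* The family v is potential V omega or cpotential W y omega. *)
Definition LN (v : 'rV[R]_d -> int -> C) (E : C) (N : nat) : R :=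
  N%:R^-1 * \int[haar d]_(t in setT) ln (opnorm (transfer (v (pt t)) E N)).

Definition Lyap (v : 'rV[R]_d -> int -> C) (E : C) : R := limn (LN v E).

(* The case y = 0 is the estimate on T^d itself.  In the second estimate the
   logarithm is -oo at zeros of the determinant, hence the use of lne. *)
Definition LDT W (rho a b sigma tau : R) : Prop :=
  (forall B : R, exists N0 : nat,
    forall omega, diophantine a b omega ->
    forall E : C, cabs E <= B ->
    forall N : nat, (N0 <= N)%N ->
    forall y, `|y| < rho ->
    (mes [set x : 'rV[R]_d | (N%:R `^ (1 - tau) <
        `| ln (opnorm (transfer (cpotential W y omega x) E N))
           - N%:R * LN (cpotential W y omega) E N |)%R]
      < (expR (- N%:R `^ sigma))%:E)%E) /\
  (forall gamma : R, 0 < gamma -> forall B : R, exists N0 : nat,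
    forall omega, diophantine a b omega ->
    forall E : C, cabs E <= B ->
    forall N : nat, (N0 <= N)%N ->
    forall y, `|y| < rho -> gamma < Lyap (cpotential W y omega) E ->
    (mes [set x : 'rV[R]_d | (N%:R `^ (1 - tau))%:E <
        `| lne (cabs (fdet (cpotential W y omega x) (ZItv 1%Z N) E))%:E
           - (N%:R * LN (cpotential W y omega) E N)%:E |]
      < (expR (- N%:R `^ sigma))%:E)%E).

Definition logbar (N : nat) : R := ln (N.*2.+1)%:R.

Definition elimination V (gamma eps sigma tau : R) (N : nat) omega x : Prop :=
  let ell : R := (Num.ceil (logbar N `^ (2 * eps)))%:~R in
  forall E : R, gamma < Lyap (potential V omega) E%:C%C ->
  forall m0 : int, zset (symm N) m0 ->
  (forall L : zitv, zset L `<=` zset (symm N) ->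
     (((zlen L)%:R / 100 : R)%:E < zdist m0 (zset (symm N) `\` zset L))%E ->
     logbar N `^ eps <= (zlen L)%:R ->
     (lne (cabs (fdet (potential V omega x) L E%:C%C))%:E <=
       ((zlen L)%:R * LN (potential V omega) E%:C%C (zlen L)
         - (zlen L)%:R `^ (1 - tau / 4))%:E)%E) ->
  forall lbar : nat, expR (logbar N `^ (3 * eps * sigma / 2)) <= lbar%:R ->
  forall m : int, - N%:Z <= m <= N%:Z - lbar%:Z + 1 ->
  lbar%:R + 2 * expR (ell ^+ 2) <= (`|m - m0|)%:~R ->
  ((lbar%:R * LN (potential V omega) E%:C%C lbar - lbar%:R `^ (1 - tau / 2))%:E
   < lne (cabs (fdet (potential V omega (x + omega *~ (m - 1))%R) (ZItv 1%Z lbar)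
                     E%:C%C))%:E)%E.

Definition localization V (gamma eps sigma CV : R) (N : nat) omega x
    (I : R -> zitv) : Prop :=
  let v := potential V omega x in
  forall j : nat, (j < N.*2.+1)%N ->
  let E := eigval v (symm N) j in
  gamma < Lyap (potential V omega) E%:C%C ->
  [/\ zset (I E) `<=` zset (symm N),
      (0 < zlen (I E))%N /\
        (zlen (I E))%:R < expR (logbar N `^ (5 * eps)),
      forall psi, unit_eigvec v (symm N) E psi ->
        forall m, zset (symm N) m ->
        ((expR (logbar N `^ (2 * eps * sigma)))%:E < zdist m (zset (I E)))%E ->
        cabs (psi m) < expR (- (gamma / 4) * fine (zdist m (zset (I E)))) &
      forall k : nat, (k < N.*2.+1)%N -> k != j ->
        expR (- CV * (zlen (I E))%:R) < `|eigval v (symm N) k - E|].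

(* CV is the constant C(V) of the separation estimate; N1 is the threshold from
   which the sets are defined. *)
Record exceptional_sets V (a b gamma eps sigma tau CV : R) (N1 : nat)
    (Omega : nat -> set 'rV[R]_d) (B : nat -> 'rV[R]_d -> set 'rV[R]_d)
    (I : nat -> 'rV[R]_d -> 'rV[R]_d -> R -> zitv) : Prop :=
  ExceptionalSets {
  es_Omega : forall N, (N1 <= N)%N -> Omega N `<=` @torus R d /\
    (mes (Omega N) < (expR (- logbar N `^ (eps * sigma)))%:E)%E ;
  es_B : forall N, (N1 <= N)%N ->
    forall omega, diophantine a b omega -> ~ Omega N omega ->
    B N omega `<=` @torus R d /\
    (mes (B N omega) < (expR (- expR (logbar N `^ (eps * sigma))))%:E)%E ;
  es_elim : forall N, (N1 <= N)%N ->
    forall omega, diophantine a b omega -> ~ Omega N omega ->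
    forall x, torus x -> ~ B N omega x ->
    elimination V gamma eps sigma tau N omega x ;
  es_loc : forall N, (N1 <= N)%N ->
    forall omega, diophantine a b omega -> ~ Omega N omega ->
    forall x, torus x -> ~ B N omega x ->
    localization V gamma eps sigma CV N omega x (I N x omega)
}.

Definition scale (N k : nat) : nat := (N ^ (2 ^ k))%N.

Definition level V omega x (N : nat) (js : nat -> nat) (k : nat) : R :=
  eigval (potential V omega x) (symm (scale N k)) (js k).

(* To be used with I = I(x, omega, E_j), the localization interval of the
   eigenvalue of index j on [-N, N]. *)
Definition admissible V (gamma : R) omega x (N j : nat) (I : zitv) : Prop :=
  [/\ (j < N.*2.+1)%N,
      2 * gamma < Lyap (potential V omega)
                    (eigval (potential V omega x) (symm N) j)%:C%C &
      forall m, zset I m -> (`|m|)%:~R <= N%:R / 2 :> R].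

(* js k and psis k are the index j_k and the normalized eigenvector psi_{j_k} on
   [-N_k, N_k], where N_k = N^(2^k). *)
Record tower V (gamma : R) omega x (N : nat) (I : zitv)
    (js : nat -> nat) (psis : nat -> int -> C) : Prop := Tower {
  tw_js : forall k, (js k < (scale N k).*2.+1)%N ;
  tw_psi : forall k, unit_eigvec (potential V omega x) (symm (scale N k))
    (level V omega x N js k) (psis k) ;
  tw_val0 : forall k, (1 <= k)%N ->
    `|level V omega x N js k - level V omega x N js 0|
      < expR (- (gamma / 10) * N%:R) ;
  tw_vec0 : forall k, (1 <= k)%N ->
    l2norm (fun n => psis k n - psis 0 n) < expR (- (gamma / 10) * N%:R) ;
  tw_decay : forall k, (1 <= k)%N -> forall n : int,
    3 * N%:R / 4 <= (`|n|)%:~R :> R -> `|n| <= (scale N k)%:Z ->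
    cabs (psis k n) < expR (- (gamma / 20) * fine (zdist n (zset I))) ;
  tw_val : forall k k', (k <= k')%N ->
    `|level V omega x N js k' - level V omega x N js k|
      < expR (- (gamma / 10) * (scale N k)%:R) ;
  tw_vec : forall k k', (k <= k')%N ->
    l2norm (fun n => psis k' n - psis k n)
      < expR (- (gamma / 10) * (scale N k)%:R)
}.

Definition tower_limit V omega x (N : nat) (js : nat -> nat)
    (psis : nat -> int -> C) (E : R) (psi : int -> C) : Prop :=
  (level V omega x N js k @[k --> \oo] --> E) /\
  (forall n, (fun k => psis k n) @ \oo --> (psi n : C^o)).

End quasiperiodic.

(* Main.v *)
(** (a) Let psi be an eigenvector on [-N, N] whose localization interval lies in
    [-N/2, N/2].  As a vector on [-N^2, N^2] it satisfies the eigenvalue equation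
    except at the two sites next to +-N, where it is of size exp(- gamma N / 8).
    Since the eigenvalues on [-N^2, N^2] near E are separated by
    exp(- C |I|) >> exp(- gamma N / 8), there is exactly one eigenpair close to
    (E, psi).  Its localization interval cannot leave [-3N/5, 3N/5], because psi
    would then be small everywhere, so the argument applies again at scale N^2
    and the successive errors are summable.  To restart it one needs
    L > gamma at the new eigenvalue; this follows from the lower semicontinuity
    of L in the energy, uniformly in omega, which the large deviation estimate
    yields through a three-factor avalanche principle.

    (b) No generalized eigenfunctions are used.  Let J = [c - s, c + s], let
    s < r be such that L > 2 gamma on [c - r, c + r], and put G = M^2 - (H - c)^2
    with M large.  For finitely supported phi, G^k phi is computed exactly on a
    large box and expanded in the eigenvectors of that box.  Those with
    |E_j - c| > r contribute at most (M^2 - r^2)^k; those localized far from the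
    support of phi contribute almost nothing; the others are close to limits of
    towers.  On the range of P(J), G^k is bounded below by (M^2 - s^2)^k, so
    P(J) phi is approximated by combinations of limits of towers.  An eigenvector
    in the range of P(J) is orthogonal to all limits with another energy, and
    eigenvalues on Z are simple, so it is itself such a limit. *)

From HB Require Import structures.
Require Import Defs.
From mathcomp Require Import all_boot all_order all_algebra.
From mathcomp Require Import perm.
From mathcomp Require Import complex.
From mathcomp Require Import all_classical all_reals all_analysis.
From mathcomp Require Import measurable_realfun.
From mathcomp Require Import ring lra zify.
Set Implicit Arguments.
Unset Strict Implicit.
Unset Printing Implicit Defensive.
Import Order.TTheory GRing.Theory Num.Theory.
Import numFieldNormedType.Exports.
Local Open Scope classical_set_scope.
Local Open Scope ring_scope.

(** All thresholds must be fixed before [omega]. Semicontinuity of the Lyapunov exponent is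
    therefore drawn from a condition at a single scale: the gap
    [avg E (2 * n) - avg E n >= c * n + 4] reproduces itself under doubling and forces [L >= c],
    while at a fixed scale it is stable under small changes of the energy. If [L > c], a gap only
    slightly weaker occurs among boundedly many scales, their number depending only on [c] and on
    bounds for the potential and the energy. The loss is a factor 3/4, which the passages from 3
    gamma to 2 gamma and from 2 gamma to gamma absorb.

    In (b), H enters [spectral_resolution] only as a quadratic form, so its commutation with P and
    the norm bounds on the range of P have to be derived. The filter is a polynomial in H because it
    then has finite range, and boxes compute its powers without error. The power k is chosen first
    and the box afterwards, so errors exponentially small in the box may carry any factor that
    depends on k.

    Tower estimates are kept non-strict with a spare factor 1/2, since strict inequalities would be
    lost in the limit. *)

Local Notation cabs := (@ComplexField.Normc.normc _).

(** * Complex and matrix norms *)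

Section complex_modulus.
Context {R : realType}.
Local Notation C := R[i].
Implicit Types (z w : C).

Lemma cabsE z : `|z| = (cabs z)%:C%C. Proof. by []. Qed.

Lemma cabs_ge0 z : 0 <= cabs z.
Proof. by case: z => a b /=; exact: sqrtr_ge0. Qed.

Lemma cabs0 : cabs (0 : C) = 0. Proof. exact: ComplexField.Normc.normc0. Qed.
Lemma cabs1 : cabs (1 : C) = 1. Proof. exact: ComplexField.Normc.normc1. Qed.
Lemma cabsM z w : cabs (z * w) = cabs z * cabs w. Proof. exact: ComplexField.Normc.normcM. Qed.
Lemma cabsN z : cabs (- z) = cabs z.
Proof. by case: z => a b /=; rewrite !sqrrN. Qed.
Lemma cabsB z w : cabs (z - w) = cabs (w - z).
Proof. by rewrite -cabsN opprB. Qed.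
Lemma cabsD z w : cabs (z + w) <= cabs z + cabs w.
Proof. by have := ler_normD z w; rewrite !cabsE -rmorphD /= lecR. Qed.
Lemma cabs_eq0 z : cabs z = 0 -> z = 0. Proof. exact: ComplexField.Normc.eq0_normc. Qed.
Lemma cabs_real (r : R) : cabs (r%:C)%C = `|r|.
Proof. by rewrite /= expr0n addr0 sqrtr_sqr. Qed.
Lemma cabs_conj z : cabs (z^*) = cabs z.
Proof. by case: z => a b /=; rewrite sqrrN. Qed.
Lemma conjM_cabs z : z^* * z = ((cabs z ^+ 2)%:C)%C.
Proof. by rewrite mulrC -normCK cabsE rmorphXn. Qed.
Lemma cabs_sum (I : Type) (r : seq I) (P : pred I) (F : I -> C) :
  cabs (\sum_(i <- r | P i) F i) <= \sum_(i <- r | P i) cabs (F i).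
Proof.
elim/big_rec2: _ => [|i x y _ le_yx]; first by rewrite cabs0.
by rewrite (le_trans (cabsD _ _)) // lerD2l.
Qed.
Lemma cabs_sqrE z : cabs z ^+ 2 = complex.Re z ^+ 2 + complex.Im z ^+ 2.
Proof. by case: z => a b /=; rewrite sqr_sqrtr ?addr_ge0 ?sqr_ge0. Qed.
Lemma Re_le_cabs z : `|complex.Re z| <= cabs z.
Proof.
by case: z => a b /=; rewrite -sqrtr_sqr ler_wsqrtr // lerDl sqr_ge0.
Qed.
Lemma Im_le_cabs z : `|complex.Im z| <= cabs z.
Proof.
by case: z => a b /=; rewrite -sqrtr_sqr ler_wsqrtr // lerDr sqr_ge0.
Qed.
Lemma cabs_le_ReIm z : cabs z <= `|complex.Re z| + `|complex.Im z|.
Proof.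
rewrite -ler_sqr ?nnegrE ?cabs_ge0 ?addr_ge0 //.
rewrite cabs_sqrE sqrrD !real_normK ?num_real //.
by rewrite addrAC lerDl mulrn_wge0 // mulr_ge0.
Qed.
End complex_modulus.

Section column_norm.
Context {R : realType}.
Local Notation C := R[i].

Lemma cauchy_schwarz_sum (I : finType) (a b : I -> R) :
  \sum_i a i * b i <=
    Num.sqrt (\sum_i a i ^+ 2) * Num.sqrt (\sum_i b i ^+ 2).
Proof.
set A := \sum_i a i ^+ 2; set B := \sum_i b i ^+ 2.
have A0 : 0 <= A by apply: sumr_ge0 => i _; exact: sqr_ge0.
have B0 : 0 <= B by apply: sumr_ge0 => i _; exact: sqr_ge0.
have hz (f g : I -> R) : \sum_i f i ^+ 2 = 0 -> \sum_i f i * g i = 0.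
  move=> f0; apply: big1 => i _.
  have /eqP : f i ^+ 2 = 0.
    by move/psumr_eq0P: f0 => -> // j _; exact: sqr_ge0.
  by rewrite sqrf_eq0 => /eqP ->; rewrite mul0r.
have [A00|An0] := eqVneq A 0.
  by rewrite (hz _ _ A00) mulr_ge0 ?sqrtr_ge0.
have [B00|Bn0] := eqVneq B 0.
  have -> : \sum_i a i * b i = 0.
    by rewrite -[RHS](hz b a B00); apply: eq_bigr => i _; rewrite mulrC.
  by rewrite mulr_ge0 ?sqrtr_ge0.
set s := Num.sqrt A; set t := Num.sqrt B.
have s0 : 0 < s by rewrite sqrtr_gt0 lt_neqAle eq_sym An0.
have t0 : 0 < t by rewrite sqrtr_gt0 lt_neqAle eq_sym Bn0.
have : 0 <= \sum_i (a i * t - b i * s) ^+ 2.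
  by apply: sumr_ge0 => i _; exact: sqr_ge0.
have -> : \sum_i (a i * t - b i * s) ^+ 2
   = t ^+ 2 * A - 2 * (t * s) * (\sum_i a i * b i) + s ^+ 2 * B.
  rewrite !mulr_sumr -sumrB -big_split /=; apply: eq_bigr => i _; ring.
rewrite !sqr_sqrtr // -/A -/B.
have eA : A = s ^+ 2 by rewrite sqr_sqrtr.
have eB : B = t ^+ 2 by rewrite sqr_sqrtr.
rewrite eA eB => h.
have ts0 : 0 < t * s by rewrite mulr_gt0.
rewrite -(ler_pM2l ts0); nra.
Qed.

Variable n : nat.
Implicit Types u v : 'cV[C]_n.

Lemma colnorm_ge0 u : 0 <= colnorm u. Proof. exact: sqrtr_ge0. Qed.

Lemma sum_cabs_ge0 u : 0 <= \sum_i cabs (u i 0) ^+ 2.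
Proof. by apply: sumr_ge0 => i _; exact: sqr_ge0. Qed.

Lemma colnorm_sq u : colnorm u ^+ 2 = \sum_i cabs (u i 0) ^+ 2.
Proof. by rewrite sqr_sqrtr // sum_cabs_ge0. Qed.

Lemma colnorm_leP u (c : R) : 0 <= c ->
  (colnorm u <= c) = (\sum_i cabs (u i 0) ^+ 2 <= c ^+ 2).
Proof. by move=> c0; rewrite -colnorm_sq ler_sqr ?nnegrE ?colnorm_ge0. Qed.

Lemma colnorm0 : colnorm (0 : 'cV[C]_n) = 0.
Proof.
by rewrite /colnorm big1 ?sqrtr0 // => i _; rewrite mxE cabs0 expr0n.
Qed.

Lemma colnormZ z u : colnorm (z *: u) = cabs z * colnorm u.
Proof.
rewrite /colnorm; under eq_bigr do rewrite mxE cabsM exprMn.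
by rewrite -mulr_sumr sqrtrM ?sqr_ge0 // sqrtr_sqr ger0_norm ?cabs_ge0.
Qed.

Lemma colnormN u : colnorm (- u) = colnorm u.
Proof. by rewrite -scaleN1r colnormZ cabsN cabs1 mul1r. Qed.

Lemma colnormD u v : colnorm (u + v) <= colnorm u + colnorm v.
Proof.
rewrite colnorm_leP ?addr_ge0 ?colnorm_ge0 // sqrrD !colnorm_sq.
have h : \sum_i cabs ((u + v) i 0) ^+ 2 <=
   \sum_i (cabs (u i 0) ^+ 2 + 2 * (cabs (u i 0) * cabs (v i 0))
           + cabs (v i 0) ^+ 2).
  apply: ler_sum => i _; rewrite mulr_natl -sqrrD mxE ler_sqr ?nnegrE ?cabs_ge0 //.
    exact: cabsD.
  by rewrite addr_ge0 ?cabs_ge0.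
apply: (le_trans h); rewrite !big_split /= lerD2r lerD2l.
rewrite -mulr_sumr mulr_natl lerMn2r /=; exact: cauchy_schwarz_sum.
Qed.

Lemma colnorm_entry u i : cabs (u i 0) <= colnorm u.
Proof.
rewrite -ler_sqr ?nnegrE ?cabs_ge0 ?colnorm_ge0 // colnorm_sq.
by rewrite (bigD1 i) //= lerDl; apply: sumr_ge0 => j _; exact: sqr_ge0.
Qed.

Lemma colnorm_eq0 u : colnorm u = 0 -> u = 0.
Proof.
move=> u0; apply/colP => i; rewrite mxE; apply: cabs_eq0.
by apply/eqP; rewrite eq_le cabs_ge0 andbT -u0 colnorm_entry.
Qed.

Lemma colnorm_le_sum u : colnorm u <= \sum_i cabs (u i 0).
Proof.
rewrite colnorm_leP; last by apply: sumr_ge0 => i _; exact: cabs_ge0.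
rewrite expr2 mulr_sumr; apply: ler_sum => i _.
rewrite expr2 ler_wpM2r ?cabs_ge0 // (bigD1 i) //= lerDl.
by apply: sumr_ge0 => j _; exact: cabs_ge0.
Qed.

Lemma colnorm_dot u v :
  cabs (\sum_i (u i 0)^* * v i 0) <= colnorm u * colnorm v.
Proof.
apply: (le_trans (cabs_sum _ _ _)).
under eq_bigr do rewrite cabsM cabs_conj.
exact: cauchy_schwarz_sum.
Qed.

End column_norm.

Section operator_norm.
Context {R : realType} {n : nat}.
Local Notation C := R[i].
Implicit Types (M P : 'M[C]_n) (u : 'cV[C]_n).

Let mxbound M := \sum_i \sum_j cabs (M i j).

Let mxbound_ok M u : colnorm (M *m u) <= mxbound M * colnorm u.
Proof.
apply: (le_trans (colnorm_le_sum _)); rewrite mulr_suml.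
apply: ler_sum => i _; rewrite mxE mulr_suml.
apply: (le_trans (cabs_sum _ _ _)); apply: ler_sum => j _.
by rewrite cabsM ler_wpM2l ?cabs_ge0 ?colnorm_entry.
Qed.

(** [sup] has a default value on unbounded sets, so [opnorm] is meaningful only through this bound
    by the entries. *)
Let has_sup_opnorm M :
  has_sup [set colnorm (M *m u) | u in [set u | colnorm u <= 1]].
Proof.
split; first by exists (colnorm (M *m 0)), 0 => //=; rewrite colnorm0.
exists (mxbound M) => _ [u /= u1 <-]; apply: (le_trans (mxbound_ok _ _)).
have b0 : 0 <= mxbound M.
  by apply: sumr_ge0 => i _; apply: sumr_ge0 => j _; exact: cabs_ge0.
by rewrite -[leRHS]mulr1 ler_wpM2l.
Qed.

Lemma opnorm_ge_unit M u : colnorm u <= 1 -> colnorm (M *m u) <= opnorm M.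
Proof. by move=> u1; apply: (ub_le_sup (has_sup_opnorm M).2); exists u. Qed.

Lemma opnorm_ge0 M : 0 <= opnorm M.
Proof.
apply: le_trans (@opnorm_ge_unit M 0 _); first exact: colnorm_ge0.
by rewrite colnorm0.
Qed.

Lemma opnorm_le M (c : R) :
  (forall u, colnorm u <= 1 -> colnorm (M *m u) <= c) -> opnorm M <= c.
Proof.
move=> h; apply: ge_sup; first exact: (has_sup_opnorm M).1.
by move=> _ [u /= u1 <-]; exact: h.
Qed.

Lemma le_opnorm M u : colnorm (M *m u) <= opnorm M * colnorm u.
Proof.
have [u0|un0] := eqVneq (colnorm u) 0.
  by rewrite (colnorm_eq0 u0) mulmx0 colnorm0 mulr0.
have up : 0 < colnorm u by rewrite lt_neqAle eq_sym un0 colnorm_ge0.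
pose w := ((colnorm u)^-1%:C)%C *: u.
have w1 : colnorm w <= 1.
  by rewrite colnormZ cabs_real ger0_norm ?invr_ge0 ?colnorm_ge0 // mulVf.
have := opnorm_ge_unit M w1.
rewrite -scalemxAr colnormZ cabs_real ger0_norm ?invr_ge0 ?colnorm_ge0 //.
by rewrite mulrC ler_pdivrMr.
Qed.

Lemma opnormM M P : opnorm (M *m P) <= opnorm M * opnorm P.
Proof.
apply: opnorm_le => u u1; rewrite -mulmxA (le_trans (le_opnorm _ _)) //.
by rewrite ler_wpM2l ?opnorm_ge0 // opnorm_ge_unit.
Qed.

Lemma opnormD M P : opnorm (M + P) <= opnorm M + opnorm P.
Proof.
apply: opnorm_le => u u1; rewrite mulmxDl (le_trans (colnormD _ _)) //.
by rewrite lerD // opnorm_ge_unit.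
Qed.

Lemma opnormN M : opnorm (- M) = opnorm M.
Proof.
by congr (sup _); apply: eq_imagel => u _; rewrite mulNmx colnormN.
Qed.

Lemma opnorm_sub_le M P : `|opnorm M - opnorm P| <= opnorm (M - P).
Proof.
have h1 := opnormD (M - P) P; have h2 := opnormD (P - M) M.
rewrite subrK in h1; rewrite subrK -(opnormN (P - M)) opprB in h2.
move: (opnorm M) (opnorm P) (opnorm (M - P)) h1 h2 => x y z h1 h2.
by rewrite ler_norml; apply/andP; split; lra.
Qed.

Lemma opnorm_le_entries M : opnorm M <= \sum_i \sum_j cabs (M i j).
Proof.
have b0 : 0 <= mxbound M.
  by apply: sumr_ge0 => i _; apply: sumr_ge0 => j _; exact: cabs_ge0.
apply: opnorm_le => u u1; apply: (le_trans (mxbound_ok _ _)).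
by rewrite -[leRHS]mulr1 ler_wpM2l.
Qed.

Lemma opnorm1_le : opnorm (1%:M : 'M[C]_n) <= 1.
Proof. by apply: opnorm_le => u; rewrite mul1mx. Qed.

End operator_norm.

Lemma sqr_inj_ge0 (R : realDomainType) (x y : R) :
  0 <= x -> 0 <= y -> x ^+ 2 = y ^+ 2 -> x = y.
Proof.
by move=> x0 y0 e; apply: (@pexpIrn R 2) => //; rewrite ?nnegrE.
Qed.

(** * Translation invariance of Haar measure on the torus *)

Section circle_translation.
Context {R : realType}.
Local Open Scope ereal_scope.
Local Notation mu := (@lebesgue_measure R).

Let shift_preimage_itv (a : R) (b1 b2 : bool) (x y : R) :
  (fun z : R => (z + a)%R) @^-1` [set` Interval (BSide b1 x) (BSide b2 y)]
  = [set` Interval (BSide b1 (x - a)%R) (BSide b2 (y - a)%R)].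
Proof.
apply/seteqP; split => z /=; rewrite !in_itv /=;
  case: b1; case: b2 => /=; lra.
Qed.

Definition rshift_by (a : R) : measurableTypeR R -> measurableTypeR R :=
  fun x => (x + a)%R.

Lemma measurable_rshift_by (a : R) : measurable_fun setT (rshift_by a).
Proof. exact: measurable_funD. Qed.

HB.instance Definition _ (a : R) :=
  isMeasurableFun.Build _ _ _ _ (rshift_by a) (@measurable_rshift_by a).

Lemma lebesgue_measure_shift (a : R) (A : set R) : measurable A ->
  pushforward mu (rshift_by a) A = mu A.
Proof.
move=> mA; apply/esym/lebesgue_measure_unique => //= _ [[x y]] _ <-.
rewrite /pushforward shift_preimage_itv !lebesgue_measure_itv/=.
rewrite !lte_fin ltrD2r -!EFinB; case: ifP => // _; congr (_%:E); ring.
Qed.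

Lemma ge0_integral_shift (a : R) (b1 b2 : bool) (x y : R) (f : R -> \bar R) :
  measurable_fun setT f -> (forall r, 0 <= f r) ->
  \int[mu]_(r in [set` Interval (BSide b1 x) (BSide b2 y)]) f (r + a)%R =
  \int[mu]_(r in [set` Interval (BSide b1 (x + a)%R) (BSide b2 (y + a)%R)]) f r.
Proof.
move=> mf f0.
have -> : [set` Interval (BSide b1 x) (BSide b2 y)] =
   (fun z : R => (z + a)%R) @^-1`
     [set` Interval (BSide b1 (x + a)%R) (BSide b2 (y + a)%R)].
  by rewrite shift_preimage_itv !addrK.
rewrite -(ge0_integral_pushforward (measurable_rshift_by a)) //=.
- apply: eq_measure_integral => A mA _; exact: lebesgue_measure_shift.
- exact: measurable_funS mf.
Qed.

Let split_itv (a c b : R) (f : R -> \bar R) : (a <= c)%R -> (c <= b)%R ->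
  measurable_fun setT f -> (forall r, 0 <= f r) ->
  \int[mu]_(r in `]a, b]) f r =
  \int[mu]_(r in `]a, c]) f r + \int[mu]_(r in `]c, b]) f r.
Proof.
move=> ac cb mf f0; rewrite -ge0_integral_setU //=.
- congr integral; apply/seteqP; split => z /=; rewrite !in_itv /=.
    by move=> h; case: (leP z c) => zc; [left|right]; lra.
  by move=> [h|h]; lra.
- exact: measurable_funS mf.
- apply/disj_setPS => z [] /=; rewrite !in_itv /=; lra.
Qed.

Lemma ge0_integral_periodic (a : R) (f : R -> \bar R) :
  measurable_fun setT f -> (forall r, 0 <= f r) ->
  (forall (r : R) (m : int), f (r + m%:~R)%R = f r) ->
  \int[mu]_(r in `[0%R, 1%R]) f (r + a)%R = \int[mu]_(r in `[0%R, 1%R]) f r.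
Proof.
move=> mf f0 fper.
(* Periodicity absorbs the integer part of [a]. With [0 <= c < 1] the shifted interval from [c] to
   [1 + c] is cut at 1, and its right piece is moved back by one period. *)
pose c := (a - (Num.floor a)%:~R)%R.
have /andP[c0 c1] : (0 <= c < 1)%R.
  rewrite /c subr_ge0 floor_le /= ltrBlDl.
  by have := floorD1_gt a; rewrite intrD.
have -> : \int[mu]_(r in `[0%R, 1%R]) f (r + a)%R =
          \int[mu]_(r in `[0%R, 1%R]) f (r + c)%R.
  apply: eq_integral => r _.
  by rewrite -(fper (r + c)%R (Num.floor a)) /c addrA subrK.
rewrite -!integral_itv_obnd_cbnd; last 2 first.
- exact: measurable_funS mf.
- apply: measurable_funTS.
  exact: (measurableT_comp mf (measurable_rshift_by c)).
rewrite ge0_integral_shift // add0r.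
rewrite (split_itv (c := 1%R)) //; [|lra|lra].
rewrite [RHS](split_itv (c := c)) //; [|lra].
rewrite addeC; congr (_ + _).
have := @ge0_integral_shift 1%R false false 0%R c f mf f0.
rewrite add0r (addrC c) => <-; apply: eq_integral => r _.
exact: (fper r 1%Z).
Qed.

End circle_translation.

Section torus_translation.
Context {R : realType}.
Local Notation RT := (measurableTypeR R).

(** The result is not reduced modulo 1; integrands will be periodic instead. *)
Definition tshift d (a : 'I_d -> R) (t : d.-tuple RT) : d.-tuple RT :=
  [tuple (tnth t i + a i : RT) | i < d].

Lemma measurable_tshift d (a : 'I_d -> R) :
  measurable_fun setT (tshift a).
Proof.
apply/measurable_fun_tnthP => i.
have -> : (@tnth d RT ^~ i \o tshift a) = (fun t : d.-tuple RT => tnth t i + a i).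
  by apply/funext => t /=; rewrite tnth_mktuple.
apply: measurable_funD => //; exact: measurable_tnth.
Qed.

Lemma tshift_cons d (a : 'I_d.+1 -> R) (x : RT) (t : d.-tuple RT) :
  tshift a (tcons (x, t)) =
  tcons ((x + a ord0 : RT), tshift (fun i => a (lift ord0 i)) t).
Proof.
apply: eq_from_tnth => i; rewrite tnth_mktuple /tcons /=.
case: (unliftP ord0 i) => [j ->|->]; last by [].
by rewrite !tnthS tnth_mktuple.
Qed.

Local Open Scope ereal_scope.

Lemma haar_succ d (F : d.+1.-tuple RT -> \bar R) :
  measurable_fun setT F -> (forall t, 0 <= F t) ->
  \int[haar d.+1]_t F t =
  \int[lebesgue_measure]_(x in `[0%R, 1%R]) \int[haar d]_t F (tcons (x, t)).
Proof.
move=> mF F0.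
have mFc : measurable_fun setT (fun p : RT * d.-tuple RT => F (tcons p)).
  exact: (measurableT_comp mF (@measurable_tcons R d)).
rewrite /= /distribution ge0_integral_pushforward //=.
rewrite preimage_setT /comp fubini_tonelli1 //.
rewrite integral_uniform /fubini_F //.
- by rewrite subr0 invr1 mul1e.
- exact: (measurable_fun_fubini_tonelli_F (m2 := haar d) (fun p => F (tcons p))).
- by move=> x; apply: integral_ge0.
Qed.

(** Induction on [d] by Tonelli: the induction hypothesis treats the inner integral, the circle the
    outer one. The periodicity of each section comes from integer vectors that vanish on the
    remaining coordinates. *)
Lemma haar_shift d (a : 'I_d -> R) (F : d.-tuple RT -> \bar R) :
  measurable_fun setT F -> (forall t, 0 <= F t) ->
  (forall (m : 'I_d -> int) t, F (tshift (fun i => (m i)%:~R) t) = F t) ->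
  \int[haar d]_t F (tshift a t) = \int[haar d]_t F t.
Proof.
elim: d a F => [|d IH] a F mF F0 Fper.
  by apply: eq_integral => t _; congr F; apply: eq_from_tnth => -[].
have mFs b : measurable_fun setT (F \o tshift b).
  exact: (measurableT_comp mF (measurable_tshift b)).
rewrite haar_succ //; last exact: mFs.
rewrite haar_succ //.
pose g x := \int[haar d]_t F (tcons (x, t)).
have mFc : measurable_fun setT (fun p : RT * d.-tuple RT => F (tcons p)).
  exact: (measurableT_comp mF (@measurable_tcons R d)).
have mcons x : measurable_fun setT (fun t : d.-tuple RT => F (tcons (x, t))).
  exact: (measurableT_comp mFc (pair1_measurable x)).
have mg : measurable_fun setT g.
  exact: (measurable_fun_fubini_tonelli_F (m2 := haar d) (fun p => F (tcons p))).
transitivity (\int[lebesgue_measure]_(x in `[0%R, 1%R]) g (x + a ord0)%R).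
  apply: eq_integral => x _.
  under eq_integral do rewrite tshift_cons.
  apply: (IH _ (fun t => F (tcons ((x + a ord0)%R, t)))) => //.
  move=> m t.
  rewrite -(Fper (fun i => if unlift ord0 i is Some j then m j else 0%Z)
              (tcons ((x + a ord0)%R, t))).
  rewrite tshift_cons unlift_none addr0; congr (F (tcons (_, _))).
  by apply: eq_from_tnth => i; rewrite !tnth_mktuple liftK.
apply: (@ge0_integral_periodic R (a ord0) g) => // [x|x m].
  exact: integral_ge0.
apply: eq_integral => t _.
rewrite -[RHS](Fper (fun i => if unlift ord0 i is Some j then 0%Z else m)
              (tcons (x, t))).
rewrite tshift_cons unlift_none; congr (F (tcons (_, _))).
apply: eq_from_tnth => i; rewrite !tnth_mktuple liftK addr0 //.
Qed.

End torus_translation.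

#[local] Opaque opnorm.

(** * The avalanche principle and the Lyapunov exponent *)

Section transfer_matrices.
Context {R : realType}.
Local Notation C := R[i].
Local Notation M2 := 'M[C]_(1 + 1).
Implicit Types (A : M2) (y z : 'cV[C]_(1 + 1)).

Lemma sum2 (V : nmodType) (F : 'I_(1 + 1) -> V) : \sum_i F i = F 0 + F 1.
Proof.
rewrite !big_ord_recl big_ord0 addr0.
by congr (F _ + F _); apply/val_inj.
Qed.

Lemma colnorm2 y : colnorm y ^+ 2 = cabs (y 0 0) ^+ 2 + cabs (y 1 0) ^+ 2.
Proof.
by rewrite colnorm_sq sum2.
Qed.

Definition wedge y z : C := y 0 0 * z 1 0 - y 1 0 * z 0 0.

Definition wedge_preserving A := forall y z, wedge (A *m y) (A *m z) = wedge y z.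

(** Orthogonal to [y] in the Hermitian product and of the same norm; the conjugates make [wedge y z]
    the product of [vperp y] with [z]. *)
Definition vperp y : 'cV[C]_(1 + 1) :=
  \col_i if i == 0 then - (y 1 0)^* else (y 0 0)^*.

Lemma colnorm_vperp y : colnorm (vperp y) = colnorm y.
Proof.
apply: sqr_inj_ge0; rewrite ?colnorm_ge0 // !colnorm2 !mxE /=.
by rewrite cabsN !cabs_conj addrC.
Qed.

Lemma wedge_decomp y z :
  ((colnorm y ^+ 2)%:C)%C *: z =
  (\sum_i (y i 0)^* * z i 0) *: y + wedge y z *: vperp y.
Proof.
rewrite colnorm2 rmorphD /= -!conjM_cabs.
apply/colP => i; rewrite !mxE !sum2 /wedge.
case: i => -[|[|//]] hi /=.
  have -> : Ordinal hi = 0 by apply/val_inj.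
  move: (y 0 0) (y 1 0) (z 0 0) (z 1 0) => y0 y1 z0 z1; ring.
have -> : Ordinal hi = 1 by apply/val_inj.
move: (y 0 0) (y 1 0) (z 0 0) (z 1 0) => y0 y1 z0 z1; ring.
Qed.

Lemma wedge_le y z : cabs (wedge y z) <= colnorm y * colnorm z.
Proof.
have -> : wedge y z = \sum_i (vperp y i 0)^* * z i 0.
  rewrite sum2 !mxE /=.
by rewrite rmorphN /= (conjCK (y 1 0)) (conjCK (y 0 0)) /wedge mulNr addrC.
by rewrite (le_trans (colnorm_dot _ _)) // colnorm_vperp.
Qed.

(** Decompose [z] along [y] and [vperp y]. The first component is stretched by [A3] exactly as [y]
    is; the second has length [|wedge y z| / |y|]. That length enters twice, once in the size of the
    first component and once through its own image, whence the factor 2. *)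
Lemma avalanche_vec A3 y z : y != 0 ->
  colnorm z * colnorm (A3 *m y) - 2 * opnorm A3 * cabs (wedge y z) <=
  colnorm (A3 *m z) * colnorm y.
Proof.
move=> y0; set w := cabs (wedge y z); set p := \sum_i (y i 0)^* * z i 0.
have ny : 0 < colnorm y.
  by rewrite lt_neqAle colnorm_ge0 andbT eq_sym; apply: contra_neq y0 => /colnorm_eq0.
have cn : cabs ((colnorm y ^+ 2)%:C)%C = colnorm y ^+ 2.
  by rewrite cabs_real ger0_norm ?sqr_ge0.
have h1 : colnorm y * colnorm z <= cabs p + w.
  have := congr1 (@colnorm R _) (wedge_decomp y z).
  rewrite colnormZ cn => e.
  have := colnormD (p *: y) (wedge y z *: vperp y).
  rewrite -e !colnormZ colnorm_vperp -mulrDl -/w expr2 -mulrA mulrC.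
  by rewrite ler_pM2r.
have h2 : cabs p * colnorm (A3 *m y) - w * (opnorm A3 * colnorm y) <=
          colnorm y ^+ 2 * colnorm (A3 *m z).
  have e : p *: (A3 *m y) = ((colnorm y ^+ 2)%:C)%C *: (A3 *m z)
           - wedge y z *: (A3 *m vperp y).
    by rewrite !scalemxAr -mulmxBr wedge_decomp addrK.
  have := colnormD (((colnorm y ^+ 2)%:C)%C *: (A3 *m z))
             (- (wedge y z *: (A3 *m vperp y))).
  rewrite -e colnormN !colnormZ cn -/w => h.
  have h' : w * colnorm (A3 *m vperp y) <= w * (opnorm A3 * colnorm y).
    by rewrite ler_wpM2l ?cabs_ge0 // -(colnorm_vperp y) le_opnorm.
  by move: h h'; move: (w * _) (w * _) => a b; lra.
have h3 : colnorm (A3 *m y) <= opnorm A3 * colnorm y by exact: le_opnorm.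
have w0 : 0 <= w by exact: cabs_ge0.
have a0 := colnorm_ge0 (A3 *m y).
move: h1 h2 h3 w0 a0 ny.
move: (colnorm (A3 *m y)) (colnorm (A3 *m z)) (colnorm y) (colnorm z)
  (opnorm A3) (cabs p) w => a b Y Z o P w h1 h2 h3 w0 a0 ny.
rewrite -(ler_pM2l ny).
have h4 : (Y * Z - w) * a <= P * a by rewrite ler_wpM2r //; lra.
have h5 : w * a <= w * (o * Y) by rewrite ler_wpM2l.
lra.
Qed.

(** Take [y = A2 b] and [z = A2 A1 x] in [avalanche_vec]. Since [A2] preserves [wedge], the error is
    governed by the wedge of [b] and [A1 x], at most [o1] however large [A2] is. *)
Let avalanche_unit A1 A2 A3 x b (o1 o2 o3 T : R) : wedge_preserving A2 ->
  colnorm x <= 1 -> colnorm b <= 1 ->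
  opnorm A1 <= o1 -> opnorm A2 <= o2 -> opnorm A3 <= o3 ->
  opnorm (A3 *m A2 *m A1) <= T ->
  colnorm (A2 *m A1 *m x) * colnorm (A3 *m A2 *m b) <= T * o2 + 2 * (o3 * o1).
Proof.
move=> wA2 x1 b1 h1 h2 h3 hT.
have o10 := le_trans (opnorm_ge0 A1) h1.
have o20 := le_trans (opnorm_ge0 A2) h2.
have o30 := le_trans (opnorm_ge0 A3) h3.
have T0 := le_trans (opnorm_ge0 _) hT.
have [y0|y0] := eqVneq (A2 *m b) 0.
  rewrite -[A3 *m A2 *m b]mulmxA y0 mulmx0 colnorm0 mulr0.
  by rewrite addr_ge0 ?mulr_ge0.
have := @avalanche_vec A3 (A2 *m b) (A2 *m A1 *m x) y0.
rewrite -[A2 *m A1 *m x]mulmxA wA2 [A3 *m (A2 *m b)]mulmxA => h.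
have hw : cabs (wedge b (A1 *m x)) <= o1.
  apply: (le_trans (wedge_le _ _)); rewrite -[leRHS]mul1r.
  apply: ler_pM; rewrite ?colnorm_ge0 //.
  exact: le_trans (opnorm_ge_unit _ x1) h1.
have g1 : colnorm (A3 *m (A2 *m (A1 *m x))) <= T.
  by rewrite !mulmxA; exact: le_trans (opnorm_ge_unit _ x1) hT.
have g2 : colnorm (A2 *m b) <= o2 by exact: le_trans (opnorm_ge_unit _ b1) h2.
have g3 : opnorm A3 * cabs (wedge b (A1 *m x)) <= o3 * o1.
  exact: ler_pM (opnorm_ge0 _) (cabs_ge0 _) h3 hw.
have g4 := ler_pM (colnorm_ge0 _) (colnorm_ge0 _) g1 g2.
move: h g3 g4.
move: (colnorm _ * colnorm _) (colnorm (A3 *m _) * colnorm _) (opnorm A3)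
   (cabs (wedge _ _)) (o3 * o1) (T * o2) => a b' o w e f.
clear; lra.
Qed.

(* wedge_preserving A2 says that the 2 x 2 matrix A2 has determinant one. *)
Lemma avalanche3 A1 A2 A3 : wedge_preserving A2 ->
  opnorm (A3 *m A2) * opnorm (A2 *m A1) - 2 * (opnorm A3 * opnorm A1) <=
  opnorm (A3 *m A2 *m A1) * opnorm A2.
Proof.
move=> wA2.
have key x b x1 b1 := @avalanche_unit A1 A2 A3 x b _ _ _ _ wA2 x1 b1
  (lexx _) (lexx _) (lexx _) (lexx _).
rewrite lerBlDr; move: key; move: (_ + _) => c key.
have c0 : 0 <= c.
  have := key 0 0; rewrite !mulmx0 !colnorm0 mul0r; exact.
(* The two suprema, over [b] and over [x], are taken one after the other, each after division by the
   other factor; the cases where that factor is zero are trivial. *)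
have [z0|zp] := leP (opnorm (A2 *m A1)) 0.
  by rewrite (le_trans _ c0) // mulr_ge0_le0 ?opnorm_ge0.
rewrite -ler_pdivlMr //; apply: opnorm_le => b b1.
have [z1|zp1] := leP (colnorm (A3 *m A2 *m b)) 0.
  by rewrite (le_trans z1) // divr_ge0 ?opnorm_ge0.
rewrite ler_pdivlMr // mulrC -ler_pdivlMr //; apply: opnorm_le => x x1.
by rewrite ler_pdivlMr // key.
Qed.

Implicit Types v : int -> C.

Definition tstep (s : C) : M2 := block_mx s%:M (- 1)%:M 1%:M 0.

Lemma transferS v E n :
  transfer v E n.+1 = tstep (v n.+1%:Z - E) *m transfer v E n.
Proof. by []. Qed.

Lemma tstep_ent s : [/\ tstep s 0 0 = s, tstep s 0 1 = -1,
   tstep s 1 0 = 1 & tstep s 1 1 = 0].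
Proof.
have e0 : (0 : 'I_(1 + 1)) = lshift 1 0 by apply/val_inj.
have e1 : (1 : 'I_(1 + 1)) = rshift 1 0 by apply/val_inj.
rewrite /tstep e0 e1 block_mxEul block_mxEur block_mxEdl block_mxEdr.
by rewrite !mxE /= !mulr1n.
Qed.

Lemma tstepE s y : ((tstep s *m y) 0 0 = s * y 0 0 - y 1 0) *
                   ((tstep s *m y) 1 0 = y 0 0).
Proof.
have [h1 h2 h3 h4] := tstep_ent s.
by rewrite !mxE !sum2 h1 h2 h3 h4 mulN1r mul1r mul0r addr0.
Qed.

Lemma wedge_transfer v E n : wedge_preserving (transfer v E n).
Proof.
elim: n => [|n IH] y z; first by rewrite !mul1mx.
rewrite transferS -!mulmxA -(IH y z) /wedge !tstepE; ring.
Qed.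

Lemma transferD v E n m : transfer v E (n + m) =
  transfer (fun k => v (k + m%:Z)) E n *m transfer v E m.
Proof.
elim: n => [|n IH]; first by rewrite mul1mx.
rewrite -[(n.+1 + m)%N]/(n + m).+1 !transferS IH mulmxA.
by congr (tstep (v _ - E) *m _ *m _); rewrite -PoszD.
Qed.

(** The images of the two basis vectors span area one, so the square of the norm is at least 1. All
    logarithms of norms below are thereby nonnegative. *)
Lemma opnorm_transfer_ge1 v E n : 1 <= opnorm (transfer v E n).
Proof.
set A := transfer v E n.
pose e (i : 'I_(1 + 1)) : 'cV[C]_(1 + 1) := delta_mx i 0.
have e1 i : colnorm (e i) = 1.
  apply: sqr_inj_ge0; rewrite ?colnorm_ge0 // colnorm_sq (bigD1 i) //=.
  rewrite expr1n mxE !eqxx cabs1 expr1n big1 ?addr0 // => j ji.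
  by rewrite mxE (negbTE ji) cabs0 expr0n.
have := wedge_le (A *m e 0) (A *m e 1).
rewrite wedge_transfer.
have -> : wedge (e 0) (e 1) = 1.
  by rewrite /wedge !mxE !eqxx /= mulr1 mul0r subr0.
rewrite cabs1 => h.
have h0 : colnorm (A *m e 0) <= opnorm A by rewrite opnorm_ge_unit ?e1.
have h1 : colnorm (A *m e 1) <= opnorm A by rewrite opnorm_ge_unit ?e1.
have h2 := ler_pM (colnorm_ge0 _) (colnorm_ge0 _) h0 h1.
have := le_trans h h2; move: (opnorm A) (opnorm_ge0 A) => o; clear => o0.
by case: (leP 1 o) => // o1; nra.
Qed.

Lemma opnorm_tstep s : opnorm (tstep s) <= cabs s + 2.
Proof.
have [h1 h2 h3 h4] := tstep_ent s.
apply: (le_trans (opnorm_le_entries _)).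
rewrite !sum2.
by rewrite h1 h2 h3 h4 cabsN cabs1 cabs0; lra.
Qed.

Lemma opnorm_transfer_le v E n (K : R) : 0 <= K ->
  (forall k : nat, (1 <= k <= n)%N -> cabs (v k%:Z - E) + 2 <= K) ->
  opnorm (transfer v E n) <= K ^+ n.
Proof.
move=> K0; elim: n => [|n IH] h; first by rewrite expr0 opnorm1_le.
rewrite transferS (le_trans (opnormM _ _)) // exprS.
apply: ler_pM; rewrite ?opnorm_ge0 //.
  by rewrite (le_trans (opnorm_tstep _)) // h /=.
by apply: IH => k /andP[k1 kn]; apply: h; rewrite k1 ltnW.
Qed.

(** Telescoping over the factors. The constant, exponential in [n], is harmless because the estimate
    will be used at boundedly many scales only. *)
Lemma transfer_lip v v' E E' n (K delta : R) : 1 <= K -> 0 <= delta ->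
  (forall k : nat, (1 <= k <= n)%N ->
     [/\ cabs (v k%:Z - E) + 2 <= K, cabs (v' k%:Z - E') + 2 <= K &
         cabs ((v k%:Z - E) - (v' k%:Z - E')) <= delta]) ->
  opnorm (transfer v E n - transfer v' E' n) <= n%:R * K ^+ n * delta.
Proof.
move=> K1 d0; have K0 : 0 <= K by lra.
elim: n => [|n IH] h.
  rewrite subrr mul0r mul0r; apply: opnorm_le => u _.
  by rewrite mul0mx colnorm0.
have {}IH : opnorm (transfer v E n - transfer v' E' n) <= n%:R * K ^+ n * delta.
  by apply: IH => k /andP[k1 kn]; apply: h; rewrite k1 ltnW.
have bT : opnorm (transfer v' E' n) <= K ^+ n.
  apply: opnorm_transfer_le K0 _ => k /andP[k1 kn].
  have /h[_ hk _] : (1 <= k <= n.+1)%N by rewrite k1 ltnW.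
  exact: hk.
have [hv hv' hd] := h n.+1 (leqnn _).
set s := v n.+1%:Z - E; set s' := v' n.+1%:Z - E'.
have e : transfer v E n.+1 - transfer v' E' n.+1 =
  tstep s *m (transfer v E n - transfer v' E' n) +
  (tstep s - tstep s') *m transfer v' E' n.
  by rewrite !transferS mulmxBr mulmxBl addrA subrK.
rewrite e (le_trans (opnormD _ _)) //.
have b1 : opnorm (tstep s *m (transfer v E n - transfer v' E' n)) <=
   K * (n%:R * K ^+ n * delta).
  rewrite (le_trans (opnormM _ _)) //; apply: ler_pM; rewrite ?opnorm_ge0 //.
  by rewrite (le_trans (opnorm_tstep _)).
have b2 : opnorm (tstep s - tstep s') <= delta.
  apply: (le_trans (opnorm_le_entries _)); apply: le_trans hd.
  have [h1 h2 h3 h4] := tstep_ent s.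
  have [h1' h2' h3' h4'] := tstep_ent s'.
  have ent i j : (tstep s - tstep s') i j = tstep s i j - tstep s' i j.
    by rewrite mxE; congr (_ + _); rewrite mxE.
  rewrite !sum2 !ent.
  by rewrite h1 h2 h3 h4 h1' h2' h3' h4' !subrr cabs0 !addr0 -/s -/s'.
have b3 : opnorm ((tstep s - tstep s') *m transfer v' E' n) <= delta * K ^+ n.
  rewrite (le_trans (opnormM _ _)) //; apply: ler_pM; rewrite ?opnorm_ge0 //.
apply: (le_trans (lerD b1 b3)).
have Kn : 0 <= K ^+ n by rewrite exprn_ge0.
clear - K1 d0 Kn.
have h5 : delta * K ^+ n <= K * (delta * K ^+ n).
  by rewrite -{1}[delta * _]mul1r ler_wpM2r // mulr_ge0.
rewrite exprS -natr1; move: (n%:R) (K ^+ n) h5 => N p; clear; lra.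
Qed.

End transfer_matrices.

(** * Measurability and averages on the torus *)

Section measurable_on_torus.
Context {R : realType}.
Local Notation RT := (measurableTypeR R).

Let measurable_fun_countable d (X : measurableType d) (g : X -> nat)
    (h : nat -> R) :
  (forall n, measurable [set x | g x = n]) ->
  measurable_fun setT (h \o g).
Proof.
move=> mg _ B mB; rewrite setTI.
have -> : (h \o g) @^-1` B = \bigcup_(n in [set n | B (h n)]) [set x | g x = n].
  apply/seteqP; split => [x /= hx|x [n /= hn gx]]; first by exists (g x).
  by rewrite /= gx.
exact: bigcup_measurable.
Qed.

Let grid d (k : nat) (t : d.-tuple RT) : 'rV[int]_d :=
  \row_i Num.floor (k.+1%:R * tnth t i : R).

Let measurable_grid d k (z : 'rV[int]_d) :
  measurable [set t : d.-tuple RT | grid k t = z].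
Proof.
have -> : [set t | grid k t = z] = \bigcap_(i in [set: 'I_d])
   ((fun t : d.-tuple RT => tnth t i : RT) @^-1`
      [set r : R | (z 0 i)%:~R <= k.+1%:R * r < (z 0 i + 1)%:~R]).
  apply/seteqP; split => t /=.
    move=> <- i _ /=; rewrite !mxE floor_le /=.
    exact: floorD1_gt.
  move=> h; apply/rowP => i; rewrite mxE.
  apply: floor_def; exact: (h i).
apply: fin_bigcap_measurable; first exact: finite_finset.
move=> i _; rewrite -[X in measurable X]setTI.
apply: (measurable_tnth i) => //.
have -> : [set r : R | (z 0 i)%:~R <= k.+1%:R * r < (z 0 i + 1)%:~R] =
   [set` `[(z 0 i)%:~R / k.+1%:R, (z 0 i + 1)%:~R / k.+1%:R[ ].
  apply/seteqP; split => r /=; rewrite in_itv /=.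
    by rewrite ler_pdivrMr // ltr_pdivlMr // mulrC.
  by rewrite ler_pdivrMr // ltr_pdivlMr // mulrC.
exact: measurable_itv.
Qed.

(** Tuples carry the product sigma-algebra, whereas continuity refers to row vectors. The two are
    linked by rounding to the grid of mesh [1 / (k + 1)]: each rounded function takes countably many
    values, coded by [pickle], on measurable cells, and continuity gives pointwise convergence. *)
Lemma measurable_continuous_pt d (F : 'rV[R]_d -> R) : continuous F ->
  measurable_fun setT (fun t : d.-tuple RT => F (pt t)).
Proof.
move=> cF.
pose approx k (t : d.-tuple RT) : 'rV[R]_d :=
  \row_i ((grid k t 0 i)%:~R / k.+1%:R).
apply: (@measurable_fun_cvg _ _ _ _ (fun k t => F (approx k t))) => [k|t _].
  have -> : (fun t => F (approx k t)) =
    (fun n : nat => F (\row_i (((odflt 0 (unpickle n) : 'rV[int]_d) 0 i)%:~R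
       / k.+1%:R))) \o (fun t => pickle (grid k t)).
    by apply/funext => t; rewrite /= pickleK.
  apply: measurable_fun_countable => n.
  case: (pselect (exists z : 'rV[int]_d, pickle z = n)) => [[z <-]|nz].
    rewrite (_ : mkset _ = [set t | grid k t = z]); first exact: measurable_grid.
    by apply/seteqP; split => t /=; [move=> /(pcan_inj pickleK)|move=> ->].
  rewrite (_ : mkset _ = set0) //.
  by apply/seteqP; split => t //= e; apply: nz; exists (grid k t).
apply: (@cvg_comp _ _ _ (approx ^~ t) F _ (nbhs (pt t))); last exact: cF.
apply/cvg_ballP => e e0.
near=> k; split=> // i j; rewrite /ball /= !mxE /=.
set r : R := tnth t j.
have k0 : 0 < k.+1%:R :> R by [].
have h1 : (Num.floor (k.+1%:R * r))%:~R <= k.+1%:R * r by exact: floor_le.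
have h2 := floorD1_gt (k.+1%:R * r).
rewrite intrD in h2.
have h3 : k.+1%:R * e > 1.
  rewrite mulrC -ltr_pdivrMl // mulr1.
  near: k; exists (Num.truncn e^-1) => // k /= hk.
  rewrite (lt_le_trans (truncnS_gt _)) // ler_nat ltnS //.
have hq : k.+1%:R * ((Num.floor (k.+1%:R * r))%:~R / k.+1%:R) =
   (Num.floor (k.+1%:R * r))%:~R :> R by rewrite mulrC divfK ?lt0r_neq0.
rewrite ltr_distlC; apply/andP; split;
  rewrite -(ltr_pM2l k0) ?mulrBr ?mulrDr hq; lra.
Unshelve. all: by end_near.
Qed.

End measurable_on_torus.

#[local] Opaque transfer.

Section analytic_potential_facts.
Context {R : realType} {d : nat} {V : 'rV[R]_d -> R} {rho : R}
  {W : 'rV[R[i]]_d -> R[i]}.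
Hypothesis hV : analytic_potential V rho W.

Lemma potential_bounded : exists2 M : R, 0 <= M & forall x, `|V x| <= M.
Proof.
have [M hM] := ap_bound hV.
have h x : `|V x| <= M.
  have := hM x 0; rewrite normr0 => /(_ (ap_rho hV)).
  by rewrite (ap_ext hV) cabs_real.
by exists M => //; exact: le_trans (normr_ge0 _) (h 0).
Qed.

Lemma potential_continuous : continuous V.
Proof.
move=> x.
have h0 : `|0 : 'rV[R]_d| < rho by rewrite normr0; exact: ap_rho hV.
have cW := differentiable_continuous (@ap_holo _ _ _ _ _ hV x 0 h0).
apply/(@cvgrPdist_le _ _ _ (nbhs x)) => e e0.
have e0' : 0 < (e%:C)%C :> R[i] by rewrite ltcR.
move/(@cvgrPdist_le _ _ _ (nbhs _)) : cW => /(_ _ e0').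
move=> /nbhs_ballP [r /= r0 hr].
(* Radii of balls over [R[i]] are elements of [R[i]]; being positive, they are real. *)
have rE : r = ((complex.Re r)%:C)%C.
  by rewrite RRe_real // gtr0_real.
have rr : 0 < complex.Re r by move: r0; rewrite rE ltcR.
near=> y.
have : (ball (Defs.cpoint x 0 : 'rV[R[i]^o]_d) r) (Defs.cpoint y 0).
  split=> // i j; rewrite /ball /= !mxE /=.
  have : ball (x : 'rV[R]_d) (complex.Re r) y.
    near: y; exact: nbhsx_ballx.
  move=> [_ /(_ i j)]; rewrite /ball /= ord1.
  have -> : Complex (x 0 j) 0 - Complex (y 0 j) 0 = ((x 0 j - y 0 j)%:C)%C.
    by rewrite rmorphB.
  by rewrite cabsE cabs_real [X in _ -> _ < X]rE ltcR.
move=> /hr /=; rewrite !(ap_ext hV) -rmorphB cabsE cabs_real lecR.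
done.
Unshelve. all: by end_near.
Qed.

End analytic_potential_facts.

(** The last hypothesis makes the error [2 * (a3 * a1)] at most half of [a32 * a21]; the other half
    costs [ln 2]. *)
Lemma avalanche_log {R : realType} (a1 a2 a3 a32 a21 a321 : R) :
  a32 * a21 - 2 * (a3 * a1) <= a321 * a2 ->
  1 <= a1 -> 1 <= a2 -> 1 <= a3 -> 1 <= a32 -> 1 <= a21 -> 1 <= a321 ->
  ln a3 + ln a1 + ln 4 <= ln a32 + ln a21 ->
  ln a32 + ln a21 - ln 2 <= ln a321 + ln a2.
Proof.
move=> h g1 g2 g3 g32 g21 g321.
have p32 : 0 < a32 by lra. have p21 : 0 < a21 by lra.
have p321 : 0 < a321 by lra. have p1 : 0 < a1 by lra.
have p2 : 0 < a2 by lra. have p3 : 0 < a3 by lra.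
rewrite -!lnM ?posrE ?mulr_gt0 // ler_ln ?posrE ?mulr_gt0 // => h4.
rewrite -ln_div ?posrE ?mulr_gt0 // ler_ln ?posrE ?mulr_gt0 ?invr_gt0 //.
lra.
Qed.

Section transfer_growth.
Context {R : realType} {d : nat}.
Local Notation C := R[i].
Variables (v : 'rV[R]_d -> int -> C) (omega : 'rV[R]_d) (Bv : R).
Hypothesis v_bound : forall x k, cabs (v x k) <= Bv.
Hypothesis v_cont : forall x (k : int) (e : R), 0 < e ->
  \forall y \near x, cabs (v y k - v x k) <= e.
Hypothesis v_per : forall x (m : 'rV[int]_d), v (x + map_mx intr m) = v x.
Hypothesis v_shift : forall x (m : int),
  v (x + omega *~ m) = fun k => v x (k + m).

Definition growth (E : C) (n : nat) (x : 'rV[R]_d) : R :=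
  ln (opnorm (transfer (v x) E n)).

Variable B : R.
Hypothesis B_ge0 : 0 <= B.
Let K : R := Bv + B + 2.

Let Bv_ge0 : 0 <= Bv.
Proof. exact: le_trans (cabs_ge0 (v 0 0)) (v_bound _ _). Qed.

Let K_ge1 : 1 <= K. Proof. rewrite /K; move: Bv_ge0 B_ge0; lra. Qed.

Let step_bound E x k : cabs E <= B -> cabs (v x k - E) + 2 <= K.
Proof.
move=> hE; have := cabsD (v x k) (- E); rewrite cabsN => h.
have := v_bound x k; rewrite /K; lra.
Qed.

Lemma growth_ge0 E n x : 0 <= growth E n x.
Proof. by rewrite ln_ge0 // opnorm_transfer_ge1. Qed.

Lemma growth_le E n x : cabs E <= B -> growth E n x <= n%:R * ln K.
Proof.
move=> hE; rewrite mulr_natl -lnXn; last by move: K_ge1; lra.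
have K0 : 0 < K by move: K_ge1; lra.
rewrite ler_ln ?posrE ?exprn_gt0 //; last first.
  exact: lt_le_trans (opnorm_transfer_ge1 _ _ _).
apply: opnorm_transfer_le => [|k _]; [exact: ltW|exact: step_bound].
Qed.

Let ln_lip (a b : R) : 1 <= a -> 1 <= b -> `|ln a - ln b| <= `|a - b|.
Proof.
wlog ab : a b / b <= a.
  move=> h a1 b1; case: (leP b a) => ab; first exact: h.
  by rewrite distrC [leRHS]distrC; apply: h => //; exact: ltW.
move=> a1 b1.
have b0 : 0 < b by lra.
have a0 : 0 < a by lra.
rewrite !ger0_norm ?subr_ge0 ?ler_ln ?posrE //.
rewrite -ln_div ?posrE //.
have -> : a / b = 1 + (a - b) / b by field; lra.
rewrite (le_trans (le_ln1Dx _)) //.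
  by rewrite (lt_le_trans (ltrN10 _)) // divr_ge0 ?subr_ge0 // ltW.
by rewrite ler_pdivrMr // ler_peMr // subr_ge0.
Qed.

Let growth_lip E E' n x x' (delta : R) : cabs E <= B -> cabs E' <= B ->
  0 <= delta ->
  (forall k : nat, (1 <= k <= n)%N ->
    cabs ((v x k%:Z - E) - (v x' k%:Z - E')) <= delta) ->
  `|growth E n x - growth E' n x'| <= n%:R * K ^+ n * delta.
Proof.
move=> hE hE' d0 h.
apply: le_trans (ln_lip (opnorm_transfer_ge1 _ _ _) (opnorm_transfer_ge1 _ _ _)) _.
apply: le_trans (opnorm_sub_le _ _) _.
apply: transfer_lip K_ge1 d0 _ => k hk.
by split; [exact: step_bound|exact: step_bound|exact: h].
Qed.

Lemma growth_lip_energy E E' n x : cabs E <= B -> cabs E' <= B ->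
  `|growth E n x - growth E' n x| <= n%:R * K ^+ n * cabs (E - E').
Proof.
move=> hE hE'; apply: growth_lip => //; first exact: cabs_ge0.
move=> k _; rewrite opprB addrC addrA subrK cabsB; exact: lexx.
Qed.

Lemma growth_continuous E n : cabs E <= B -> continuous (growth E n).
Proof.
move=> hE x; apply/(@cvgrPdist_le _ _ _ (nbhs x)) => e e0.
pose c := n%:R * K ^+ n + 1.
have c0 : 0 < c.
  rewrite /c ltr_wpDl // mulr_ge0 // exprn_ge0 //; move: K_ge1; lra.
have ec0 : 0 < e / c by rewrite divr_gt0.
have h k : \forall y \near x, cabs (v y k - v x k) <= e / c by exact: v_cont.
have H : \forall y \near x, forall k : 'I_n.+1, cabs (v y k%:Z - v x k%:Z) <= e / c.
  exact: filter_forall (fun k : 'I_n.+1 => h k%:Z).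
near=> y.
have hy : forall k : 'I_n.+1, cabs (v y k%:Z - v x k%:Z) <= e / c by near: y.
apply: (@le_trans _ _ (n%:R * K ^+ n * (e / c))).
  apply: growth_lip => //; first exact: ltW.
  move=> k /andP[_ kn]; rewrite opprB addrA subrK cabsB.
  exact: (hy (Ordinal (kn : (k < n.+1)%N))).
apply: (@le_trans _ _ (c * (e / c))).
  by rewrite ler_wpM2r ?ltW // /c ltrDl.
by rewrite mulrC divfK // lt0r_neq0.
Unshelve. all: by end_near.
Qed.

Lemma growth_periodic E n x (m : 'rV[int]_d) :
  growth E n (x + map_mx intr m) = growth E n x.
Proof. by rewrite /growth v_per. Qed.

Lemma transfer_shiftD E n m x : transfer (v x) E (n + m) =
  transfer (v (x + omega *~ m)) E n *m transfer (v x) E m.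
Proof. by rewrite transferD v_shift. Qed.

Lemma growth_subadd E n m x :
  growth E (n + m) x <= growth E n (x + omega *~ m) + growth E m x.
Proof.
rewrite /growth transfer_shiftD.
have h1 := opnorm_transfer_ge1 (v (x + omega *~ m)) E n.
have h2 := opnorm_transfer_ge1 (v x) E m.
have h3 := opnorm_transfer_ge1 (v x) E (n + m).
rewrite transfer_shiftD in h3.
rewrite -lnM ?posrE; [|exact: lt_le_trans h1|exact: lt_le_trans h2].
rewrite ler_ln ?posrE; first exact: opnormM.
  exact: lt_le_trans h3.
apply: mulr_gt0; [exact: lt_le_trans h1|exact: lt_le_trans h2].
Qed.

(** Blocks of lengths [q], [n], [p] follow each other along the orbit. The avalanche principle
    reverses subadditivity for the two overlapping blocks, once the overlap [n] has been counted
    twice. *)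
Lemma growth_superadd E p n q x :
  growth E p (x + omega *~ (n + q)%N) + growth E q x + ln 4 <=
    growth E (p + n) (x + omega *~ q) + growth E (n + q) x ->
  growth E (p + n) (x + omega *~ q) + growth E (n + q) x - ln 2 <=
    growth E (p + n + q) x + growth E n (x + omega *~ q).
Proof.
have xE : x + omega *~ (n + q)%N = x + omega *~ q + omega *~ n.
  by rewrite PoszD mulrzDr [X in x + X = _]addrC addrA.
rewrite /growth xE !transfer_shiftD.
set A1 := transfer (v x) E q.
set A2 := transfer (v (x + omega *~ q)) E n.
set A3 := transfer _ E p.
have h := @avalanche3 _ A1 A2 A3 (@wedge_transfer _ _ _ _).
have g1 : 1 <= opnorm A1 by exact: opnorm_transfer_ge1.
have g2 : 1 <= opnorm A2 by exact: opnorm_transfer_ge1.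
have g3 : 1 <= opnorm A3 by exact: opnorm_transfer_ge1.
have g32 : 1 <= opnorm (A3 *m A2).
  by rewrite -transfer_shiftD; exact: opnorm_transfer_ge1.
have g21 : 1 <= opnorm (A2 *m A1).
  by rewrite -transfer_shiftD; exact: opnorm_transfer_ge1.
have g321 : 1 <= opnorm (A3 *m A2 *m A1).
  by rewrite -!transfer_shiftD; exact: opnorm_transfer_ge1.
exact: avalanche_log h g1 g2 g3 g32 g21 g321.
Qed.

End transfer_growth.

Section torus_mean.
Context {R : realType} {d : nat}.
Local Notation RT := (measurableTypeR R).
Implicit Types (f g : 'rV[R]_d -> R).

Definition nice g := measurable_fun setT (fun t : d.-tuple RT => g (pt t)) /\
  exists M : R, forall x, `|g x| <= M.

Definition mean g : R := \int[haar d]_(t in setT) g (pt t).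

Lemma nice_measurable g : nice g ->
  measurable_fun setT (fun t : d.-tuple RT => g (pt t)).
Proof. by case. Qed.

Lemma nice_integrable g : nice g ->
  (haar d).-integrable setT (EFin \o (fun t => g (pt t))).
Proof.
move=> [mg [M hM]]; apply: measurable_bounded_integrable => //.
  exact: le_lt_trans (probability_le1 (haar d) measurableT) (ltry 1).
exists M; split; first exact: num_real.
by move=> x Mx t _; exact: le_trans (hM _) (ltW Mx).
Qed.

Lemma niceD f g : nice f -> nice g -> nice (fun x => f x + g x).
Proof.
move=> [mf [M hM]] [mg [N hN]]; split; first exact: measurable_funD.
exists (M + N) => x; exact: le_trans (ler_normD _ _) (lerD _ _).
Qed.

Lemma niceZ (c : R) g : nice g -> nice (fun x => c * g x).
Proof.
move=> [mg [N hN]]; split; first exact: measurable_funM.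
by exists (`|c| * N) => x; rewrite normrM ler_wpM2l.
Qed.

Lemma nice_cst (c : R) : nice (fun=> c).
Proof. by split; [exact: measurable_cst|exists `|c|]. Qed.

Lemma meanD f g : nice f -> nice g -> mean (fun x => f x + g x) = mean f + mean g.
Proof. by move=> nf ng; rewrite /mean RintegralD //; exact: nice_integrable. Qed.

Lemma meanZ (c : R) g : nice g -> mean (fun x => c * g x) = c * mean g.
Proof. by move=> ng; rewrite /mean RintegralZl //; exact: nice_integrable. Qed.

Lemma mean_cst (c : R) : mean (fun=> c) = c.
Proof.
rewrite /mean Rintegral_cst //.
transitivity (c * fine (1%E : \bar R)); last by rewrite mulr1.
by congr (_ * fine _); exact: (probability_setT (haar (R := R) d)).
Qed.

Lemma mean_le f g : nice f -> nice g -> (forall x, f x <= g x) -> mean f <= mean g.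
Proof.
by move=> nf ng fg; apply: le_Rintegral => //; exact: nice_integrable.
Qed.

Lemma mean_ge0 g : (forall x, 0 <= g x) -> 0 <= mean g.
Proof. by move=> g0; apply: Rintegral_ge0 => t _. Qed.

Let pt_tshift (a : 'rV[R]_d) t : pt (tshift (fun i => a 0 i) t) = pt t + a.
Proof. by apply/rowP => i; rewrite !mxE tnth_mktuple. Qed.

Lemma nice_shift (a : 'rV[R]_d) g : nice g -> nice (fun x => g (x + a)).
Proof.
move=> [mg [M hM]]; split; last by exists M.
have -> : (fun t : d.-tuple RT => g (pt t + a)) =
  (fun t => g (pt t)) \o tshift (fun i => a 0 i).
  by apply/funext => t /=; rewrite pt_tshift.
exact: (measurableT_comp mg (measurable_tshift _)).
Qed.

Lemma mean_shift (a : 'rV[R]_d) g : nice g -> (forall x, 0 <= g x) ->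
  (forall x (m : 'rV[int]_d), g (x + map_mx intr m) = g x) ->
  mean (fun x => g (x + a)) = mean g.
Proof.
move=> [mg _] g0 gper; rewrite /mean /Rintegral; congr fine.
pose F (t : d.-tuple RT) := (g (pt t))%:E.
pose ai i := a 0 i.
transitivity (\int[haar d]_t F (tshift ai t))%E.
  by apply: eq_integral => t _; rewrite /F pt_tshift.
apply: haar_shift => [|t|m t].
- exact/measurable_EFinP.
- by rewrite lee_fin.
- rewrite /F -(gper (pt t) (\row_i m i)); congr (g _)%:E.
  by apply/rowP => i; rewrite !mxE tnth_mktuple.
Qed.

(** [mes] is an infimum over measurable supersets; each of these bounds the measure of the set,
    which is itself measurable here. *)
Lemma mean_indicator (b : 'rV[R]_d -> bool) (e : R) :
  measurable_fun setT (fun t : d.-tuple RT => b (pt t)) ->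
  (mes [set x | b x] < e%:E)%E ->
  nice (fun x => (b x)%:R) /\ mean (fun x => (b x)%:R) <= e.
Proof.
move=> mb he.
pose A := [set t : d.-tuple RT | b (pt t)].
have mA : measurable A.
  rewrite (_ : A = setT `&` (fun t : d.-tuple RT => b (pt t)) @^-1` [set true]).
    exact: mb.
  by rewrite setTI.
have eA : (fun t : d.-tuple RT => (b (pt t))%:R) = \1_A :> (_ -> R).
  apply/funext => t; rewrite indicE; case bE : (b (pt t)).
    by rewrite mem_set.
  by rewrite memNset //= /A /= bE.
split.
  split; last by exists 1 => x; case: (b x); rewrite ?normr1 ?normr0.
  by rewrite eA; exact: measurable_indic.
rewrite /mean eA /Rintegral integral_indic // setIT.
have hA : (haar d A <= e%:E)%E.
  move: he => /ereal_inf_lt[_ [B [mB AB] <-]] /ltW; apply: le_trans.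
  by apply: le_measure; rewrite ?inE.
by rewrite -lee_fin fineK // ge0_fin_numE // (le_lt_trans hA) ?ltry.
Qed.

End torus_mean.

Section fekete.
Context {R : realType}.

(** Fekete's lemma. Besides the limit, the second conclusion is needed: the limit is also the
    infimum, so it bounds the average at every scale from below. *)
Lemma fekete (u : nat -> R) (c : R) : (forall n, 0 <= u n <= n%:R * c) ->
  (forall n m, u (n + m)%N <= u n + u m) ->
  exists2 l : R, (fun n => n%:R^-1 * u n) @ \oo --> l &
    forall n, (0 < n)%N -> n%:R * l <= u n.
Proof.
move=> ub us.
pose w n := n%:R^-1 * u n.
have c0 : 0 <= c.
  by have /andP[h1 h2] := ub 1%N; rewrite mul1r in h2; exact: le_trans h1 h2.
pose S := [set w n | n in [set n | (0 < n)%N]].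
have hS : has_inf S.
  split; first by exists (w 1%N), 1%N.
  exists 0 => _ [n /= n0 <-]; rewrite /w mulr_ge0 ?invr_ge0 //.
  by have /andP[] := ub n.
have wl n : (0 < n)%N -> inf S <= w n.
  by move=> n0; apply: (ge_inf hS.2); exists n.
exists (inf S); last first.
  move=> n n0; rewrite -ler_pdivlMl ?ltr0n //; exact: wl.
have um m q : (u (q * m)%N <= q%:R * u m).
  elim: q => [|q IH]; first by have /andP[_] := ub 0%N; rewrite !mul0r.
  by rewrite mulSn (le_trans (us _ _)) // -natr1 mulrDl mul1r addrC lerD2r.
apply/cvgrPdist_le => /= e e0.
have [_ [m /= m0 <-] hm] := inf_adherent (eps := e / 2) (divr_gt0 e0 (ltr0n _ 2)) hS.
near=> n.
have n0 : (0 < n)%N by near: n; exists 1%N.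
have nN : m%:R * c <= n%:R * (e / 2).
  rewrite -ler_pdivrMr; last by lra.
  near: n; exists (Num.truncn (m%:R * c / (e / 2))).+1 => // n /= hn.
  by rewrite (le_trans (ltW (truncnS_gt _))) // ler_nat.
have n0' : 0 < n%:R :> R by rewrite ltr0n.
rewrite distrC ler_norml; apply/andP; split.
  by have := wl n n0; rewrite /w; lra.
suff : w n <= inf S + e by rewrite /w; lra.
rewrite /w ler_pdivrMl //.
(* Split [n] into a multiple of the nearly optimal [m] and a remainder, which costs at most [m * c]
   and is negligible against [n * (e / 2)]. *)
rewrite [in leLHS](divn_eq n m).
have h1 := us (n %/ m * m)%N (n %% m)%N.
have h2 := um m (n %/ m)%N.
have /andP[_ h3] := ub (n %% m)%N.
have h4 : (n %% m)%:R * c <= m%:R * c.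
  by rewrite ler_wpM2r // ler_nat ltnW // ltn_pmod.
have h5 : u m <= m%:R * (inf S + e / 2).
  by rewrite -ler_pdivrMl ?ltr0n // ltW.
have h6 : (n %/ m)%:R * u m <= (n %/ m * m)%:R * (inf S + e / 2).
  by rewrite natrM -mulrA ler_wpM2l.
have S0 : 0 <= inf S.
  apply: lb_le_inf; first exact: hS.1.
  move=> _ [k /= k0 <-]; rewrite /w mulr_ge0 ?invr_ge0 //.
  by have /andP[] := ub k.
have h7 : (n %/ m * m)%:R * (inf S + e / 2) <= n%:R * (inf S + e / 2).
  rewrite ler_wpM2r ?ler_nat ?leq_trunc_div //; lra.
lra.
Unshelve. all: by end_near.
Qed.

End fekete.

#[local] Opaque ln expR powR.

Lemma le_of_eq {R : realType} (x y : R) : x = y -> x <= y.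
Proof. by move=> ->. Qed.

Section large_scales.
Context {R : realType}.

Lemma powR_large (s A : R) : 0 < s ->
  exists n0 : nat, forall x : R, n0%:R <= x -> A <= x `^ s.
Proof.
move=> s0; pose a := Num.max A 1.
exists (Num.truncn (a `^ s^-1)).+1 => x hx.
have a1 : 1 <= a by rewrite le_max lexx orbT.
apply: (@le_trans _ _ a); first by rewrite le_max lexx.
have -> : a = (a `^ s^-1) `^ s.
  by rewrite -powRrM mulVf ?gt_eqF // powRr1 //; lra.
apply: ge0_ler_powR; rewrite ?nnegrE ?powR_ge0 //.
- exact: ltW.
- exact: le_trans hx.
- exact: le_trans (ltW (truncnS_gt _)) hx.
Qed.

Lemma powR_sublinear (s e : R) : 0 < s -> 0 < e ->
  exists n0 : nat, forall x : R, n0%:R <= x -> x `^ (1 - s) <= e * x.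
Proof.
move=> s0 e0; have [n0 h] := @powR_large s e^-1 s0.
exists n0.+1 => x hx.
have x0 : 0 < x by apply: lt_le_trans hx; rewrite ltr0n.
have {}h : e^-1 <= x `^ s by apply: h; apply: le_trans hx; rewrite ler_nat.
have xs0 : 0 < x `^ s by exact: powR_gt0.
have -> : x `^ (1 - s) = x / x `^ s.
  by rewrite powRB ?powRr1 ?(ltW x0) // (gt_eqF x0) implybT.
have h1 : 1 <= e * x `^ s by rewrite -ler_pdivrMl // mulr1.
by rewrite ler_pdivrMr // -mulrA [x * _]mulrC mulrA ler_peMl // ltW.
Qed.

Lemma expR_powR_small (s A : R) : 0 < s ->
  exists n0 : nat, forall n : nat, (n0 <= n)%N ->
    A * n%:R * expR (- n%:R `^ s) <= 1.
Proof.
move=> s0; have s20 : 0 < s / 2 by lra.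
have [n0 h] := @powR_large (s / 2) (4 / s) s20.
pose a := Num.max A 1.
exists (maxn n0 (Num.truncn a).+1) => n; rewrite geq_max => /andP[hn ha].
have nn : 0 < n%:R :> R by rewrite ltr0n (leq_trans _ ha).
have {}h : 4 / s <= n%:R `^ (s / 2) by apply: h; rewrite ler_nat.
set y := n%:R `^ (s / 2) in h.
have y0 : 0 < y by exact: powR_gt0.
(* [ln y <= y] bounds [ln n] by [2 / s * y], and [4 / s <= y] turns this into
   [2 ln n <= y * y = n^s]; the exponential is then at most [n^-2]. *)
have ys : n%:R `^ s = y * y.
  rewrite -powRD ?(gt_eqF nn) ?implybT //; congr (_ `^ _); lra.
have ln1 : ln n%:R <= 2 / s * y.
  have : ln y <= y by exact: le_trans (ltW (ln_sublinear y0)) _.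
  rewrite ln_powR => h1.
  apply: (@le_trans _ _ (2 / s * (s / 2 * ln n%:R))).
    by apply: le_of_eq; field; lra.
  by rewrite ler_wpM2l // divr_ge0 // ltW.
have h2 : 2 * ln n%:R <= n%:R `^ s.
  rewrite ys; apply: (@le_trans _ _ (4 / s * y)); last first.
    by apply: ler_wpM2r => //; exact: ltW.
  have -> : 4 / s * y = 2 * (2 / s * y) by field; lra.
  by rewrite ler_wpM2l.
have h3 : expR (- n%:R `^ s) <= (n%:R ^+ 2)^-1.
  have -> : n%:R ^+ 2 = expR (2 * ln n%:R) :> R.
    by rewrite mulr_natl -lnXn // lnK // posrE exprn_gt0.
  by rewrite -expRN ler_expR lerN2.
have an : a <= n%:R.
  by apply: le_trans (ltW (truncnS_gt _)) _; rewrite ler_nat.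
have a1 : A <= a by rewrite le_max lexx.
have a2 : 1 <= a by rewrite le_max lexx orbT.
apply: (@le_trans _ _ (a * n%:R * (n%:R ^+ 2)^-1)).
  apply: (@le_trans _ _ (a * n%:R * expR (- n%:R `^ s))).
    by rewrite ler_wpM2r ?expR_ge0 // ler_wpM2r // ltW.
  by rewrite ler_wpM2l // mulr_ge0 //; lra.
have -> : a * n%:R * (n%:R ^+ 2)^-1 = a / n%:R by field; exact: lt0r_neq0.
by rewrite ler_pdivrMr // mul1r.
Qed.

End large_scales.

(** * Lower bounds for the Lyapunov exponent *)

Lemma superadd_good {R : realFieldType} (a1 a2 a3 a4 r1 r2 r3 r4 z1 z2 z3 z4 l : R) :
  a1 + a2 + (r1 + r2 + r3 + r4) + l <= a3 + a4 ->
  (z1 - a1 <= r1) -> (z2 - a2 <= r2) -> (- r3 <= z3 - a3) -> (- r4 <= z4 - a4) ->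
  z1 + z2 + l <= z3 + z4.
Proof. lra. Qed.

Lemma superadd_bad {R : realFieldType} (z1 z2 z3 z4 y1 y2 y3 M l : R) :
  z1 <= y2 -> z4 <= y3 -> 0 <= z3 -> 0 <= z2 -> M <= y1 -> y2 + y3 = M -> 0 <= l ->
  z1 + z4 <= z3 + z2 + (l + y1).
Proof. lra. Qed.

(** Here and in [double_step2], [A1], ..., [A4] are the averages at scales n, 2n, 3n, 4n. Each use
    of the avalanche principle loses at most 2, so the gap [g = A2 - A1] becomes at least
    [2 * g - 4] at the doubled scale. The gap is therefore required in the form [cn + 4], because 4
    is the fixed point of this map. *)
Lemma double_step1 {R : realFieldType} (A1 A2 A3 r1 r2 r4 l4 l2 err cn : R) :
  (A1 + A1 + (r1 + r1 + r2 + r2) + l4 <= A2 + A2 ->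
   A2 + A2 <= A3 + A1 + l2 + err) ->
  cn + 4 <= A2 - A1 -> 4 * r4 + l4 <= 2 * cn -> r1 <= r4 -> r2 <= r4 ->
  l2 <= 1 -> err <= 1 -> A2 - A1 - 2 <= A3 - A2.
Proof.
move=> s h1 h2 h3 h4 h5 h6.
have : A2 + A2 <= A3 + A1 + l2 + err by apply: s; lra.
lra.
Qed.

Lemma double_step2 {R : realFieldType} (A1 A2 A3 A4 r1 r2 r3 r4 l4 l2 err cn : R) :
  (A2 + A1 + (r2 + r1 + r3 + r2) + l4 <= A3 + A2 ->
   A3 + A2 <= A4 + A1 + l2 + err) ->
  cn + 4 <= A2 - A1 -> 4 * r4 + l4 <= 2 * cn -> r1 <= r4 -> r2 <= r4 -> r3 <= r4 ->
  l2 <= 1 -> err <= 1 -> A2 - A1 - 2 <= A3 - A2 ->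
  2 * cn + 4 <= A4 - A2.
Proof.
move=> s h1 h2 h3 h4 h5 h6 h7 h8.
have : A3 + A2 <= A4 + A1 + l2 + err by apply: s; lra.
lra.
Qed.

Lemma double_nat (n0 n : nat) : (n0 <= n)%N ->
  [/\ [/\ n <= 4 * n, 2 * n <= 4 * n & 3 * n <= 4 * n],
      [/\ n <= 2 * n, n <= 3 * n, n0 <= 2 * n & n0 <= 3 * n],
      [/\ n + n = 2 * n, 2 * n + n = 3 * n & 3 * n + n = 2 * (2 * n)] &
      (3 * n + n <= 5 * n) /\ (3 * n + n + n <= 5 * n)]%N.
Proof. by move=> h; split; [split|split|split|split]; lia. Qed.

Lemma linear_step {R : realFieldType} (c N n A A2 : R) :
  c * N - c * n <= A -> c * N + 4 <= A2 - A -> c * (2 * N) - c * n <= A2.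
Proof. lra. Qed.

Lemma below_gap {R : realFieldType} (c l p n A : R) :
  c * (p * n) - c * n <= A -> A < p * n * (l + (c - l) / 2) ->
  c <= p * ((c - l) / 2) -> 0 < n -> False.
Proof.
move=> h1 h2 h3 n0.
have := ler_wpM2r (ltW n0) h3; lra.
Qed.

Section lyapunov.
Context {R : realType} {d : nat}.
Local Notation C := R[i].
Variables (v : 'rV[R]_d -> int -> C) (omega : 'rV[R]_d) (Bv : R).
Hypothesis v_bound : forall x k, cabs (v x k) <= Bv.
Hypothesis v_cont : forall x (k : int) (e : R), 0 < e ->
  \forall y \near x, cabs (v y k - v x k) <= e.
Hypothesis v_per : forall x (m : 'rV[int]_d), v (x + map_mx intr m) = v x.
Hypothesis v_shift : forall x (m : int),
  v (x + omega *~ m) = fun k => v x (k + m).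
Variables (B : R) (B_ge0 : 0 <= B).
Let K : R := Bv + B + 2.

Let Kge1 : 1 <= K.
Proof.
have : 0 <= Bv by exact: le_trans (cabs_ge0 (v 0 0)) (v_bound _ _).
rewrite /K; move: B_ge0; lra.
Qed.

Definition avg (E : C) (n : nat) : R := mean (growth v E n).

Lemma avgE E n : avg E n = mean (growth v E n). Proof. by []. Qed.

Lemma LN_avg E n : LN v E n = n%:R^-1 * avg E n.
Proof. by []. Qed.

#[local] Opaque mean avg.

Lemma nice_growth E n : cabs E <= B -> nice (growth v E n).
Proof.
move=> hE; split.
  apply: measurable_continuous_pt; exact: (growth_continuous v_bound v_cont B_ge0).
exists (n%:R * ln K) => x.
by rewrite ger0_norm ?growth_ge0 // (growth_le v_bound B_ge0).
Qed.

#[local] Opaque growth nice.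

Lemma avg_bounds E n : cabs E <= B -> 0 <= avg E n <= n%:R * ln K.
Proof.
move=> hE; rewrite avgE; apply/andP; split.
  by apply: mean_ge0 => x; exact: growth_ge0.
rewrite -[leRHS](@mean_cst R d); apply: mean_le; first exact: nice_growth.
  exact: nice_cst.
by move=> x; rewrite (growth_le v_bound B_ge0).
Qed.

Lemma mean_growth_shift E n (a : 'rV[R]_d) : cabs E <= B ->
  mean (fun x => growth v E n (x + a)) = avg E n.
Proof.
move=> hE; rewrite avgE; apply: mean_shift; first exact: nice_growth.
  by move=> x; exact: growth_ge0.
by move=> x m; exact: growth_periodic.
Qed.

Lemma avg_subadd E n m : cabs E <= B -> avg E (n + m) <= avg E n + avg E m.
Proof.
move=> hE.
have nm := nice_growth n hE; have nmm := nice_growth m hE.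
have e := mean_growth_shift n (omega *~ m) hE.
have -> : avg E n + avg E m =
    mean (fun x => growth v E n (x + omega *~ m) + growth v E m x).
  rewrite meanD; [|exact: nice_shift|exact: nmm].
  by apply: f_equal2; [exact: (esym e)|exact: avgE].
rewrite avgE; apply: mean_le; first exact: nice_growth.
  exact: (niceD (nice_shift _ nm) nmm).
by move=> x; exact: growth_subadd.
Qed.

Lemma lyap_cvg E : cabs E <= B -> (LN v E @ \oo --> Lyap v E) /\
  forall n, (0 < n)%N -> n%:R * Lyap v E <= avg E n.
Proof.
move=> hE.
have [l hl lle] := @fekete R (avg E) (ln K) (fun n => avg_bounds n hE)
  (fun n m => avg_subadd n m hE).
have -> : Lyap v E = l by apply: cvg_lim => //; exact: hl.
by split.
Qed.

Lemma avg_lip E E' n : cabs E <= B -> cabs E' <= B ->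
  avg E n <= avg E' n + n%:R * K ^+ n * cabs (E - E').
Proof.
move=> hE hE'; have e : avg E' n + n%:R * K ^+ n * cabs (E - E') =
    mean (fun x => growth v E' n x + n%:R * K ^+ n * cabs (E - E')).
  rewrite meanD; [|exact: nice_growth|exact: nice_cst].
  by apply: f_equal2; [exact: avgE|exact: (esym (mean_cst _))].
rewrite e avgE; apply: mean_le; first exact: nice_growth.
  apply: niceD; [exact: nice_growth|exact: nice_cst].
move=> x; have := growth_lip_energy v_bound B_ge0 n x hE hE'.
by move=> /ler_normlP[_]; rewrite lerBlDl.
Qed.

Variables (E : C) (hE : cabs E <= B) (r eta : nat -> R).

Definition deviates N := (mes [set x : 'rV[R]_d |
  (r N < `|growth v E N x - avg E N|)%R] < (eta N)%:E)%E.

Let ind N x : bool := r N < `|growth v E N x - avg E N|.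

Let ind_mean N (a : 'rV[R]_d) : deviates N ->
  nice (fun x => (ind N (x + a))%:R : R) /\
  mean (fun x => (ind N (x + a))%:R : R) <= eta N.
Proof.
move=> hN.
have [ng mi] : nice (fun x => (ind N x)%:R : R) /\
               mean (fun x => (ind N x)%:R : R) <= eta N.
  apply: mean_indicator => //.
  apply: measurable_fun_ltr => //; apply: measurableT_comp => //.
  by apply: measurable_funB => //; exact: nice_measurable (nice_growth N hE).
split; first exact: nice_shift ng.
apply: le_trans mi; apply: le_of_eq.
refine (mean_shift a ng _ _) => [x|x m]; first exact: ler0n.
by rewrite /ind (growth_periodic v_per).
Qed.

(** Outside the four deviation sets every growth is within [r] of its average, so the gap assumed
    for the averages gives the pointwise gap that [growth_superadd] asks for. On those sets the
    trivial bound [n * ln K] is used; the indicators, integrated, give the last term. *)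
Lemma avg_superadd p n q :
  deviates p -> deviates q -> deviates (p + n)%N -> deviates (n + q)%N ->
  avg E p + avg E q + (r p + r q + r (p + n)%N + r (n + q)%N) + ln 4 <=
    avg E (p + n) + avg E (n + q) ->
  avg E (p + n) + avg E (n + q) <= avg E (p + n + q) + avg E n + ln 2 +
    (p + n + n + q)%:R * ln K *
      (eta p + eta q + eta (p + n)%N + eta (n + q)%N).
Proof.
move=> dp dq dpn dnq hgap.
pose a1 := omega *~ (n + q)%N; pose a2 := omega *~ q.
have [n1 m1] := ind_mean a1 dp; have [n2 m2] := ind_mean 0 dq.
have [n3 m3] := ind_mean a2 dpn; have [n4 m4] := ind_mean 0 dnq.
pose M : R := (p + n + n + q)%:R * ln K.
have K1 := Kge1.
have M0 : 0 <= M by exact: (mulr_ge0 (ler0n _ _) (ln_ge0 K1)).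
have g1 := nice_shift a2 (nice_growth (p + n) hE).
have g2 := nice_growth (n + q) hE.
have g3 := nice_growth (p + n + q) hE.
have g4 := nice_shift a2 (nice_growth n hE).
have n12 := niceD n1 n2; have n123 := niceD n12 n3; have n1234 := niceD n123 n4.
have key x : growth v E (p + n) (x + a2) + growth v E (n + q) x <=
  (growth v E (p + n + q) x + growth v E n (x + a2)) + (ln 2 +
  M * ((ind p (x + a1))%:R + (ind q (x + 0))%:R + (ind (p + n) (x + a2))%:R +
      (ind (n + q) (x + 0))%:R)).
  rewrite !addr0.
  have ln20 : 0 <= ln 2 :> R by rewrite ln_ge0 // ler1n.
  have [good|bad] := boolP [&& ~~ ind p (x + a1), ~~ ind q x,
      ~~ ind (p + n) (x + a2) & ~~ ind (n + q) x].
    move/and4P: good => [h1 h2 h3 h4].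
    rewrite (negbTE h1) (negbTE h2) (negbTE h3) (negbTE h4) !addr0 mulr0 addr0.
    rewrite -lerBlDr; apply: growth_superadd => //.
    have nind N y : ~~ ind N y ->
        (- r N <= growth v E N y - avg E N) /\ (growth v E N y - avg E N <= r N).
      by move=> hi; apply/andP; rewrite -ler_norml leNgt; exact: hi.
    exact: superadd_good hgap (nind _ _ h1).2 (nind _ _ h2).2
      (nind _ _ h3).1 (nind _ _ h4).1.
  have hs : 1 <= (ind p (x + a1))%:R + (ind q x)%:R + (ind (p + n) (x + a2))%:R +
      (ind (n + q) x)%:R :> R.
    rewrite -!natrD ler1n; move: bad; do 4 case: (ind _ _) => //.
  have hg1 := growth_le v_bound B_ge0 (p + n) (x + a2) hE.
  have hg2 := growth_le v_bound B_ge0 (n + q) x hE.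
  have hg3 := growth_ge0 v E (p + n + q) x.
  have hg4 := growth_ge0 v E n (x + a2).
  have hM : M <= M * ((ind p (x + a1))%:R + (ind q x)%:R +
     (ind (p + n) (x + a2))%:R + (ind (n + q) x)%:R) by rewrite ler_peMr.
  have eM : (p + n)%:R * ln K + (n + q)%:R * ln K = M.
    by rewrite -mulrDl -natrD addnA.
  exact: superadd_bad hg1 hg2 hg3 hg4 hM eM ln20.
have cst2 : nice (fun _ : 'rV[R]_d => ln 2 : R) by exact: nice_cst.
have h := mean_le (niceD g1 g2) (niceD (niceD g3 g4) (niceD cst2 (niceZ M n1234))) key.
have e1 := etrans (meanD g1 g2) (f_equal2 +%R (mean_growth_shift (p + n) a2 hE)
  (esym (avgE E (n + q)))).
have e2 := etrans (meanD g3 g4) (f_equal2 +%R (esym (avgE E (p + n + q)))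
  (mean_growth_shift n a2 hE)).
have e3 := etrans (meanD n123 n4) (f_equal2 +%R (etrans (meanD n12 n3)
  (f_equal2 +%R (meanD n1 n2) erefl)) erefl).
have e4 := etrans (meanD cst2 (niceZ M n1234)) (f_equal2 +%R (mean_cst _)
  (etrans (meanZ M n1234) (f_equal ( *%R M) e3))).
have e5 := etrans (meanD (niceD g3 g4) (niceD cst2 (niceZ M n1234)))
  (f_equal2 +%R e2 e4).
apply: (le_trans (le_of_eq (esym e1))); apply: (le_trans h).
apply: (le_trans (le_of_eq e5)); rewrite addrA lerD2l ler_wpM2l //.
by apply: lerD m4; apply: lerD m3; exact: lerD.
Qed.

Variables (c : R) (n0 : nat).
Hypothesis n0_gt0 : (0 < n0)%N.
Hypothesis dev : forall n, (n0 <= n)%N -> deviates n.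
Hypothesis r_mono : forall m n, (m <= n)%N -> r m <= r n.
Hypothesis eta_mono : forall m n, (m <= n)%N -> eta n <= eta m.
Hypothesis r_small : forall n, (n0 <= n)%N -> 4 * r (4 * n)%N + ln 4 <= 2 * c * n%:R.
Hypothesis eta_small : forall n, (n0 <= n)%N -> 20 * ln K * n%:R * eta n <= 1.

Let ln2_le1 : ln 2 <= 1 :> R.
Proof.
have := @le_ln1Dx R 1; rewrite (_ : 1 + 1 = 2) //; apply; lra.
Qed.

(** Scale 4n is reached through 3n: block lengths n, n, n first compare 3n with 2n, and then 2n, n,
    n compare 4n with 3n. *)
Lemma avg_double n : (n0 <= n)%N -> c * n%:R + 4 <= avg E (2 * n) - avg E n ->
  c * (2 * n)%:R + 4 <= avg E (2 * (2 * n)) - avg E (2 * n).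
Proof.
move=> hn hg.
have [[i1 i2 i3] [i4 i5 i6 i7] [e2 e23 e34] [i8 i9]] := double_nat hn.
have lnK0 : 0 <= ln K by exact: ln_ge0 Kge1.
have rs : 4 * r (4 * n)%N + ln 4 <= 2 * (c * n%:R) by rewrite mulrA r_small.
have es := eta_small hn.
have r1 : r n <= r (4 * n)%N by exact: r_mono.
have r2 : r (2 * n)%N <= r (4 * n)%N by exact: r_mono.
have r3 : r (3 * n)%N <= r (4 * n)%N by exact: r_mono.
have h2 : eta (2 * n)%N <= eta n by exact: eta_mono.
have h3 : eta (3 * n)%N <= eta n by exact: eta_mono.
have en m : (n0 <= m)%N -> 0 <= eta m.
  move=> hm; have := dev hm; rewrite /deviates => h.
  rewrite -lee_fin; apply: le_trans (ltW h).
  apply: le_ereal_inf_tmp => _ [A _ <-]; exact: measure_ge0.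
have en1 := en n hn.
(* At most [5 * n] factors and four deviation sets, each of measure at most [eta n]: this is the 20
   in [eta_small]. *)
have err (k : nat) (f1 f2 f3 f4 : R) : (k <= 5 * n)%N -> f1 <= eta n -> f2 <= eta n ->
    f3 <= eta n -> f4 <= eta n -> k%:R * ln K * (f1 + f2 + f3 + f4) <= 1.
  move=> hk q1 q2 q3 q4; apply: le_trans es.
  have hk' : k%:R <= 5 * n%:R :> R by rewrite -natrM ler_nat.
  apply: (@le_trans _ _ (k%:R * ln K * (4 * eta n))).
    apply: ler_wpM2l; first exact: (mulr_ge0 (ler0n _ _) lnK0).
    have -> : 4 * eta n = eta n + eta n + eta n + eta n by ring.
    by apply: lerD q4; apply: lerD q3; exact: lerD.
  apply: (@le_trans _ _ (5 * n%:R * ln K * (4 * eta n))).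
    apply: ler_wpM2r; first by exact: (mulr_ge0 (ler0n _ 4) en1).
    exact: (ler_wpM2r lnK0 hk').
  by apply: le_of_eq; ring.
have dn := dev hn.
have d2 : deviates (2 * n)%N by exact: dev.
have d3 : deviates (3 * n)%N by exact: dev.
have s1 := @avg_superadd n n n dn dn; rewrite !e2 e23 in s1.
have g1 := double_step1 (s1 d2 d2) hg rs r1 r2 ln2_le1
  (err (3 * n + n)%N _ _ _ _ i8 (lexx _) (lexx _) h2 h2).
have s2 := @avg_superadd (2 * n) n n d2 dn; rewrite e23 e2 in s2.
rewrite [in X in _ <= avg E X + _ + _ + _]e34 in s2.
have := double_step2 (s2 d3 d2) hg rs r1 r2 r3 ln2_le1
  (err (3 * n + n + n)%N _ _ _ _ i9 h2 (lexx _) h3 h2) g1.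
by rewrite natrM mulrCA.
Qed.

(* The hypothesis involves one scale only and is therefore stable under small
   changes of E, unlike a lower bound on Lyap itself. *)
Lemma lyap_ge_of_gap n : (n0 <= n)%N ->
  c * n%:R + 4 <= avg E (2 * n) - avg E n -> c <= Lyap v E.
Proof.
move=> hn hg.
have eS s : (2 ^ s.+1 * n = 2 * (2 ^ s * n))%N by rewrite expnS mulnA.
have big s : (n0 <= 2 ^ s * n)%N.
  by rewrite (leq_trans hn) // leq_pmull // expn_gt0.
have gap s : c * (2 ^ s * n)%:R + 4 <= avg E (2 * (2 ^ s * n)) - avg E (2 ^ s * n).
  elim: s => [|s IH]; first by rewrite expn0 mul1n.
  by rewrite eS; exact: avg_double.
(* The gaps at doubled scales telescope to linear growth with slope [c], up to the fixed loss
   [c * n]. *)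
have lin s : c * (2 ^ s * n)%:R - c * n%:R <= avg E (2 ^ s * n).
  elim: s => [|s IH].
    by rewrite expn0 mul1n subrr; have /andP[] := avg_bounds n hE.
  have g := gap s; rewrite eS natrM.
  exact: linear_step IH g.
have [cv _] := lyap_cvg hE.
rewrite leNgt; apply/negP => lt_c.
have e0 : 0 < (c - Lyap v E) / 2.
  by apply: divr_gt0; [rewrite subr_gt0|exact: ltr0n].
move/cvgrPdist_lt : cv => /(_ _ e0) [m0 _ hm].
have n1 : (0 < n)%N by exact: leq_trans hn.
(* Large enough for [LN] to be within half of [c - Lyap] of its limit, and for the loss [c * n] to
   be absorbed by the other half. *)
pose s := maxn m0 (Num.truncn (c / ((c - Lyap v E) / 2))).+1.
have hs1 : (s < 2 ^ s)%N by exact: ltn_expl.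
have hs : (m0 <= 2 ^ s * n)%N.
  rewrite (leq_trans (leq_maxl m0 (Num.truncn (c / ((c - Lyap v E) / 2))).+1)) //.
  by rewrite (leq_trans (ltnW hs1)) // leq_pmulr.
have := hm _ hs; rewrite LN_avg => /ltr_normlP[h _].
have N0 : 0 < (2 ^ s * n)%:R :> R by rewrite ltr0n muln_gt0 expn_gt0.
have hq : c <= (2 ^ s)%:R * ((c - Lyap v E) / 2).
  rewrite -ler_pdivrMr // ltW // (lt_le_trans (truncnS_gt _)) // ler_nat.
  by rewrite (leq_trans _ (ltnW hs1)) // leq_maxr.
have hl := lin s.
have ha : avg E (2 ^ s * n) < (2 ^ s * n)%:R * (Lyap v E + (c - Lyap v E) / 2).
  by rewrite opprB ltrBlDl ltr_pdivrMl in h.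
rewrite natrM in hl ha.
have nn : 0 < n%:R :> R by rewrite ltr0n.
exact: below_gap hl ha hq nn.
Qed.

End lyapunov.

(** Both averages move by at most 1/2, and 4 has to remain: the eighth of [c * n] given up between
    7/8 and 3/4 must be at least 5, hence the 40. *)
Lemma gap_transfer {R : realFieldType} (c n a1 a2 b1 b2 : R) :
  7 / 8 * c * n <= a2 - a1 -> a2 <= b2 + 1 / 2 -> b1 <= a1 + 1 / 2 ->
  40 <= c * n -> 3 / 4 * c * n + 4 <= b2 - b1.
Proof. lra. Qed.

Lemma gap_step {R : realFieldType} (c p n a a2 a0 : R) :
  a <= a0 + 7 / 8 * c * ((p - 1) * n) -> a2 - a <= 7 / 8 * c * (p * n) ->
  a2 <= a0 + 7 / 8 * c * ((2 * p - 1) * n).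
Proof. lra. Qed.

Lemma gap_contra {R : realFieldType} (c l p n a a0 lk : R) : 0 < n -> 0 < c ->
  a <= a0 + 7 / 8 * c * ((p - 1) * n) -> p * n * l <= a -> c < l -> a0 <= n * lk ->
  8 * lk < c * p -> 0 <= p -> False.
Proof.
move=> n0 c0 h1 h2 h3 h4 h5 p0.
have h6 : p * n * c <= p * n * l.
  by apply: ler_wpM2l; [exact: (mulr_ge0 p0 (ltW n0))|exact: ltW].
have h7 : n * (8 * lk) < n * (c * p) by rewrite ltr_pM2l.
have h8 : 0 < c * n by rewrite mulr_gt0.
lra.
Qed.

Lemma add4_le (a b c d n : nat) : (a + b + c + d <= n)%N ->
  [/\ a <= n, b <= n, c <= n & d <= n]%N.
Proof. by move=> h; split; lia. Qed.

Section lyapunov_lsc.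
Context {R : realType} {d : nat} {V : 'rV[R]_d -> R} {rho : R}
  {W : 'rV[R[i]]_d -> R[i]}.
Hypothesis hV : analytic_potential V rho W.
Variables (a b sigma tau : R).
Hypothesis sigma01 : 0 < sigma < 1.
Hypothesis tau01 : 0 < tau < 1.
Hypothesis hLDT : LDT W rho a b sigma tau.

Let pot_cont omega x (k : int) (e : R) : 0 < e ->
  \forall y \near x, cabs (potential V omega y k - potential V omega x k) <= e.
Proof.
move=> e0.
have hc : (fun y => V (y + omega *~ k)) @ x --> V (x + omega *~ k).
  apply: (@cvg_comp _ _ _ (fun y => y + omega *~ k) V (nbhs x)
    (nbhs (x + omega *~ k))); last exact: (potential_continuous hV).
  by apply: (@cvgD R 'rV[R]_d); [exact: cvg_id|exact: cvg_cst].
move/(@cvgrPdist_le _ _ _ (nbhs x)) : hc => /(_ _ e0); apply: filterS => y hy.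
have -> : potential V omega y k - potential V omega x k =
   ((V (y + omega *~ k) - V (x + omega *~ k))%:C)%C by rewrite rmorphB.
by rewrite cabs_real distrC; exact: hy.
Qed.

Let pot_per omega x (m : 'rV[int]_d) :
  potential V omega (x + map_mx intr m) = potential V omega x.
Proof. by apply/funext => k; rewrite /potential addrAC (ap_per hV). Qed.

Let pot_shift omega x (m : int) :
  potential V omega (x + omega *~ m) = fun k => potential V omega x (k + m).
Proof.
apply/funext => k; rewrite /potential; congr (V _)%:C%C.
by rewrite -addrA mulrzDr [_ *~ k + _]addrC.
Qed.

Lemma cpotential0 omega : cpotential W 0 omega = potential V omega.
Proof. by apply/funext => x; apply/funext => k; rewrite /cpotential (ap_ext hV). Qed.

(** Were the gap below 7/8 of [c] times the scale at each scale [2 ^ i * n0] with [i < i0], the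
    average at the last scale would fall below its lower bound by the Lyapunov exponent. So a gap
    occurs at one of these scales; it persists at [E'] and is converted back by [lyap_ge_of_gap].
    Which scale it is may depend on [omega], but [i0] and hence [delta] do not. *)
Lemma lyap_lsc (Bd c : R) : 0 < c -> exists2 delta : R, 0 < delta &
  forall omega, diophantine a b omega -> forall E E' : R,
  `|E| <= Bd -> `|E - E'| <= delta ->
  c < Lyap (potential V omega) E%:C%C ->
  3 / 4 * c <= Lyap (potential V omega) E'%:C%C.
Proof.
move=> c0.
have /andP[s0 s1] := sigma01; have /andP[t0 t1] := tau01.
have [M M0 hM] := potential_bounded hV.
pose B := `|Bd| + 1; pose K := M + B + 2.
have B0 : 0 <= B by rewrite addr_ge0.
have K1 : 1 <= K by rewrite /K; move: M0 B0; lra.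
pose c1 : R := 3 / 4 * c.
have c10 : 0 < c1 by rewrite /c1; move: c0; lra.
have [N0 hN0] := hLDT.1 B.
have c16 : 0 < c1 / 16 by move: c10; lra.
have [N2 hN2] := powR_sublinear t0 c16.
have [N3 hN3] := expR_powR_small (20 * ln K) s0.
pose N4 := (Num.truncn (40 / c1)).+1.
pose n0 := (N0 + N2 + N3 + N4)%N.
have n00 : (0 < n0)%N by rewrite /n0 /N4 addnS.
pose r (N : nat) : R := N%:R `^ (1 - tau).
pose eta (N : nat) : R := expR (- N%:R `^ sigma).
have c140 n : (n0 <= n)%N -> 40 <= c1 * n%:R.
  move=> hn; rewrite mulrC -ler_pdivrMr // ltW // (lt_le_trans (truncnS_gt _)) //.
  by rewrite ler_nat; have [] := add4_le hn.
have r_mono m n : (m <= n)%N -> r m <= r n.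
  move=> mn; apply: ge0_ler_powR; rewrite ?nnegrE ?ler0n ?ler_nat //.
  by rewrite subr_ge0 ltW.
have eta_mono m n : (m <= n)%N -> eta n <= eta m.
  move=> mn; rewrite ler_expR lerN2.
  by apply: ge0_ler_powR; rewrite ?nnegrE ?ler0n ?ler_nat // ltW.
have ln4 : ln 4 <= 3 :> R.
  have := @le_ln1Dx R 3; rewrite (_ : 1 + 3 = 4); last by ring.
  by apply; rewrite (lt_trans (ltrN10 _)).
have r_small n : (n0 <= n)%N -> 4 * r (4 * n)%N + ln 4 <= 2 * c1 * n%:R.
  move=> hn.
  have h1 : r (4 * n)%N <= c1 / 16 * (4 * n)%:R.
    apply: hN2; rewrite ler_nat (leq_trans _ (leq_pmull n _)) //.
    by have [] := add4_le hn.
  move: h1 ln4 (c140 n hn); rewrite natrM.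
  move: (r _) (ln 4) (n%:R) => x y z; lra.
have eta_small n : (n0 <= n)%N -> 20 * ln K * n%:R * eta n <= 1.
  by move=> hn; apply: hN3; have [] := add4_le hn.
have [i0 hi0] : exists i0 : nat, 8 * ln K < c * (2 ^ i0)%:R.
  exists (Num.truncn (8 * ln K / c)).+1.
  rewrite [X in _ < X]mulrC -ltr_pdivrMr //.
  apply: (lt_le_trans (truncnS_gt _)).
  by rewrite ler_nat ltnW // ltn_expl.
pose nmax := (2 ^ i0.+1 * n0)%N.
pose D : R := nmax%:R * K ^+ nmax.
have D0 : 0 < D.
  rewrite mulr_gt0 ?ltr0n ?muln_gt0 ?expn_gt0 // exprn_gt0 //.
  exact: lt_le_trans K1.
(* The 1 keeps [E'] within the bound [B]; the other term keeps all averages up to scale [nmax]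
   within 1/2 of those at [E]. *)
exists (Num.min 1 (1 / 2 / D)).
  by rewrite lt_min ltr01 /= !divr_gt0.
move=> omega hom E E' hE; rewrite le_min => /andP[d1 d2] hL.
pose v := potential V omega.
have v_bound x k : cabs (v x k) <= M by rewrite /v /potential cabs_real.
have bE : cabs (E%:C)%C <= B.
  rewrite cabs_real (le_trans hE) // (le_trans (ler_norm _)) // lerDl ler01 //.
have bE' : cabs (E'%:C)%C <= B.
  rewrite cabs_real /B.
  have := ler_distD E 0 E'; rewrite sub0r normrN => h.
  have := ler_norm Bd; move: (`|Bd|) hE d1 h; rewrite sub0r normrN distrC.
  move: (`|E|) (`|E'|) (`|E' - E|) => x y z w; clear hL; lra.
have vc : forall x (k : int) (e : R), 0 < e ->
  \forall y \near x, cabs (v y k - v x k) <= e by exact: pot_cont.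
have vp : forall x (m : 'rV[int]_d), v (x + map_mx intr m) = v x by exact: pot_per.
have vs : forall x (m : int), v (x + omega *~ m) = fun k => v x (k + m).
  exact: pot_shift.
have dev e n : cabs e <= B -> (n0 <= n)%N -> deviates v e r eta n.
  move=> he hn.
  have hn' : (N0 <= n)%N by have [] := add4_le hn.
  have h0 : `|0 : 'rV[R]_d| < rho by rewrite normr0; exact: ap_rho hV.
  have := hN0 omega hom e he n hn' 0 h0.
  rewrite cpotential0 LN_avg mulrA divff ?mul1r //.
  by rewrite pnatr_eq0 -lt0n (leq_trans n00).
have diff n : (n <= nmax)%N ->
  avg v (E%:C)%C n <= avg v (E'%:C)%C n + 1 / 2 /\
  avg v (E'%:C)%C n <= avg v (E%:C)%C n + 1 / 2.
  move=> hn.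
  have h : n%:R * K ^+ n * `|E - E'| <= 1 / 2.
    apply: (@le_trans _ _ (D * `|E - E'|)).
      apply: ler_wpM2r; first exact: normr_ge0.
      apply: ler_pM; [exact: ler0n| |by rewrite ler_nat|exact: ler_weXn2l].
      by apply: exprn_ge0; exact: le_trans K1.
    by rewrite mulrC -ler_pdivlMr.
  have h1 := avg_lip v_bound vc B0 n bE bE'.
  have h2 := avg_lip v_bound vc B0 n bE' bE.
  have e1 : (E%:C - E'%:C = (E - E')%:C)%C by rewrite rmorphB.
  have e2 : (E'%:C - E%:C = (E' - E)%:C)%C by rewrite rmorphB.
  move: h1 h2; rewrite e1 e2 !cabs_real [`|E' - E|]distrC => h1 h2.
  by split; [apply: (le_trans h1)|apply: (le_trans h2)]; rewrite lerD2l.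
have [i [hi hgap]] : exists i : nat, (i < i0)%N /\
    7 / 8 * c * (2 ^ i * n0)%:R <=
      avg v (E%:C)%C (2 ^ i.+1 * n0) - avg v (E%:C)%C (2 ^ i * n0).
  apply: contrapT => hno.
  have up i : (i <= i0)%N -> avg v (E%:C)%C (2 ^ i * n0) <=
     avg v (E%:C)%C n0 + 7 / 8 * c * (((2 ^ i)%:R - 1) * n0%:R).
    elim: i => [_|i IH hi]; first by rewrite expn0 mul1n subrr mul0r mulr0 addr0.
    have h1 := IH (ltnW hi).
    have h2 : avg v (E%:C)%C (2 ^ i.+1 * n0) - avg v (E%:C)%C (2 ^ i * n0) <=
       7 / 8 * c * ((2 ^ i)%:R * n0%:R).
      rewrite -natrM leNgt; apply/negP => h; apply: hno; exists i.
      by split => //; exact: ltW.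
    by have := gap_step h1 h2; rewrite -natrM -expnS.
  have [_ hl] := lyap_cvg v_bound vc vp vs B0 bE.
  have h1 := up i0 (leqnn _).
  have p0 : (0 < 2 ^ i0 * n0)%N by rewrite muln_gt0 expn_gt0.
  have h2 := hl _ p0; rewrite natrM in h2.
  have h3 := avg_bounds v_bound vc B0 n0 bE.
  have n0R : 0 < n0%:R :> R by rewrite ltr0n.
  exact: gap_contra n0R c0 h1 h2 hL (andP h3).2 hi0 (ler0n _ _).
have hn : (n0 <= 2 ^ i * n0)%N by rewrite leq_pmull // expn_gt0.
have hx : (2 ^ i.+1 * n0 <= nmax)%N.
  by rewrite leq_mul2r leq_exp2l // ltnS ltnW ?orbT.
have hx' : (2 ^ i * n0 <= nmax)%N.
  by apply: leq_trans hx; rewrite leq_mul2r leq_exp2l // leqnSn orbT.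
have key := (@lyap_ge_of_gap R d v omega M v_bound vc vp vs B B0 (E'%:C)%C bE' r eta
   c1 n0 n00).
have key' := key (fun n hn' => dev _ n bE' hn') r_mono eta_mono r_small eta_small
  (2 ^ i * n0)%N hn.
apply: key'; rewrite mulnA -expnS.
apply: gap_transfer hgap (diff _ hx).1 (diff _ hx').2 _.
apply: (le_trans (c140 _ hn)); rewrite ler_wpM2r ?ler0n // /c1.
by move: c0; lra.
Qed.

End lyapunov_lsc.

(** * Square-summable sequences *)

Section window_sums.
Context {V : nmodType}.
Implicit Types f g : int -> V.

Definition wsum f (N : nat) : V := \sum_(i < N.*2.+1) f ((i : nat)%:Z - N%:Z).

Lemma wsum0 f : wsum f 0 = f 0.
Proof. by rewrite /wsum big_ord_recl big_ord0 addr0. Qed.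

Lemma wsumS f N : wsum f N.+1 = f (- N.+1%:Z) + wsum f N + f N.+1%:Z.
Proof.
rewrite {1}/wsum doubleS big_ord_recl big_ord_recr /= sub0r addrA.
congr (_ + _ + f _); last by rewrite /bump /=; lia.
by apply: eq_bigr => i _; congr (f _); rewrite /bump /=; lia.
Qed.

Lemma eq_wsum f g N : (forall n : int, `|n| <= N%:Z -> f n = g n) ->
  wsum f N = wsum g N.
Proof.
move=> h; apply: eq_bigr => i _; apply: h.
have := ltn_ord i; lia.
Qed.

Lemma wsumD f g N : wsum (fun n => f n + g n) N = wsum f N + wsum g N.
Proof. exact: big_split. Qed.

Lemma wsum_stable f N M : (N <= M)%N -> (forall n : int, N%:Z < `|n| -> f n = 0) ->
  wsum f M = wsum f N.
Proof.
move=> + h; elim: M => [|M IH]; first by rewrite leqn0 => /eqP ->.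
rewrite leq_eqVlt => /predU1P[->//|]; rewrite ltnS => NM.
rewrite wsumS IH // !h ?addr0 ?add0r //; lia.
Qed.

End window_sums.

Section l2_norm.
Context {R : realType}.
Local Notation C := R[i].
Implicit Types phi psi : int -> C.

Lemma ler_wsum (f g : int -> R) N :
  (forall n : int, `|n| <= N%:Z -> f n <= g n) -> wsum f N <= wsum g N.
Proof.
move=> h; apply: ler_sum => i _; apply: h; have := ltn_ord i; lia.
Qed.

Lemma wsum_mono (f : int -> R) N M : (forall n, 0 <= f n) -> (N <= M)%N ->
  wsum f N <= wsum f M.
Proof.
move=> f0; elim: M => [|M IH]; first by rewrite leqn0 => /eqP ->.
rewrite leq_eqVlt => /predU1P[->//|]; rewrite ltnS => /IH h.
rewrite (le_trans h) // wsumS -addrA addrCA -[leLHS]addr0 lerD2l.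
by rewrite addr_ge0.
Qed.

Lemma wsum_entry (f : int -> R) N n : (forall n, 0 <= f n) -> `|n| <= N%:Z ->
  f n <= wsum f N.
Proof.
move=> f0 nN.
have hi : (absz (n + N%:Z)%R < N.*2.+1)%N by lia.
rewrite /wsum (bigD1 (Ordinal hi)) //= (_ : _ - _ = n); last by lia.
by rewrite lerDl sumr_ge0.
Qed.

Lemma wsumZ (c : R) (f : int -> R) N : wsum (fun n => c * f n) N = c * wsum f N.
Proof. by rewrite /wsum mulr_sumr. Qed.

Definition win N phi : 'cV[C]_(N.*2.+1) := \col_i phi ((i : nat)%:Z - N%:Z).

Definition nrm N phi : R := colnorm (win N phi).

Lemma nrm_sq N phi : nrm N phi ^+ 2 = wsum (fun n => cabs (phi n) ^+ 2) N.
Proof. by rewrite colnorm_sq; apply: eq_bigr => i _; rewrite mxE. Qed.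

Lemma nrm_ge0 N phi : 0 <= nrm N phi. Proof. exact: colnorm_ge0. Qed.

Lemma nrm_le N phi c : 0 <= c -> (nrm N phi <= c) =
  (wsum (fun n => cabs (phi n) ^+ 2) N <= c ^+ 2).
Proof. by move=> c0; rewrite -nrm_sq ler_sqr ?nnegrE ?nrm_ge0. Qed.

Lemma nrmD N phi psi : nrm N (fun n => phi n + psi n) <= nrm N phi + nrm N psi.
Proof.
have -> : nrm N (fun n => phi n + psi n) = colnorm (win N phi + win N psi).
  by congr colnorm; apply/colP => i; rewrite !mxE.
exact: colnormD.
Qed.

Lemma nrmZ N c phi : nrm N (fun n => c * phi n) = cabs c * nrm N phi.
Proof.
rewrite -colnormZ; congr colnorm; apply/colP => i; by rewrite !mxE.
Qed.

Lemma nrm_mono N M phi : (N <= M)%N -> nrm N phi <= nrm M phi.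
Proof.
move=> NM; rewrite nrm_le ?nrm_ge0 // nrm_sq wsum_mono // => n.
exact: sqr_ge0.
Qed.

Lemma nrm_entry N phi n : `|n| <= N%:Z -> cabs (phi n) <= nrm N phi.
Proof.
move=> nN; rewrite -ler_sqr ?nnegrE ?nrm_ge0 ?cabs_ge0 // nrm_sq.
by apply: (@wsum_entry (fun n => cabs (phi n) ^+ 2)) => // k; exact: sqr_ge0.
Qed.

Let sq phi (n : int) : \bar R := ((cabs (phi n)) ^+ 2)%:E.

Let sq_ge0 phi n : (0 <= sq phi n)%E.
Proof. by rewrite lee_fin sqr_ge0. Qed.

Let wset (N : nat) : set int := [set n : int | `|n| <= N%:Z].

Let wset_bij N : set_bij `I_(N.*2.+1) (wset N)
  (fun i : nat => i%:Z - N%:Z).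
Proof.
split=> [i /= hi|i j _ _ /= h|n /= hn].
- rewrite /wset /=; lia.
- lia.
- exists (absz (n + N%:Z)); rewrite /wset /= in hn *; lia.
Qed.

Let finite_wset N : finite_set (wset N).
Proof.
have -> : wset N = (fun i : nat => i%:Z - N%:Z) @` `I_(N.*2.+1).
  have [h1 _ h3] := wset_bij N; apply/seteqP; split=> [n /h3 [i hi <-]|_ [i hi <-]].
    by exists i.
  exact: h1.
by apply: finite_image; exact: finite_II.
Qed.

Let fsum_wset N phi :
  (\sum_(n \in wset N) sq phi n)%E = (wsum (fun n => cabs (phi n) ^+ 2) N)%:E.
Proof.
rewrite (reindex_fsbig _ _ _ _ (wset_bij N)) -fsbig_ord /sq sumEFin.
by [].
Qed.

(** [esum] ranges over all finite sets of sites, among which the centred windows are cofinal. Bounds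
    in l^2 can thus be proved window by window. *)
Lemma sqnorm_leP phi c : reflect (forall N, nrm N phi ^+ 2 <= c)
  (sqnorm phi <= c%:E)%E.
Proof.
apply: (iffP idP) => [h N|h].
  rewrite nrm_sq -lee_fin -fsum_wset; apply: le_trans h.
  apply: ereal_sup_ubound; exists (wset N) => //; split=> //.
apply: ge_ereal_sup => _ [A [finA _] <-].
have [N hN] : exists N, A `<=` wset N.
  have /finite_seqP[s ->] := finA.
  exists (\max_(n <- s) absz n)%N => n /= ns; rewrite /wset /=.
  by rewrite -abszE lez_nat; exact: (@leq_bigmax_seq _ s xpredT (fun n => absz n)).
apply: (@le_trans _ _ (\sum_(n \in wset N) sq phi n)%E).
  apply: (lee_fsum_nneg_subset finA (finite_wset N)) => [n|n _].
    by rewrite !inE; exact: hN.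
  exact: sq_ge0.
by rewrite fsum_wset -nrm_sq lee_fin.
Qed.

Lemma sqnorm_ge0 phi : (0 <= sqnorm phi)%E.
Proof. by apply: esum_ge0 => n _; exact: sq_ge0. Qed.

Lemma l2_bound phi c : (forall N, nrm N phi <= c) -> l2 phi /\ l2norm phi <= c.
Proof.
move=> h; have c0 : 0 <= c by exact: le_trans (nrm_ge0 0 phi) (h 0%N).
have hs : (sqnorm phi <= (c ^+ 2)%:E)%E.
  apply/sqnorm_leP => N; by rewrite ler_sqr ?nnegrE ?nrm_ge0.
split; first exact: le_lt_trans hs (ltry _).
have hf : sqnorm phi \is a fin_num.
  rewrite ge0_fin_numE ?sqnorm_ge0 //; exact: le_lt_trans hs (ltry _).
have := hs; rewrite -(fineK hf) lee_fin => hc.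
by rewrite /l2norm -(ger0_norm c0) -sqrtr_sqr ler_wsqrtr.
Qed.

Lemma l2norm_ge0 phi : 0 <= l2norm phi. Proof. exact: sqrtr_ge0. Qed.

Lemma l2norm_sqE phi : l2 phi -> sqnorm phi = (l2norm phi ^+ 2)%:E.
Proof.
move=> h; have hf : sqnorm phi \is a fin_num.
  by rewrite ge0_fin_numE ?sqnorm_ge0.
by rewrite /l2norm sqr_sqrtr ?fineK // fine_ge0 // sqnorm_ge0.
Qed.

Lemma nrm_le_l2norm phi N : l2 phi -> nrm N phi <= l2norm phi.
Proof.
move=> h; have := lexx (sqnorm phi).
rewrite {2}(l2norm_sqE h) => /sqnorm_leP /(_ N).
by rewrite ler_sqr ?nnegrE ?nrm_ge0 ?l2norm_ge0.
Qed.

(** Outside l^2 the sum is infinite and [fine] returns 0, so a nonzero norm certifies membership; in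
    particular unit vectors need no separate hypothesis. *)
Lemma l2norm_neq0 phi : l2norm phi != 0 -> l2 phi.
Proof.
move=> h; rewrite /l2 /= ltey; apply: contra_neq h => e.
by rewrite /l2norm e /= sqrtr0.
Qed.

Lemma l2norm_cvg phi : l2 phi -> (fun N => nrm N phi) @ \oo --> l2norm phi.
Proof.
move=> h; apply/cvgrPdist_le => /= e e0.
have [N hN] : exists N, l2norm phi - e <= nrm N phi.
  apply: contrapT => hn.
  have : l2norm phi <= l2norm phi - e.
    apply: (l2_bound _).2 => N; rewrite leNgt; apply/negP => hlt.
    by apply: hn; exists N; exact: ltW.
  by rewrite leNgt ltrBlDr ltrDl e0.
exists N => // M /= NM.
have h1 := nrm_le_l2norm M h; have h2 := nrm_mono phi NM.
rewrite ger0_norm ?subr_ge0 //.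
move: (l2norm phi) (nrm N phi) (nrm M phi) hN h1 h2 => x y z; lra.
Qed.

Lemma l2_entry phi n : l2 phi -> cabs (phi n) <= l2norm phi.
Proof.
move=> h; apply: le_trans (nrm_le_l2norm (absz n) h).
by apply: nrm_entry; lia.
Qed.

Lemma l2norm_eq0 phi : l2 phi -> l2norm phi = 0 -> phi = fun=> 0.
Proof.
move=> h e; apply/funext => n; apply: cabs_eq0.
by apply/eqP; rewrite eq_le cabs_ge0 andbT -e l2_entry.
Qed.

Lemma l2D phi psi : l2 phi -> l2 psi -> l2 (fun n => phi n + psi n) /\
  l2norm (fun n => phi n + psi n) <= l2norm phi + l2norm psi.
Proof.
move=> h1 h2; apply: l2_bound => N; apply: (le_trans (nrmD _ _ _)).
by apply: lerD; exact: nrm_le_l2norm.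
Qed.

Lemma l2Z c phi : l2 phi -> l2 (fun n => c * phi n) /\
  l2norm (fun n => c * phi n) = cabs c * l2norm phi.
Proof.
move=> h.
have key z psi : l2 psi -> l2 (fun n => z * psi n) /\
    l2norm (fun n => z * psi n) <= cabs z * l2norm psi.
  move=> hp; apply: l2_bound => N; rewrite nrmZ ler_wpM2l ?cabs_ge0 //.
  exact: nrm_le_l2norm.
have [h1 h2] := key c _ h; split=> //.
have [c0|cn0] := eqVneq c 0.
  move: h2; rewrite c0 cabs0 mul0r => h2.
  by apply/eqP; rewrite eq_le h2 l2norm_ge0.
apply/eqP; rewrite eq_le h2 /=.
have [_] := key c^-1 _ h1.
have -> : (fun n => c^-1 * (c * phi n)) = phi.
  by apply/funext => n; rewrite mulrA mulVf // mul1r.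
rewrite -(ler_pM2l (_ : 0 < cabs c)); last first.
  rewrite lt_neqAle cabs_ge0 andbT eq_sym; apply: contra_neq cn0.
  exact: cabs_eq0.
by rewrite mulrA -cabsM mulfV // cabs1 mul1r.
Qed.

Lemma l2N phi : l2 phi -> l2 (fun n => - phi n) /\
  l2norm (fun n => - phi n) = l2norm phi.
Proof.
move=> h; have [h1 h2] := l2Z (-1) h.
have e : (fun n => - phi n) = (fun n => -1 * phi n).
  by apply/funext => n; rewrite mulN1r.
by rewrite e h2 cabsN cabs1 mul1r.
Qed.

Lemma l2B phi psi : l2 phi -> l2 psi -> l2 (fun n => phi n - psi n) /\
  l2norm (fun n => phi n - psi n) <= l2norm phi + l2norm psi.
Proof.
move=> h1 /l2N [h2 <-]; exact: (l2D h1 h2).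
Qed.

Lemma l20 : l2 (fun=> 0 : C) /\ l2norm (fun=> 0 : C) = 0.
Proof.
have [h1 h2] : l2 (fun=> 0 : C) /\ l2norm (fun=> 0 : C) <= 0.
  apply: l2_bound => N; rewrite nrm_le // expr0n.
  by rewrite /wsum big1 // => i _; rewrite cabs0 expr0n.
by split=> //; apply/eqP; rewrite eq_le h2 l2norm_ge0.
Qed.

Lemma l2norm_triangle phi psi chi : l2 (fun n => phi n - psi n) ->
  l2 (fun n => psi n - chi n) ->
  l2norm (fun n => phi n - chi n) <=
    l2norm (fun n => phi n - psi n) + l2norm (fun n => psi n - chi n).
Proof.
move=> h1 h2; have [_] := l2D h1 h2.
by have -> : (fun n => phi n - psi n + (psi n - chi n)) = (fun n => phi n - chi n);
  first by apply/funext => n; rewrite addrA subrK.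
Qed.

Lemma l2_finsupp phi (N : nat) : (forall n : int, N%:Z < `|n| -> phi n = 0) ->
  l2 phi /\ l2norm phi = nrm N phi.
Proof.
move=> h.
have hM M : nrm M phi <= nrm N phi.
  case: (leqP N M) => hNM; last by apply: nrm_mono; exact: ltnW.
  rewrite nrm_le ?nrm_ge0 // nrm_sq (wsum_stable hNM) // => n hn.
  by rewrite h // cabs0 expr0n.
have [h1 h2] := l2_bound hM; split=> //.
by apply/eqP; rewrite eq_le h2 nrm_le_l2norm.
Qed.

Lemma l2_sum (I : Type) (s : seq I) (F : I -> int -> C) :
  (forall i, l2 (F i)) -> l2 (fun n => \sum_(i <- s) F i n) /\
  l2norm (fun n => \sum_(i <- s) F i n) <= \sum_(i <- s) l2norm (F i).
Proof.
move=> hF; elim: s => [|i s [IH1 IH2]].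
  have -> : (fun n : int => \sum_(i <- [::]) F i n) = fun=> 0.
    by apply/funext => n; rewrite big_nil.
  by rewrite big_nil; have [h1 h2] := l20; split=> //; rewrite h2.
have e : (fun n : int => \sum_(j <- i :: s) F j n) =
   fun n => F i n + \sum_(j <- s) F j n by apply/funext => n; rewrite big_cons.
rewrite e big_cons; have [h1 h2] := l2D (hF i) IH1; split=> //.
by rewrite (le_trans h2) // lerD2l.
Qed.

End l2_norm.

Section complex_limits.
Context {R : realType}.
Local Notation C := R[i].

Lemma cvg_complex (f : nat -> C) (a : C) :
  (fun n => complex.Re (f n)) @ \oo --> complex.Re a ->
  (fun n => complex.Im (f n)) @ \oo --> complex.Im a ->
  (f : nat -> C^o) @ \oo --> (a : C^o).
Proof.
move=> /cvgrPdist_lt hr /cvgrPdist_lt hi; apply/cvgrPdist_lt => e e0.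
have eE : e = ((complex.Re e)%:C)%C by rewrite RRe_real // gtr0_real.
have re : 0 < complex.Re e / 2.
  by move: e0; rewrite eE ltcR => h; rewrite divr_gt0.
have := hr _ re; have := hi _ re; apply: filterS2 => n h1 h2.
rewrite cabsE eE ltcR (le_lt_trans (cabs_le_ReIm _)) //.
rewrite !raddfB /=; rewrite [ltRHS]splitr; exact: ltrD.
Qed.

Lemma cvg_le_const (u : nat -> R) (l c : R) : u @ \oo --> l ->
  (forall n, u n <= c) -> l <= c.
Proof.
move=> /cvgrPdist_lt h hc; rewrite leNgt; apply/negP => lt_cl.
have e0 : 0 < l - c by rewrite subr_gt0.
have [N _ /(_ N (leqnn N))] := h _ e0.
have := hc N; move: (u N) => x h1 /ltr_normlP[_]; lra.
Qed.

Lemma cvg_unique_real (u : nat -> R) (l l' : R) :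
  u @ \oo --> l -> u @ \oo --> l' -> l = l'.
Proof.
move=> h h'.
have e : lim (u @ \oo) = l by apply: cvg_lim.
by rewrite -e; apply: cvg_lim.
Qed.

End complex_limits.

Section real_inner_product.
Context {R : realType}.
Local Notation C := R[i].
Implicit Types phi psi chi : int -> C.

(** A symmetric bilinear form over the reals with the same norm as [ip]; expansions below need no
    conjugates. *)
Definition rip phi psi : R := complex.Re (ip phi psi).

Definition ripN N phi psi : R :=
  wsum (fun n => complex.Re ((phi n)^* * psi n)) N.

Let Re_conjM (a b : C) :
  complex.Re (a^* * b) = complex.Re a * complex.Re b + complex.Im a * complex.Im b.
Proof. by case: a b => [x y] [z w] /=; ring. Qed.

Let Im_conjM (a b : C) :
  complex.Im (a^* * b) = complex.Re (a^* * (Complex 0 (-1) * b)).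
Proof. by case: a b => [x y] [z w] /=; ring. Qed.

Let polar (a b : C) : complex.Re (a^* * b) =
  4^-1 * (cabs (a + b) ^+ 2 + - 1 * cabs (a - b) ^+ 2).
Proof.
have h : cabs (a + b) ^+ 2 + - 1 * cabs (a - b) ^+ 2 = 4 * complex.Re (a^* * b).
  by rewrite Re_conjM !cabs_sqrE; case: a b => [x y] [z w] /=; ring.
by rewrite h mulKf // pnatr_eq0.
Qed.

Let ripN_polar N phi psi : ripN N phi psi =
  4^-1 * (nrm N (fun n => phi n + psi n) ^+ 2 +
          - 1 * nrm N (fun n => phi n - psi n) ^+ 2).
Proof.
by rewrite !nrm_sq -wsumZ -wsumD -wsumZ; apply: eq_bigr => i _; rewrite polar.
Qed.

Let cvg_sq phi : l2 phi -> (fun N => nrm N phi ^+ 2) @ \oo --> l2norm phi ^+ 2.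
Proof. by move=> h; rewrite expr2; apply: cvgM; exact: l2norm_cvg. Qed.

Let rip' phi psi : R := 4^-1 * (l2norm (fun n => phi n + psi n) ^+ 2 +
          - 1 * l2norm (fun n => phi n - psi n) ^+ 2).

Let ripN_cvg' phi psi : l2 phi -> l2 psi ->
  (fun N => ripN N phi psi) @ \oo --> rip' phi psi.
Proof.
move=> h1 h2.
have -> : (fun N => ripN N phi psi) = (fun N =>
  4^-1 * (nrm N (fun n => phi n + psi n) ^+ 2 +
          - 1 * nrm N (fun n => phi n - psi n) ^+ 2)).
  by apply/funext => N; exact: ripN_polar.
apply: cvgMr; apply: cvgD; first exact: (cvg_sq (l2D h1 h2).1).
by apply: cvgMr; exact: (cvg_sq (l2B h1 h2).1).
Qed.

(** Polarization writes the partial sums through window norms, which converge. The imaginary part is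
    the real part after [psi] has been multiplied by -i. *)
Lemma ip_lim phi psi : l2 phi -> l2 psi ->
  ip phi psi = Complex (rip' phi psi) (rip' phi (fun n => Complex 0 (-1) * psi n)).
Proof.
move=> h1 h2; rewrite /ip.
apply: (@cvg_lim C^o); first exact: norm_hausdorff.
have h3 := (l2Z (Complex 0 (-1)) h2).1.
apply: cvg_complex => /=.
  have e : (fun N => complex.Re (\sum_(i < N.*2.+1)
     (phi ((i : nat)%:Z - N%:Z))^* * psi ((i : nat)%:Z - N%:Z))) =
     (fun N => ripN N phi psi).
    by apply/funext => N; rewrite raddf_sum.
  by rewrite e; exact: ripN_cvg'.
have e : (fun N => complex.Im (\sum_(i < N.*2.+1)
     (phi ((i : nat)%:Z - N%:Z))^* * psi ((i : nat)%:Z - N%:Z))) =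
     (fun N => ripN N phi (fun n => Complex 0 (-1) * psi n)).
  by apply/funext => N; rewrite raddf_sum; apply: eq_bigr => i _; exact: Im_conjM.
by rewrite e; exact: ripN_cvg'.
Qed.

Lemma ripN_cvg phi psi : l2 phi -> l2 psi ->
  (fun N => ripN N phi psi) @ \oo --> rip phi psi.
Proof. by move=> h1 h2; rewrite /rip ip_lim //; exact: ripN_cvg'. Qed.

Let rip_unique phi psi (l : R) : l2 phi -> l2 psi ->
  (fun N => ripN N phi psi) @ \oo --> l -> rip phi psi = l.
Proof.
move=> h1 h2 h; exact: cvg_unique_real (ripN_cvg h1 h2) h.
Qed.

Lemma ripC phi psi : l2 phi -> l2 psi -> rip phi psi = rip psi phi.
Proof.
move=> h1 h2; apply: rip_unique => //.
have -> : (fun N => ripN N phi psi) = (fun N => ripN N psi phi).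
  apply/funext => N; apply: eq_bigr => i _; rewrite !Re_conjM.
  by rewrite [X in X + _]mulrC [X in _ + X]mulrC.
exact: ripN_cvg.
Qed.

Lemma ripDr phi psi chi : l2 phi -> l2 psi -> l2 chi ->
  rip phi (fun n => psi n + chi n) = rip phi psi + rip phi chi.
Proof.
move=> h1 h2 h3; apply: rip_unique => //; first exact: (l2D h2 h3).1.
have -> : (fun N => ripN N phi (fun n => psi n + chi n)) =
  (fun N => ripN N phi psi + ripN N phi chi).
  apply/funext => N; rewrite -wsumD; apply: eq_bigr => i _.
  by rewrite mulrDr raddfD.
by apply: cvgD; exact: ripN_cvg.
Qed.

Lemma ripZr phi psi (c : R) : l2 phi -> l2 psi ->
  rip phi (fun n => (c%:C)%C * psi n) = c * rip phi psi.
Proof.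
move=> h1 h2; apply: rip_unique => //; first exact: (l2Z _ h2).1.
have -> : (fun N => ripN N phi (fun n => (c%:C)%C * psi n)) =
  (fun N => c * ripN N phi psi).
  apply/funext => N; rewrite -wsumZ; apply: eq_bigr => i _.
  rewrite !Re_conjM; case: (psi _) (phi _) => [x y] [z w] /=; ring.
by apply: cvgMr; exact: ripN_cvg.
Qed.

Lemma ripNr phi psi : l2 phi -> l2 psi -> rip phi (fun n => - psi n) = - rip phi psi.
Proof.
move=> h1 h2; rewrite -mulN1r -ripZr //; congr rip; apply/funext => n.
by rewrite rmorphN /= mulNr mul1r.
Qed.

Lemma ripBr phi psi chi : l2 phi -> l2 psi -> l2 chi ->
  rip phi (fun n => psi n - chi n) = rip phi psi - rip phi chi.
Proof.
by move=> h1 h2 h3; rewrite ripDr // ?ripNr //; exact: (l2N h3).1.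
Qed.

Lemma ripDl phi psi chi : l2 phi -> l2 psi -> l2 chi ->
  rip (fun n => psi n + chi n) phi = rip psi phi + rip chi phi.
Proof.
move=> h1 h2 h3; rewrite ripC //; last exact: (l2D h2 h3).1.
by rewrite ripDr // (ripC h1 h2) (ripC h1 h3).
Qed.

Lemma ripBl phi psi chi : l2 phi -> l2 psi -> l2 chi ->
  rip (fun n => psi n - chi n) phi = rip psi phi - rip chi phi.
Proof.
move=> h1 h2 h3; rewrite ripC //; last exact: (l2B h2 h3).1.
by rewrite ripBr // (ripC h1 h2) (ripC h1 h3).
Qed.

Lemma ripZl phi psi (c : R) : l2 phi -> l2 psi ->
  rip (fun n => (c%:C)%C * psi n) phi = c * rip psi phi.
Proof.
move=> h1 h2; rewrite ripC //; last exact: (l2Z _ h2).1.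
by rewrite ripZr // (ripC h1 h2).
Qed.

Lemma rip_self phi : l2 phi -> rip phi phi = l2norm phi ^+ 2.
Proof.
move=> h; apply: rip_unique => //.
have -> : (fun N => ripN N phi phi) = (fun N => nrm N phi ^+ 2).
  apply/funext => N; rewrite nrm_sq; apply: eq_bigr => i _.
  by rewrite Re_conjM cabs_sqrE !expr2.
exact: cvg_sq.
Qed.

Lemma l2norm_sqD phi psi : l2 phi -> l2 psi ->
  l2norm (fun n => phi n + psi n) ^+ 2 =
  l2norm phi ^+ 2 + 2 * rip phi psi + l2norm psi ^+ 2.
Proof.
move=> h1 h2; have h12 := (l2D h1 h2).1.
rewrite -rip_self // ripDr // !ripDl // !rip_self // (ripC h2 h1); ring.
Qed.

Lemma l2norm_sqB phi psi : l2 phi -> l2 psi ->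
  l2norm (fun n => phi n - psi n) ^+ 2 =
  l2norm phi ^+ 2 - 2 * rip phi psi + l2norm psi ^+ 2.
Proof.
move=> h1 h2; have [h3 h4] := l2N h2.
rewrite (l2norm_sqD h1 h3) ripNr // h4; ring.
Qed.

Lemma l2_tail phi (e : R) : l2 phi -> 0 < e ->
  exists N : nat, forall n : int, N%:Z < `|n| -> cabs (phi n) <= e.
Proof.
move=> h e0; have e20 : 0 < e ^+ 2 by rewrite exprn_gt0.
have /cvgrPdist_lt /(_ _ e20) [N _ hN] := cvg_sq h.
exists N => n Nn.
have [m hm] : exists m, absz n = m.+1 by exists (absz n).-1; lia.
have h1 := hN m; have h2 : (N <= m)%N by lia.
have {h1 h2} := h1 h2; rewrite /= => /ltr_normlP[_ h1].
have h2 : nrm m phi ^+ 2 + cabs (phi n) ^+ 2 <= nrm m.+1 phi ^+ 2.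
  rewrite !nrm_sq wsumS.
  have [en|en] : n = m.+1%:Z \/ n = - m.+1%:Z by lia.
    by rewrite -en lerD2r lerDr sqr_ge0.
  by rewrite -en [leLHS]addrC lerDl sqr_ge0.
have h3 : nrm m.+1 phi ^+ 2 <= l2norm phi ^+ 2.
  by rewrite ler_sqr ?nnegrE ?nrm_ge0 ?l2norm_ge0 // nrm_le_l2norm.
rewrite -ler_sqr ?nnegrE ?cabs_ge0 ?(ltW e0) //.
move: h1 h2 h3; move: (l2norm _ ^+ 2) (nrm _ _ ^+ 2) (nrm _ _ ^+ 2)
  (cabs _ ^+ 2) (e ^+ 2) => x y z w u; lra.
Qed.

End real_inner_product.

Section schrodinger_operator.
Context {R : realType}.
Local Notation C := R[i].
Implicit Types phi psi chi : int -> C.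

Lemma wsum_shift (f : int -> R) N :
  wsum (fun n => f (n + 1)) N + f (- N%:Z) = wsum f N + f (N%:Z + 1).
Proof.
elim: N => [|N IH]; first by rewrite !wsum0 !add0r oppr0 addrC.
rewrite !wsumS (_ : - N.+1%:Z + 1 = - N%:Z); last by lia.
rewrite (_ : N.+1%:Z = N%:Z + 1); last by lia.
move: IH; move: (wsum _ _) (wsum _ _) => x y.
move: (f _) (f _) (f _) (f _) => p q s t; lra.
Qed.

Lemma l2_shiftr phi : l2 phi -> l2 (fun n => phi (n + 1)) /\
  l2norm (fun n => phi (n + 1)) <= l2norm phi.
Proof.
move=> h; apply: l2_bound => N; apply: le_trans (nrm_le_l2norm N.+1 h).
rewrite nrm_le ?nrm_ge0 // nrm_sq.
have := wsum_shift (fun n => cabs (phi n) ^+ 2) N; rewrite wsumS.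
have := sqr_ge0 (cabs (phi (- N%:Z))).
have := sqr_ge0 (cabs (phi (- N.+1%:Z))).
rewrite (_ : N.+1%:Z = N%:Z + 1); last by lia.
move: (wsum _ _) (wsum _ _) (_ ^+ 2) (_ ^+ 2) (_ ^+ 2) => a b c e f; lra.
Qed.

Lemma l2_shiftl phi : l2 phi -> l2 (fun n => phi (n - 1)) /\
  l2norm (fun n => phi (n - 1)) <= l2norm phi.
Proof.
move=> h; apply: l2_bound => N; apply: le_trans (nrm_le_l2norm N.+1 h).
rewrite nrm_le ?nrm_ge0 // nrm_sq.
have := wsum_shift (fun n => cabs (phi (n - 1)) ^+ 2) N; rewrite wsumS.
have -> : wsum (fun n => cabs (phi (n + 1 - 1)) ^+ 2) N =
   wsum (fun n => cabs (phi n) ^+ 2) N.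
  by apply: eq_bigr => i _; rewrite addrK.
rewrite addrK (_ : - N%:Z - 1 = - N.+1%:Z); last by lia.
have := sqr_ge0 (cabs (phi N%:Z)).
have := sqr_ge0 (cabs (phi N.+1%:Z)).
move: (wsum _ _) (wsum _ _) (_ ^+ 2) (_ ^+ 2) (_ ^+ 2) => a b c e f; lra.
Qed.

(** Summation by parts on a window leaves two boundary terms, which vanish in the limit because
    [phi] is bounded and [psi] tends to zero. *)
Lemma rip_shift phi psi : l2 phi -> l2 psi ->
  rip phi (fun n => psi (n + 1)) = rip (fun n => phi (n - 1)) psi.
Proof.
move=> h1 h2.
have h3 := (l2_shiftr h2).1; have h4 := (l2_shiftl h1).1.
pose g n := complex.Re ((phi (n - 1))^* * psi n).
have g0 (s : nat -> int) : (forall N, N%:Z <= `|s N|) ->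
    (fun N => g (s N)) @ \oo --> (0 : R).
  move=> hs; apply/cvgrPdist_le => /= e e0.
  pose M := l2norm phi + 1.
  have M0 : 0 < M by rewrite ltr_wpDl // l2norm_ge0.
  have [N hN] := l2_tail h2 (divr_gt0 e0 M0).
  exists N.+1 => // n /= hn; rewrite sub0r normrN.
  apply: le_trans (Re_le_cabs _) _; rewrite cabsM cabs_conj.
  apply: (@le_trans _ _ (M * (e / M))); last by rewrite mulrC divfK // gt_eqF.
  apply: ler_pM; rewrite ?cabs_ge0 //.
    by rewrite (le_trans (l2_entry _ h1)) // /M lerDl.
  by apply: hN; apply: lt_le_trans (hs n); rewrite ltz_nat.
have e N : ripN N phi (fun n => psi (n + 1)) =
   ripN N (fun n => phi (n - 1)) psi + (g (N%:Z + 1) - g (- N%:Z)).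
  rewrite addrA -(wsum_shift g) addrK; apply: eq_bigr => i _.
  by rewrite /g addrK.
have c1 := ripN_cvg h1 h3.
have c2 : (fun N => ripN N phi (fun n => psi (n + 1))) @ \oo -->
   rip (fun n => phi (n - 1)) psi + (0 - 0).
  have -> : (fun N => ripN N phi (fun n => psi (n + 1))) = (fun N =>
    ripN N (fun n => phi (n - 1)) psi + (g (N%:Z + 1) - g (- N%:Z))).
    by apply/funext.
  apply: cvgD; first exact: ripN_cvg.
  apply: cvgB; [apply: g0 => N; lia|apply: g0 => N; lia].
rewrite subr0 addr0 in c2.
exact: cvg_unique_real c1 c2.
Qed.

Variables (v : int -> C) (r : int -> R) (Bv : R).
Hypothesis v_real : forall n, v n = ((r n)%:C)%C.
Hypothesis v_bound : forall n, `|r n| <= Bv.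
Local Notation H := (schrodinger v).

Let l2_mult phi : l2 phi -> l2 (fun n => v n * phi n) /\
  l2norm (fun n => v n * phi n) <= Bv * l2norm phi.
Proof.
have Bv0 : 0 <= Bv by exact: le_trans (normr_ge0 _) (v_bound 0).
move=> h; apply: l2_bound => N.
apply: (@le_trans _ _ (Bv * nrm N phi)); last first.
  by rewrite ler_wpM2l // nrm_le_l2norm.
rewrite nrm_le ?mulr_ge0 ?nrm_ge0 // exprMn nrm_sq -wsumZ.
apply: ler_wsum => n _; rewrite cabsM exprMn ler_wpM2r ?sqr_ge0 //.
by rewrite ler_sqr ?nnegrE ?cabs_ge0 // v_real cabs_real.
Qed.

Lemma l2_schrodinger phi : l2 phi -> l2 (H phi) /\
  l2norm (H phi) <= (2 + Bv) * l2norm phi.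
Proof.
move=> h; have [s1 s2] := l2_shiftr h; have [t1 t2] := l2_shiftl h.
have [m1 m2] := l2_mult h.
have [a1 a2] := l2N s1; have [b1 b2] := l2B a1 t1; have [c1 c2] := l2D b1 m1.
split; first exact: c1.
apply: le_trans c2 _.
move: s2 t2 m2 a2 b2.
move: (l2norm _) (l2norm _) (l2norm _) (l2norm _) (l2norm _) => x1 x2 x3 x4 x5.
lra.
Qed.

Lemma schrodingerD phi psi :
  H (fun n => phi n + psi n) = (fun n => H phi n + H psi n).
Proof. by apply/funext => n; rewrite /schrodinger; ring. Qed.

Lemma schrodingerB phi psi :
  H (fun n => phi n - psi n) = (fun n => H phi n - H psi n).
Proof. by apply/funext => n; rewrite /schrodinger; ring. Qed.

Lemma schrodingerZ c phi : H (fun n => c * phi n) = (fun n => c * H phi n).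
Proof. by apply/funext => n; rewrite /schrodinger; ring. Qed.

Lemma schrodinger_selfadjoint phi psi : l2 phi -> l2 psi ->
  rip phi (H psi) = rip (H phi) psi.
Proof.
move=> h1 h2.
have [s1 _] := l2_shiftr h1; have [t1 _] := l2_shiftl h1; have [m1 _] := l2_mult h1.
have [s2 _] := l2_shiftr h2; have [t2 _] := l2_shiftl h2; have [m2 _] := l2_mult h2.
have [a1 _] := l2N s1; have [a2 _] := l2N s2.
have [b1 _] := l2B a1 t1; have [b2 _] := l2B a2 t2.
have e1 : rip phi (H psi) = - rip phi (fun n => psi (n + 1))
   - rip phi (fun n => psi (n - 1)) + rip phi (fun n => v n * psi n).
  by rewrite -ripNr // -ripBr // -ripDr.
have e2 : rip (H phi) psi = - rip psi (fun n => phi (n + 1))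
   - rip psi (fun n => phi (n - 1)) + rip psi (fun n => v n * phi n).
  rewrite ripC //; last exact: (l2_schrodinger h1).1.
  by rewrite -ripNr // -ripBr // -ripDr.
rewrite e1 e2 (rip_shift h1 h2) (rip_shift h2 h1).
rewrite (ripC t1 h2) (ripC t2 h1).
have -> : rip phi (fun n => v n * psi n) = rip psi (fun n => v n * phi n).
  apply: (cvg_unique_real (ripN_cvg h1 m2)).
  have -> : (fun N => ripN N phi (fun n => v n * psi n)) =
            (fun N => ripN N psi (fun n => v n * phi n)).
    apply/funext => N; apply: eq_bigr => i _; rewrite v_real.
    by case: (phi _) (psi _) => [x y] [z w] /=; ring.
  exact: ripN_cvg.
ring.
Qed.

Lemma eigen_recurrence phi E n : H phi = (fun n => (E%:C)%C * phi n) ->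
  phi (n + 1) = (v n - (E%:C)%C) * phi n - phi (n - 1).
Proof.
move=> /(congr1 (fun f => f n)); rewrite /schrodinger => e.
have -> : phi (n + 1) = - (- phi (n + 1) - phi (n - 1) + v n * phi n)
   + v n * phi n - phi (n - 1) by ring.
rewrite e; ring.
Qed.

Lemma eigen_zero phi E m : H phi = (fun n => (E%:C)%C * phi n) ->
  phi m = 0 -> phi (m + 1) = 0 -> phi = fun=> 0.
Proof.
move=> hE h0 h1.
have up (k : nat) : phi (m + k%:Z) = 0 /\ phi (m + k%:Z + 1) = 0.
  elim: k => [|k [IH1 IH2]]; first by rewrite addr0.
  have -> : m + k.+1%:Z = m + k%:Z + 1 by lia.
  by split=> //; rewrite (eigen_recurrence _ hE) IH2 addrK IH1 mulr0 subr0.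
have dn (k : nat) : phi (m - k%:Z) = 0 /\ phi (m - k%:Z + 1) = 0.
  elim: k => [|k [IH1 IH2]]; first by rewrite subr0.
  have e : m - k.+1%:Z + 1 = m - k%:Z by lia.
  rewrite e; split=> //.
  have := eigen_recurrence (m - k%:Z) hE.
  rewrite IH1 IH2 mulr0 sub0r (_ : m - k%:Z - 1 = m - k.+1%:Z); last by lia.
  by move=> /esym/eqP; rewrite oppr_eq0 => /eqP.
apply/funext => n; case: (leP m n) => hmn.
  by have [+ _] := up (absz (n - m)); rewrite (_ : m + _ = n) //; lia.
by have [+ _] := dn (absz (m - n)); rewrite (_ : m - _ = n) //; lia.
Qed.

(** The Wronskian [w] of two solutions at the same energy is constant in [n], and it tends to zero
    for square-summable solutions, so it vanishes. *)
Lemma eigen_simple phi psi E : l2 phi -> l2 psi -> phi <> (fun=> 0) ->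
  H phi = (fun n => (E%:C)%C * phi n) -> H psi = (fun n => (E%:C)%C * psi n) ->
  exists z : C, psi = fun n => z * phi n.
Proof.
move=> h1 h2 phi0 e1 e2.
pose w n := phi (n + 1) * psi n - phi n * psi (n + 1).
have wS n : w (n + 1) = w n.
  rewrite /w (eigen_recurrence (n + 1) e1) (eigen_recurrence (n + 1) e2) addrK.
  ring.
have w_cst (k : nat) : w k%:Z = w 0.
  by elim: k => // k IH; rewrite -IH -[RHS]wS; congr w; lia.
have w_cst' (k : nat) : w (- k%:Z) = w 0.
  by elim: k => [|k IH]; rewrite ?oppr0 // -IH -[LHS]wS; congr w; lia.
have w0 n : w n = 0.
  have -> : w n = w 0.
    have [->|->] : n = (absz n)%:Z \/ n = - (absz n)%:Z by lia.
      exact: w_cst.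
    exact: w_cst'.
  apply: cabs_eq0; apply/eqP; rewrite eq_le cabs_ge0 andbT.
  apply/ler_addgt0Pr => e e0; rewrite add0r.
  pose M := 2 * l2norm phi + 1.
  have p0 := l2norm_ge0 phi.
  have M0 : 0 < M by rewrite /M; lra.
  have [N hN] := l2_tail h2 (divr_gt0 e0 M0).
  have b1 : cabs (psi N.+1%:Z) <= e / M by apply: hN; lia.
  have b2 : cabs (psi (N.+1%:Z + 1)) <= e / M by apply: hN; lia.
  rewrite -(w_cst N.+1) (le_trans (cabsD _ _)) // cabsN !cabsM.
  have c1 := l2_entry (N.+1%:Z + 1) h1; have c2 := l2_entry N.+1%:Z h1.
  have d1 := ler_pM (cabs_ge0 _) (cabs_ge0 _) c1 b1.
  have d2 := ler_pM (cabs_ge0 _) (cabs_ge0 _) c2 b2.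
  apply: le_trans (lerD d1 d2) _.
  have -> : l2norm phi * (e / M) + l2norm phi * (e / M) = (2 * l2norm phi) * (e / M) by ring.
  apply: (@le_trans _ _ (M * (e / M))); last by rewrite mulrC divfK // gt_eqF.
  by rewrite ler_wpM2r ?divr_ge0 ?ltW // /M ltrDl.
have [m hm] : exists m, phi m <> 0.
  by apply: contrapT => hn; apply: phi0; apply/funext => n; apply: contrapT => h;
    apply: hn; exists n.
(* With this multiple the difference [chi] vanishes at [m], and by [w m = 0] also at [m + 1]; two
   consecutive zeros propagate through the recurrence. *)
exists (psi m / phi m).
have phim : phi m != 0 by apply/eqP.
pose chi n := psi n - psi m / phi m * phi n.
suff : chi = fun=> 0.
  by move=> h; apply/funext => n; apply/eqP; rewrite -subr_eq0 -[_ - _]/(chi n) h.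
apply: (@eigen_zero chi E m).
- rewrite schrodingerB schrodingerZ e1 e2; apply/funext => n; rewrite /chi; ring.
- by rewrite /chi divfK // subrr.
- rewrite /chi; apply: (mulfI phim); rewrite mulr0 mulrBr.
  rewrite mulrA [phi m * (psi m / phi m)]mulrC divfK //.
  by have := w0 m; rewrite /w => /eqP; rewrite subr_eq0 => /eqP <-; rewrite mulrC subrr.
Qed.

End schrodinger_operator.

(** * Eigenvectors of finite boxes and approximate eigenvectors *)

Section hermitian_eigenbasis.
Context {R : realType}.
Local Notation C := R[i].

(** The spectral theorem lists the eigenvalues in no particular order, whereas [eigval] sorts the
    roots of the characteristic polynomial. The two lists are permutations of each other, and the
    permutation [s] relabels the eigenvectors. *)
Lemma hermitian_eigenbasis (n : nat) (A : 'M[C]_n) (rts : seq C) :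
  (forall i j, A i j = (A j i)^* ) ->
  char_poly A = \prod_(z <- rts) ('X - z%:P) ->
  exists U : 'I_n -> 'cV[C]_n,
  [/\ forall j, A *m U j = ((nth 0 (sort <=%R (map (@complex.Re R) rts)) j)%:C)%C *: U j,
      forall i j, \sum_m (U i m 0)^* * U j m 0 = (i == j)%:R &
      forall m m', \sum_i (U i m' 0)^* * U i m 0 = (m == m')%:R].
Proof.
move=> Ah hrts.
have Aherm : A \is hermsymmx.
  apply/is_hermitianmxP; rewrite expr0 scale1r.
  by apply/matrixP => i j; rewrite !mxE Ah.
have /hermitian_normalmx/orthomx_spectralP AE := Aherm.
have Dreal := hermitian_spectral_diag_real Aherm.
set P := spectralmx A in AE; set D := spectral_diag A in AE Dreal.
have PU : P \is unitarymx by exact: spectral_unitarymx.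
have Punit : P \in unitmx by exact: spectral_unit.
have PPt : P *m map_mx Num.conj (P^T) = 1%:M by exact/unitarymxP.
have PtP : map_mx Num.conj (P^T) *m P = 1%:M by exact: mulmx1C.
have charA : char_poly A = \prod_(i < n) ('X - (D 0 i)%:P).
  have e1 : char_poly_mx A = map_mx polyC (invmx P) *m char_poly_mx (diag_mx D) *m map_mx polyC P.
    rewrite /char_poly_mx mulmxBr mulmxBl -!map_mxM -AE; congr (_ - _).
    by rewrite mul_mx_scalar -scalemxAl -map_mxM mulVmx // map_mx1 scalemx1.
  rewrite /char_poly e1 !det_mulmx mulrAC -det_mulmx -map_mxM mulVmx // map_mx1 det1 mul1r.
  rewrite -/(char_poly _) char_poly_trig ?diag_mx_is_trig //.
  by apply: eq_bigr => i _; rewrite mxE eqxx mulr1n.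
pose t : n.-tuple R := [tuple complex.Re (D 0 i) | i < n].
have hperm : perm_eq (sort <=%R (map (@complex.Re R) rts)) t.
  rewrite perm_sort.
  have -> : (t : seq R) = map (@complex.Re R) [seq D 0 i | i : 'I_n].
    by rewrite -map_comp.
  apply: perm_map; apply: prod_XsubC_eq; rewrite -hrts charA big_map.
  by rewrite big_enum.
have /tuple_permP[s hs] := hperm.
have eigE (j : 'I_n) : nth 0 (sort <=%R (map (@complex.Re R) rts)) j = complex.Re (D 0 (s j)).
  rewrite hs; have -> : nth 0 [tuple tnth t (s i) | i < n] j =
     tnth [tuple tnth t (s i) | i < n] j by rewrite (tnth_nth 0).
  by rewrite !tnth_mktuple.
exists (fun j => \col_m (P (s j) m)^*).
split=> [j|i j|m m'].
- rewrite eigE.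
  have -> : ((complex.Re (D 0 (s j)))%:C)%C = D 0 (s j).
    by rewrite RRe_real //; have /mxOverP := Dreal; exact.
  have -> : \col_m (P (s j) m)^* = map_mx Num.conj (P^T) *m delta_mx (s j) 0.
    by rewrite -colE; apply/colP => m; rewrite !mxE.
  rewrite mulmxA [in LHS]AE -(mulmxA _ P) PPt mulmx1 invmx_unitary // -mulmxA.
  have -> : diag_mx D *m delta_mx (s j) 0 = D 0 (s j) *: delta_mx (s j) 0 :> 'cV_n.
    apply/colP => m; rewrite -colE !mxE eqxx andbT.
    by case: eqVneq => [->|_]; rewrite ?mulr1n ?mulr0n ?mulr1 ?mulr0.
  by rewrite -scalemxAr.
- have /matrixP/(_ (s i) (s j)) := PPt; rewrite !mxE (inj_eq perm_inj) => <-.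
  by apply: eq_bigr => m _; rewrite !mxE conjCK.
- have /matrixP/(_ m m') := PtP; rewrite !mxE => <-.
  rewrite [RHS](reindex_inj (@perm_inj _ s)) /=; apply: eq_bigr => i _.
  by rewrite !mxE conjCK mulrC.
Qed.

End hermitian_eigenbasis.

Section finite_volume.
Context {R : realType}.
Local Notation C := R[i].
Variables (v : int -> C) (r : int -> R).
Hypothesis v_real : forall n, v n = ((r n)%:C)%C.

Lemma eigvals_spec (L : zitv) : exists2 rts : seq C,
  char_poly (dirichlet v L) = \prod_(z <- rts) ('X - z%:P) &
  forall j, eigval v L j = nth 0 (sort <=%R (map (@complex.Re R) rts)) j.
Proof.
exists (sval (closed_field_poly_normal (char_poly (dirichlet v L)))) => //.
case: closed_field_poly_normal => rts /= e; rewrite {1}e.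
by have /monicP -> := char_poly_monic (dirichlet v L); rewrite scale1r.
Qed.

Lemma dirichlet_hermitian (L : zitv) i j :
  dirichlet v L i j = (dirichlet v L j i)^*.
Proof.
rewrite !mxE eq_sym; case: eqP => [->|_].
  by rewrite v_real; apply/eqP; rewrite eq_complex /= oppr0 !eqxx.
by rewrite orbC; case: ifP => _; rewrite ?rmorphN ?rmorph1 ?rmorph0.
Qed.

Lemma dirichlet_schrodinger (N : nat) (psi : int -> C)
    (i : 'I_(zlen (symm N))) :
  (forall n : int, N%:Z < `|n| -> psi n = 0) ->
  (dirichlet v (symm N) *m win N psi) i 0 =
  schrodinger v psi ((i : nat)%:Z - N%:Z).
Proof.
move=> hsupp; rewrite mxE /schrodinger.
pose f (k : int) : C :=
  if k == i%:Z then v (- N%:Z + i%:Z) else if (k == i%:Z + 1) || (k + 1 == i%:Z) then -1 else 0.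
have -> : \sum_j dirichlet v (symm N) i j * win N psi j 0 =
   \sum_(j < N.*2.+1) f j%:Z * psi (j%:Z - N%:Z).
  apply: eq_bigr => j _; rewrite !mxE /f /=; congr (_ * _).
  rewrite (_ : (j%:Z == i%:Z) = (i == j)); last by rewrite eq_sym.
  rewrite (_ : (j%:Z == i%:Z + 1) = (i.+1 == j)); last by rewrite eq_sym; lia.
  by rewrite (_ : (j%:Z + 1 == i%:Z) = (j.+1 == i)) //; lia.
pose g (k : int) := f (k + N%:Z) * psi k.
have -> : \sum_(j < N.*2.+1) f j%:Z * psi (j%:Z - N%:Z) = wsum g N.
  by apply: eq_bigr => j _; rewrite /g subrK.
have ii : (i < N.*2.+1)%N := ltn_ord i.
pose m := i%:Z - N%:Z.
pose d (p : int) (c : C) (k : int) : C := if k == p then c else 0.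
have wd (p : int) (c : C) M : `|p| <= M%:Z -> wsum (d p c) M = c.
  move=> pM; have hi : (absz (p + M%:Z)%R < M.*2.+1)%N by lia.
  rewrite /wsum (bigD1 (Ordinal hi)) //= big1 ?addr0 => [|j jn].
    by rewrite /d ifT //; lia.
  rewrite /d ifF //; apply/negbTE; apply: contra jn => /eqP e.
  by apply/eqP/val_inj => /=; lia.
(* One more site on each side, where [psi] vanishes: both neighbours of [m] then lie in the window,
   and the ends of the box need no separate case. *)
have -> : wsum g N = wsum g N.+1.
  rewrite wsumS /g !hsupp ?mulr0 ?addr0 ?add0r //; lia.
have -> : wsum g N.+1 = wsum (fun k => d m (v m * psi m) k +
    (d (m + 1) (- psi (m + 1)) k + d (m - 1) (- psi (m - 1)) k)) N.+1.
  apply: eq_wsum => k _; rewrite /g /f /d.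
  have [->|km] := eqVneq k m.
    rewrite (_ : (m + N%:Z == i%:Z)); last by rewrite /m; lia.
    rewrite (_ : (m == m + 1) = false); last by lia.
    rewrite (_ : (m == m - 1) = false); last by lia.
    by rewrite !addr0; congr (v _ * _); rewrite /m; lia.
  rewrite ifF; last by rewrite /m in km *; lia.
  have [->|km1] := eqVneq k (m + 1).
    rewrite ifT; last by rewrite /m; lia.
    by rewrite ifF ?add0r ?addr0 ?mulN1r //; lia.
  have [->|km2] := eqVneq k (m - 1).
    rewrite ifT; last by rewrite /m; lia.
    by rewrite !add0r mulN1r.
  by rewrite ifF ?mul0r ?addr0 //; rewrite /m in km km1 km2 *; lia.
have hm1 : `|m| <= N.+1%:Z by rewrite /m; lia.
have hm2 : `|m + 1| <= N.+1%:Z by rewrite /m; lia.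
have hm3 : `|m - 1| <= N.+1%:Z by rewrite /m; lia.
rewrite !wsumD !wd //.
by rewrite addrC.
Qed.

Lemma unit_eigvecP (N : nat) (E : R) (psi : int -> C) :
  unit_eigvec v (symm N) E psi <->
  [/\ forall n : int, N%:Z < `|n| -> psi n = 0,
      forall n : int, `|n| <= N%:Z -> schrodinger v psi n = (E%:C)%C * psi n &
      nrm N psi = 1].
Proof.
have zsetE n : zset (symm N) n <-> `|n| <= N%:Z by rewrite /zset /=; lia.
have colE' : \col_(i < zlen (symm N)) psi (zlo (symm N) + (i : nat)%:Z) = win N psi.
  by apply/colP => i; rewrite !mxE /= addrC.
rewrite /unit_eigvec colE'; split=> -[h1 h2 h3].
  have supp (n : int) : N%:Z < `|n| -> psi n = 0.
    by move=> hn; apply: h1 => /zsetE; lia.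
  split=> //; last by rewrite -(l2_finsupp supp).2.
  move=> n hn.
  have hi : (absz (n + N%:Z)%R < N.*2.+1)%N by lia.
  have /matrixP/(_ (Ordinal hi) 0) := h2.
  rewrite (dirichlet_schrodinger _ supp) !mxE /= (_ : _ - _ = n) //; lia.
split=> //.
- by move=> n hn; apply: h1; rewrite ltNge; apply/negP => /zsetE.
- apply/colP => i; rewrite (dirichlet_schrodinger _ h1) !mxE h2 //.
  have hi : (i < N.*2.+1)%N := ltn_ord i; lia.
- by rewrite (l2_finsupp h1).2.
Qed.

Lemma finite_eigenbasis (N : nat) : exists e : 'I_(N.*2.+1) -> int -> C,
  [/\ forall j : 'I_(N.*2.+1), unit_eigvec v (symm N) (eigval v (symm N) j) (e j),
      forall phi : int -> C, (forall n : int, N%:Z < `|n| -> phi n = 0) ->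
        forall n, phi n = \sum_j wsum (fun k => (e j k)^* * phi k) N * e j n &
      forall a : 'I_(N.*2.+1) -> C,
        nrm N (fun n => \sum_j a j * e j n) ^+ 2 = \sum_j cabs (a j) ^+ 2].
Proof.
have [rts hchar heig] := eigvals_spec (symm N).
have [U [hU hon hcomp]] := hermitian_eigenbasis (dirichlet_hermitian (L := symm N)) hchar.
pose ext (u : 'cV[C]_(N.*2.+1)) (n : int) : C :=
  if `|n| <= N%:Z then u (inord (absz (n + N%:Z)%R)) 0 else 0.
have ext_win u : win N (ext u) = u.
  apply/colP => i; rewrite mxE /ext ifT; last by have := ltn_ord i; lia.
  rewrite subrK; congr (u _ _); apply/val_inj => /=; rewrite inordK //.
have ext_out u (n : int) : N%:Z < `|n| -> ext u n = 0.
  by move=> hn; rewrite /ext ifF //; lia.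
have ext_in u (i : 'I_N.*2.+1) : ext u ((i : nat)%:Z - N%:Z) = u i 0.
  by have /matrixP/(_ i 0) := ext_win u; rewrite mxE.
have parseval a : nrm N (fun n => \sum_j a j * ext (U j) n) ^+ 2 = \sum_j cabs (a j) ^+ 2.
  rewrite nrm_sq; apply: (@complexI R); rewrite /wsum !rmorph_sum /=.
  transitivity (\sum_(m < N.*2.+1) \sum_i \sum_j ((a i)^* * a j) * ((U i m 0)^* * U j m 0)).
    apply: eq_bigr => m _; rewrite -conjM_cabs rmorph_sum /= mulr_suml.
    apply: eq_bigr => i _; rewrite mulr_sumr; apply: eq_bigr => j _.
    rewrite rmorphM /= !ext_in; ring.
  rewrite exchange_big /=; apply: eq_bigr => i _.
  transitivity (\sum_j ((a i)^* * a j) * (i == j)%:R).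
    rewrite exchange_big /=; apply: eq_bigr => j _.
    by rewrite -hon mulr_sumr.
  rewrite (bigD1 i) //= eqxx mulr1 conjM_cabs big1 ?addr0 // => j ji.
  by rewrite eq_sym (negbTE ji) mulr0.
exists (fun j => ext (U j)); split=> // [j|phi supp n].
  apply/unit_eigvecP; split=> [|n hn|]; first exact: ext_out.
    have hi : (absz (n + N%:Z)%R < N.*2.+1)%N by lia.
    have := dirichlet_schrodinger (Ordinal hi) (ext_out (U j)).
    rewrite ext_win hU mxE -heig /= (_ : _ - _ = n); last by lia.
    move=> <-; congr (_ * _); rewrite /ext hn; congr (U j _ _).
    by apply/val_inj; rewrite /= inordK.
  have := parseval (fun i => (i == j)%:R).
  have -> : (fun n => \sum_i (i == j)%:R * ext (U i) n) = ext (U j).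
    apply/funext => n; rewrite (bigD1 j) //= eqxx mul1r big1 ?addr0 // => i ij.
    by rewrite (negbTE ij) mul0r.
  rewrite (bigD1 j) //= eqxx cabs1 expr1n big1 ?addr0 => [|i ij]; last first.
    by rewrite (negbTE ij) cabs0 expr0n.
  by move=> h; apply: sqr_inj_ge0; rewrite ?nrm_ge0 // h expr1n.
case: (ltP N%:Z `|n|) => hn.
  rewrite supp // big1 // => j _; by rewrite ext_out // mulr0.
have hi : (absz (n + N%:Z)%R < N.*2.+1)%N by lia.
have en : n = ((Ordinal hi : 'I_N.*2.+1) : nat)%:Z - N%:Z by rewrite /=; lia.
rewrite en; move: (Ordinal hi) => i {hn hi en}.
transitivity (\sum_(m < N.*2.+1) phi ((m : nat)%:Z - N%:Z) *
    \sum_j (U j m 0)^* * U j i 0).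
  rewrite (bigD1 i) //= hcomp eqxx mulr1 big1 ?addr0 // => m mi.
  by rewrite hcomp eq_sym (negbTE mi) mulr0.
under eq_bigr do rewrite mulr_sumr.
rewrite exchange_big /=; apply: eq_bigr => j _.
rewrite /wsum mulr_suml; apply: eq_bigr => m _; rewrite !ext_in; ring.
Qed.

End finite_volume.

Section approximate_eigenvectors.
Context {R : realType}.
Local Notation C := R[i].
Variables (v : int -> C) (r : int -> R).
Hypothesis v_real : forall n, v n = ((r n)%:C)%C.

Lemma schrodinger_sum (I : finType) (a : I -> C) (e : I -> int -> C) n :
  schrodinger v (fun n => \sum_j a j * e j n) n =
  \sum_j a j * schrodinger v (e j) n.
Proof.
rewrite /schrodinger mulr_sumr -!sumrN -!big_split /=.
by apply: eq_bigr => j _; ring.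
Qed.

Lemma unit_eigvec_phase (L : zitv) (E : R) psi (z : C) : cabs z = 1 ->
  unit_eigvec v L E psi -> unit_eigvec v L E (fun n => z * psi n).
Proof.
move=> z1 [h1 h2 h3].
have hl : l2 psi by apply: l2norm_neq0; rewrite h3 oner_neq0.
split; first by move=> n /h1 ->; rewrite mulr0.
  have -> : \col_(i < zlen L) (z * psi (zlo L + (i : nat)%:Z)) =
    z *: \col_(i < zlen L) psi (zlo L + (i : nat)%:Z).
    by apply/colP => i; rewrite !mxE.
  by rewrite -scalemxAr h2 !scalerA mulrC.
by rewrite (l2Z z hl).2 z1 h3 mul1r.
Qed.

Lemma unit_eigvec_l2 L (E : R) psi : unit_eigvec v L E psi -> l2 psi.
Proof. by case=> _ _ h; apply: l2norm_neq0; rewrite h oner_neq0. Qed.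

Section residual.
Variables (N : nat) (phi : int -> C) (E delta : R).
Hypothesis phi_supp : forall n : int, N%:Z < `|n| -> phi n = 0.
Hypothesis phi_unit : nrm N phi = 1.
Hypothesis delta_ge0 : 0 <= delta.
Hypothesis phi_res :
  nrm N (fun n => schrodinger v phi n - (E%:C)%C * phi n) <= delta.
Local Notation ev j := (eigval v (symm N) j).

Let expansion : exists (e : 'I_(N.*2.+1) -> int -> C) (c : 'I_(N.*2.+1) -> C),
  [/\ forall j : 'I_(N.*2.+1), unit_eigvec v (symm N) (ev j) (e j),
      forall n, phi n = \sum_j c j * e j n,
      forall a : 'I_(N.*2.+1) -> C,
        nrm N (fun n => \sum_j a j * e j n) ^+ 2 = \sum_j cabs (a j) ^+ 2,
      \sum_j cabs (c j) ^+ 2 = 1 &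
      \sum_(j < N.*2.+1) (ev j - E) ^+ 2 * cabs (c j) ^+ 2 <= delta ^+ 2].
Proof.
have [e [he hexp hpars]] := finite_eigenbasis v_real N.
pose c (j : 'I_(N.*2.+1)) : C := wsum (fun k => (e j k)^* * phi k) N.
exists e, c.
have hphi n : phi n = \sum_j c j * e j n by exact: hexp.
split=> //.
  rewrite -hpars -[RHS](expr1n _ 2) -phi_unit !nrm_sq; apply: eq_wsum => n _.
  by rewrite -hphi.
have -> : \sum_(j < N.*2.+1) (ev j - E) ^+ 2 * cabs (c j) ^+ 2 =
   \sum_(j < N.*2.+1) cabs (((ev j - E)%:C)%C * c j) ^+ 2.
  by apply: eq_bigr => j _; rewrite cabsM cabs_real exprMn real_normK ?num_real.
rewrite -(hpars (fun j : 'I_(N.*2.+1) => ((ev j - E)%:C)%C * c j)).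
have -> : nrm N (fun n => \sum_(j < N.*2.+1) ((ev j - E)%:C)%C * c j * e j n) ^+ 2 =
   nrm N (fun n => schrodinger v phi n - (E%:C)%C * phi n) ^+ 2.
  rewrite !nrm_sq; apply: eq_wsum => n hn; congr (cabs _ ^+ 2).
  have -> : phi = (fun n => \sum_j c j * e j n) by apply/funext.
  rewrite schrodinger_sum mulr_sumr -sumrB; apply: eq_bigr => j _.
  have [_ h2e _] := (unit_eigvecP v N _ _).1 (he j); rewrite h2e //.
  by rewrite rmorphB /=; ring.
by rewrite ler_sqr ?nnegrE ?nrm_ge0.
Qed.

(** The weights [cabs (c j) ^+ 2] have sum 1, and the weighted mean of the squared distances to [E]
    is at most [delta ^+ 2]; not all distances can exceed [delta]. *)
Lemma approx_eigenvalue : exists j : 'I_(N.*2.+1), `|ev j - E| <= delta.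
Proof.
have [e [c [he hphi hp h1 h2]]] := expansion.
apply: contrapT => hn.
have hj (j : 'I_(N.*2.+1)) : delta ^+ 2 < (ev j - E) ^+ 2.
  rewrite -[ltRHS]real_normK ?num_real // ltr_sqr ?nnegrE // ltNge.
  by apply/negP => h; apply: hn; exists j.
have h3 : \sum_(j < N.*2.+1) ((ev j - E) ^+ 2 - delta ^+ 2) * cabs (c j) ^+ 2 <= 0.
  under eq_bigr do rewrite mulrBl.
  by rewrite sumrB -mulr_sumr h1 mulr1 subr_le0.
have h4 : \sum_(j < N.*2.+1) ((ev j - E) ^+ 2 - delta ^+ 2) * cabs (c j) ^+ 2 = 0.
  apply/eqP; rewrite eq_le h3 /=; apply: sumr_ge0 => j _.
  by rewrite mulr_ge0 ?sqr_ge0 // subr_ge0 ltW.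
have h5 : \sum_(j < N.*2.+1) cabs (c j) ^+ 2 = 0.
  apply: big1 => j _; have /psumr_eq0P := h4 => /(_ _ j isT) h.
  have /eqP : ((ev j - E) ^+ 2 - delta ^+ 2) * cabs (c j) ^+ 2 = 0.
    by apply: h => k _; rewrite mulr_ge0 ?sqr_ge0 // subr_ge0 ltW.
  by rewrite mulf_eq0 subr_eq0 gt_eqF //= => /eqP.
by have := oner_neq0 R; rewrite -h1 h5 eqxx.
Qed.

(** All other eigenvalues are at distance at least [s / 2] from [E], so the components off [j] have
    total norm at most [eta = 2 * delta / s]. The component along [j] then has modulus within [eta]
    of 1, and its phase is put into the eigenvector. *)
Lemma approx_eigenvector (j : 'I_(N.*2.+1)) (s : R) : 0 < s -> 4 * delta <= s ->
  `|ev j - E| <= delta ->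
  (forall k : nat, (k < N.*2.+1)%N -> k != j :> nat -> s < `|ev k - ev j|) ->
  exists2 psi, unit_eigvec v (symm N) (ev j) psi &
    l2norm (fun n => psi n - phi n) <= 4 * delta / s.
Proof.
move=> s0 ds hj hsep.
have [e [c [he hphi hp h1 h2]]] := expansion.
pose eta := 2 * delta / s.
have eta0 : 0 <= eta by rewrite divr_ge0 ?mulr_ge0 // ltW.
have eta1 : eta <= 1 / 2 by rewrite ler_pdivrMr //; lra.
have tail : \sum_(k | k != j) cabs (c k) ^+ 2 <= eta ^+ 2.
  have -> : eta ^+ 2 = delta ^+ 2 / (s / 2) ^+ 2.
    by rewrite /eta; field; lra.
  rewrite ler_pdivlMr ?exprn_gt0 ?divr_gt0 // mulr_suml.
  apply: le_trans h2; rewrite [leRHS](bigD1 j) //= -[leLHS]add0r.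
  apply: lerD; first by rewrite mulr_ge0 ?sqr_ge0.
  apply: ler_sum => k kj; rewrite mulrC ler_wpM2r ?sqr_ge0 //.
  rewrite -[leRHS]real_normK ?num_real // ler_sqr ?nnegrE ?divr_ge0 ?(ltW s0) //.
  have := hsep k (ltn_ord k) kj; have := ler_distD E (ev k) (ev j).
  rewrite [`|E - _|]distrC; move: hj.
  move: (`|_|) (`|_|) (`|_|) => x y z; lra.
have cj : 1 - eta ^+ 2 <= cabs (c j) ^+ 2.
  by rewrite -h1 (bigD1 j) //= lerBlDr lerD2l.
have eta2 : eta ^+ 2 <= 1 / 4.
  by have := ler_sqr (x := eta) (y := 1 / 2); rewrite !nnegrE; nra.
have a0 : 0 < cabs (c j).
  rewrite lt_neqAle cabs_ge0 andbT eq_sym; apply/eqP => a0.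
  by move: cj; rewrite a0 expr0n /=; lra.
have a1 : cabs (c j) <= 1.
  rewrite -(ler_sqr (y := 1)) ?nnegrE ?cabs_ge0 // expr1n -h1 (bigD1 j) //= lerDl.
  by apply: sumr_ge0 => k _; exact: sqr_ge0.
pose z := c j / ((cabs (c j))%:C)%C.
have z1 : cabs z = 1.
  rewrite cabsM ComplexField.Normc.normcV cabs_real ger0_norm ?cabs_ge0 //.
  by rewrite mulfV // gt_eqF.
have uz := unit_eigvec_phase z1 (he j).
exists (fun n => z * e j n) => //.
pose a k := if k == j then z - c j else - c k.
have hd : (fun n => z * e j n - phi n) = (fun n => \sum_k a k * e k n).
  apply/funext => n; rewrite hphi (bigD1 j) //= [RHS](bigD1 j) //= /a eqxx.
  rewrite opprD addrA -mulrBl; congr (_ + _); rewrite -sumrN.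
  by apply: eq_bigr => k kj; rewrite (negbTE kj) mulNr.
have dsupp n : N%:Z < `|n| -> z * e j n - phi n = 0.
  move=> hn; rewrite phi_supp // subr0.
  have [h1e _ _] := (unit_eigvecP v N _ _).1 (he j).
  by rewrite h1e // mulr0.
rewrite (l2_finsupp dsupp).2.
have -> : 4 * delta / s = 2 * eta by rewrite /eta; ring.
have hnd : nrm N (fun n => z * e j n - phi n) ^+ 2 = \sum_k cabs (a k) ^+ 2.
  by rewrite -hp; congr (nrm N _ ^+ 2).
have e20 : 0 <= 2 * eta by rewrite mulr_ge0.
rewrite nrm_le // -nrm_sq.
apply: (le_trans (le_of_eq hnd)); rewrite (bigD1 j) //= /a eqxx.
have -> : \sum_(k | k != j) cabs (if k == j then z - c j else - c k) ^+ 2 =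
   \sum_(k | k != j) cabs (c k) ^+ 2.
  by apply: eq_bigr => k kj; rewrite (negbTE kj) cabsN.
have zc : cabs (z - c j) = 1 - cabs (c j).
  have -> : z - c j = ((1 - cabs (c j))%:C)%C * z.
    rewrite rmorphB /= mulrBl mul1r; congr (_ - _).
    by rewrite /z mulrC divfK // eq_complex /= negb_and gt_eqF.
  by rewrite cabsM z1 mulr1 cabs_real ger0_norm // subr_ge0.
rewrite zc; move: tail cj eta2 a0 a1 eta0 eta1.
move: (\sum_(_ | _) _) (cabs (c j)) => t y; move: (eta) => h.
move=> q1 q2 q3 q4 q5 q6 q7.
have : (1 - y) ^+ 2 <= h ^+ 2 by rewrite ler_sqr ?nnegrE; nra.
nra.
Qed.

End residual.

Lemma eigval_bound (N : nat) (E Bv : R) psi : (forall n, `|r n| <= Bv) ->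
  unit_eigvec v (symm N) E psi -> `|E| <= 2 + Bv.
Proof.
move=> hB hu; have [h1 h2 h3] := (unit_eigvecP v N _ _).1 hu.
have hl := unit_eigvec_l2 hu; have [_ _ h4] := hu.
have [q1 q2] := l2_schrodinger v_real hB hl; rewrite h4 mulr1 in q2.
apply: le_trans q2; apply: le_trans (nrm_le_l2norm N q1).
have -> : nrm N (schrodinger v psi) = nrm N (fun n => (E%:C)%C * psi n).
  by apply: sqr_inj_ge0; rewrite ?nrm_ge0 // !nrm_sq; apply: eq_wsum => n hn; rewrite h2.
by rewrite nrmZ h3 mulr1 cabs_real.
Qed.

End approximate_eigenvectors.

Lemma log_arith {R : realFieldType} (x y z w : R) :
  x <= 6^-1 * y -> - z <= w / 2 -> y <= 3 * w -> x <= z + w.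
Proof. lra. Qed.

(** * Size conditions on the scales *)

Section asymptotics.
Context {R : realType}.

(** For [e < 1] the left side is smaller than any power of [N]. Half of [ln N] pays for the power,
    which is at most a sixth of [logbar (N ^ 2) <= 3 ln N]; the other half pays for [c]. *)
Lemma exp_log_powR_small (e c : R) : 0 < e < 1 -> 0 < c ->
  exists n0 : nat, forall N : nat, (n0 <= N)%N ->
    expR (logbar (R := R) (N ^ 2) `^ e) <= c * N%:R.
Proof.
move=> /andP[e0 e1] c0.
have e10 : 0 < 1 - e by lra.
have s6 : 0 < (6 : R)^-1 by lra.
have [n1 h1] := powR_sublinear e10 s6.
pose t : R := n1%:R + `|2 * ln c|.
exists (Num.truncn (expR t) + 3)%N => N hN.
have N3 : (3 <= N)%N by exact: leq_trans (leq_addl _ _) hN.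
have N0 : 0 < N%:R :> R by rewrite ltr0n (leq_trans _ N3).
have hln : t <= ln N%:R.
  rewrite -ler_expR lnK ?posrE //; apply: le_trans (ltW (truncnS_gt _)) _.
  by rewrite ler_nat; apply: leq_trans hN; rewrite -addn1 leq_add2l.
have lnN : ln N%:R <= logbar (R := R) (N ^ 2).
  rewrite /logbar ler_ln ?posrE // ler_nat; nia.
have lnN3 : logbar (R := R) (N ^ 2) <= 3 * ln N%:R.
  rewrite mulr_natl -lnXn // /logbar ler_ln ?posrE ?exprn_gt0 // -natrX ler_nat.
  rewrite !expnS expn0 muln1; nia.
have h2 : logbar (R := R) (N ^ 2) `^ e <= 6^-1 * logbar (R := R) (N ^ 2).
  have := h1 (logbar (N ^ 2)); rewrite (_ : 1 - (1 - e) = e); last by ring.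
  apply; apply: le_trans lnN; apply: le_trans hln; by rewrite /t lerDl.
have h3 : - ln c <= ln N%:R / 2.
  have : `|2 * ln c| <= ln N%:R by apply: le_trans hln; rewrite /t lerDr.
  move=> /ler_normlP[h _]; move: h; move: (ln c) (ln N%:R) => x y; lra.
rewrite -[leRHS]lnK ?posrE ?mulr_gt0 // ler_expR lnM ?posrE //.
exact: log_arith h2 h3 lnN3.
Qed.

Lemma mul_expN_small (A a : R) : 0 < a ->
  exists n0 : nat, forall N : nat, (n0 <= N)%N -> A * N%:R * expR (- (a * N%:R)) <= 1.
Proof.
move=> a0; pose A1 := `|A| + 1.
have A1p : 0 < A1 by rewrite ltr_wpDl.
have h20 : 0 < (1 / 2 : R) by lra.
have [n0 h] := @expR_powR_small R (1 / 2) A1 h20.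
have [n1 h1] := @powR_large R (1 / 2) a^-1 h20.
exists (n0 + n1).+1 => N hN.
have hn0 : (n0 <= N)%N by lia.
have hn1 : n1%:R <= N%:R :> R by rewrite ler_nat; lia.
have N0 : 0 < N%:R :> R by rewrite ltr0n; lia.
apply: le_trans (h N hn0).
have hA : A <= A1 by rewrite /A1 (le_trans (ler_norm _)) // lerDl.
apply: (@le_trans _ _ (A1 * N%:R * expR (- (a * N%:R)))).
  by rewrite ler_wpM2r ?expR_ge0 // ler_wpM2r // ltW.
rewrite ler_wpM2l ?mulr_ge0 ?(ltW A1p) ?(ltW N0) // ler_expR lerN2.
have -> : a * N%:R = a * N%:R `^ (1 / 2) * N%:R `^ (1 / 2).
  rewrite -mulrA -powRD; last by rewrite (gt_eqF N0) implybT.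
  by rewrite (_ : 1 / 2 + 1 / 2 = 1) ?powRr1 ?ltW //; lra.
rewrite -[leLHS]mul1r ler_wpM2r ?powR_ge0 //.
by have := h1 _ hn1; rewrite -ler_pdivrMl // mulr1.
Qed.

End asymptotics.

(** * Towers of eigenpairs *)

Section distance_to_interval.
Context {R : realType}.
Implicit Type A : set int.

Lemma zdist_fineK n A : A !=set0 ->
  zdist (R := R) n A = (fine (zdist (R := R) n A))%:E.
Proof.
move=> [m Am]; rewrite fineK // ge0_fin_numE.
  by apply: le_lt_trans (ltry ((`|n - m|)%:~R : R)); apply: ereal_inf_lbound; exists m.
by apply: le_ereal_inf_tmp => _ [k _ <-]; rewrite lee_fin ler0z.
Qed.

Lemma zdist_le n A m : A m -> fine (zdist (R := R) n A) <= (`|n - m|)%:~R.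
Proof.
move=> Am; have hA : A !=set0 by exists m.
by rewrite -lee_fin -zdist_fineK //; apply: ereal_inf_lbound; exists m.
Qed.

Lemma zdist_ge n A (D : R) : A !=set0 -> (forall m, A m -> D <= (`|n - m|)%:~R) ->
  D <= fine (zdist (R := R) n A).
Proof.
move=> hA h; rewrite -lee_fin -zdist_fineK //.
by apply: le_ereal_inf_tmp => _ [m Am <-]; rewrite lee_fin h.
Qed.

End distance_to_interval.

Section exponentials.
Context {R : realType}.
Implicit Types x y z l : R.

Lemma expR5_ge : 32 <= expR (5 : R).
Proof.
have h1 : 2 <= expR (1 : R) by have := @expR_ge1Dx R 1; lra.
have e : expR (5 : R) = expR 1 * expR 1 * (expR 1 * expR 1) * expR 1.
  by rewrite -!expRD; congr expR; ring.
have h2 : 4 <= expR (1 : R) * expR 1 by nra.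
have h4 : 16 <= expR (1 : R) * expR 1 * (expR 1 * expR 1) by nra.
rewrite e; nra.
Qed.

(** A margin of 5 in an exponent buys the factor 32, which absorbs the numerical constants of the
    tower estimates. *)
Lemma expR_gap x y : x + 5 <= y -> 32 * expR x <= expR y.
Proof.
move=> h; apply: (@le_trans _ _ (expR 5 * expR x)).
  by rewrite ler_wpM2r ?expR_ge0 // expR5_ge.
by rewrite -expRD ler_expR; lra.
Qed.

(** The residual is [2 exp(-x/8)] and the separation [exp(-c l)]. As 1/8 - 1/10 = 1/40, the
    condition [n + 5 <= x / 40] pays for the separation and leaves a factor 32, which turns 8 into
    1/4. *)
Lemma separation_ratio x l c n : c * l <= `|c| * l -> `|c| * l <= n ->
  n + 5 <= x / 40 ->
  4 * (2 * expR (- (x / 8))) / expR (- c * l) <= 1 / 4 * expR (- (x / 10)).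
Proof.
move=> h1 h2 h3; have -> : (expR (- c * l))^-1 = expR (c * l) by rewrite mulNr expRN invrK.
have h4 : expR (- (x / 8)) * expR (c * l) <= expR (- (x / 8) + n).
  by rewrite -expRD ler_expR; lra.
have h5 : 32 * expR (- (x / 8) + n) <= expR (- (x / 10)) by apply: expR_gap; lra.
have -> : 4 * (2 * expR (- (x / 8))) * expR (c * l) =
  8 * (expR (- (x / 8)) * expR (c * l)) by ring.
move: h4 h5; move: (_ * _) (expR _) (expR _) => a b d; lra.
Qed.

End exponentials.

Lemma leq_sum6 (n1 n2 n3 n4 n5 n6 N : nat) : (4 + n1 + n2 + n3 + n4 + n5 + n6 <= N)%N ->
  [/\ (4 <= N)%N, [/\ n1 <= N, n2 <= N & n3 <= N]%N & [/\ n4 <= N, n5 <= N & n6 <= N]%N].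
Proof. by move=> h; split; [lia|split; lia|split; lia]. Qed.

Lemma ltn_double3 (N : nat) : (4 <= N)%N -> (N.*2.+1 <= 3 * N)%N.
Proof. lia. Qed.

Section good_scales.
Context {R : realType}.
Variables (gamma eps sigma CV delta : R).

(** Sizes are taken at [N ^ 2] because [step] uses localization on both boxes and measures it in
    units of [N]. [gs_sep] makes the separation dominate the residual, [gs_mass] contradicts the
    normalization of a vector that is small everywhere, and [gs_delta] keeps the drift of the energy
    within the range of semicontinuity. *)
Record good_scale (N : nat) : Prop := GoodScale {
  gs_4 : (4 <= N)%N ;
  gs_s : expR (logbar (R := R) (N ^ 2) `^ (2 * eps * sigma)) <= N%:R / 100 ;
  gs_l : expR (logbar (R := R) (N ^ 2) `^ (5 * eps)) <= N%:R / 100 ;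
  gs_sep : `|CV| * expR (logbar (R := R) (N ^ 2) `^ (5 * eps)) + 5
             <= gamma * N%:R / 40 ;
  gs_big : 1000 <= gamma * N%:R ;
  gs_mass : (N.*2.+1)%:R * (4 * expR (- (gamma * N%:R / 50))) < 1 ;
  gs_delta : expR (- (gamma / 10 * N%:R)) <= delta
}.

Lemma good_scale_exists : 0 < gamma -> 0 < eps < 1 / 5 -> 0 < sigma < 1 -> 0 < delta ->
  exists C0 : nat, forall N, (C0 <= N)%N -> good_scale N.
Proof.
move=> g0 /andP[e0 e1] /andP[s0 s1] d0.
have e5 : 0 < 5 * eps < 1 by apply/andP; split; lra.
have es : 0 < 2 * eps * sigma < 1.
  apply/andP; split; first by rewrite !mulr_gt0.
  have h : eps * sigma <= eps * 1 by rewrite ler_wpM2l ?ltW.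
  by rewrite -mulrA; lra.
have c1 : 0 < (100 : R)^-1 by lra.
have [n1 h1] := exp_log_powR_small es c1.
have [n2 h2] := exp_log_powR_small e5 c1.
pose c3 := gamma / 80 / (`|CV| + 1).
have CV1 : 0 < `|CV| + 1 by rewrite ltr_wpDl.
have c30 : 0 < c3 by rewrite !divr_gt0.
have [n3 h3] := exp_log_powR_small e5 c30.
have g50 : 0 < gamma / 50 by lra.
have [n5 h5] := mul_expN_small 16 g50.
have g10 : 0 < gamma / 10 by lra.
have [n6 h6] := mul_expN_small delta^-1 g10.
pose n4 := (Num.truncn (1000 / gamma)).+1.
exists (4 + n1 + n2 + n3 + n4 + n5 + n6)%N => N hN.
have [N4 [N1 N2 N3] [N5 N6 N7]] := leq_sum6 hN.
have N0 : 0 < N%:R :> R by rewrite ltr0n; exact: leq_trans N4.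
have big : 1000 <= gamma * N%:R.
  rewrite mulrC -ler_pdivrMr //; apply: (le_trans (ltW (truncnS_gt _))).
  by rewrite ler_nat.
split=> //.
- by rewrite [_ / 100]mulrC; exact: h1.
- by rewrite [_ / 100]mulrC; exact: h2.
- have q : (`|CV| + 1) * expR (logbar (R := R) (N ^ 2) `^ (5 * eps)) <= gamma / 80 * N%:R.
    apply: (@le_trans _ _ ((`|CV| + 1) * (c3 * N%:R))).
      by rewrite ler_wpM2l ?(ltW CV1) // h3.
    by rewrite mulrA /c3 [_ * (_ / _)]mulrC divfK // gt_eqF.
  have q2 := expR_ge0 (logbar (R := R) (N ^ 2) `^ (5 * eps)).
  rewrite mulrAC in q.
  move: q q2 big; move: (expR _) => y; move: (gamma * N%:R) (`|CV|) => z w; lra.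
- have := h5 N N6; have E0 := expR_gt0 (- (gamma / 50 * N%:R)).
  rewrite (_ : gamma * N%:R / 50 = gamma / 50 * N%:R); last by ring.
  have : (N.*2.+1)%:R <= 3 * N%:R :> R.
    by rewrite -natrM ler_nat; exact: ltn_double3.
  move: E0 N0; move: (expR _) => y; move: ((N.*2.+1)%:R : R) (N%:R : R) => z w y0 w0 q1 q2.
  have q3 : z * (4 * y) <= 3 * w * (4 * y).
    by rewrite ler_wpM2r // mulr_ge0 // ltW.
  have q4 : 0 < w * y by rewrite mulr_gt0.
  lra.
- have := h6 N N7; have E0 := expR_gt0 (- (gamma / 10 * N%:R)).
  have N1' : 1 <= N%:R :> R by rewrite ler1n; exact: leq_trans N4.
  rewrite -mulrA ler_pdivrMl // mulr1 => q; apply: le_trans q.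
  by apply: ler_peMl => //; exact: ltW.
Qed.

Lemma logbar_mono (N M : nat) (e : R) : (N <= M)%N -> 0 <= e ->
  expR (logbar (R := R) N `^ e) <= expR (logbar (R := R) M `^ e).
Proof.
move=> NM e0; rewrite ler_expR; apply: ge0_ler_powR; rewrite ?nnegrE ?ln_ge0 ?ler1n //.
by rewrite ler_ln ?posrE ?ltr0n // ler_nat; lia.
Qed.

End good_scales.

Lemma absz_ends (N : nat) : `|N%:Z| = N%:Z /\ `|- N%:Z| = N%:Z.
Proof. by split; lia. Qed.

Lemma outside_square (N : nat) (n : int) : (N < N ^ 2)%N -> (N ^ 2)%:Z < `|n| -> N%:Z < `|n|.
Proof. lia. Qed.

Lemma zset_dist (L : zitv) (m n : int) : zset L m -> zset L n -> `|m - n| <= (zlen L)%:Z.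
Proof. rewrite /zset /=; lia. Qed.

Section truncation.
Context {R : realType}.
Local Notation C := R[i].
Variables (v : int -> C) (N : nat) (psi : int -> C) (E : C).
Hypothesis supp : forall n : int, N%:Z < `|n| -> psi n = 0.
Hypothesis heq : forall n : int, `|n| <= N%:Z -> schrodinger v psi n = E * psi n.

(* The equation on [-N, N] fails on Z only at the two sites next to the ends. *)
Lemma truncation_defect (M : nat) : (N.+1 <= M)%N ->
  nrm M (fun n => schrodinger v psi n - E * psi n) ^+ 2
    = cabs (psi N%:Z) ^+ 2 + cabs (psi (- N%:Z)) ^+ 2.
Proof.
move=> NM; set rho := fun n => _.
have rho_in (n : int) : `|n| <= N%:Z -> rho n = 0.
  by move=> hn; rewrite /rho heq // subrr.
have rho_out (n : int) : N.+1%:Z < `|n| -> rho n = 0.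
  move=> hn; rewrite /rho /schrodinger !supp ?mulr0 ?subr0 ?oppr0 ?addr0 //; lia.
have rho_edge : cabs (rho N.+1%:Z) = cabs (psi N%:Z) /\
                cabs (rho (- N.+1%:Z)) = cabs (psi (- N%:Z)).
  split; rewrite /rho /schrodinger.
    rewrite (supp (n := N.+1%:Z + 1)) ?(supp (n := N.+1%:Z)); [|lia|lia].
    rewrite (_ : N.+1%:Z - 1 = N%:Z); last by lia.
    by rewrite oppr0 !mulr0 sub0r addr0 subr0 cabsN.
  rewrite (supp (n := - N.+1%:Z - 1)) ?(supp (n := - N.+1%:Z)); [|lia|lia].
  rewrite (_ : - N.+1%:Z + 1 = - N%:Z); last by lia.
  by rewrite !mulr0 subr0 addr0 subr0 cabsN.
rewrite nrm_sq (wsum_stable NM); last by move=> n hn; rewrite rho_out // cabs0 expr0n.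
rewrite wsumS.
have -> : wsum (fun n => cabs (rho n) ^+ 2) N = 0.
  rewrite /wsum big1 // => i _; rewrite rho_in ?cabs0 ?expr0n //.
  by have := ltn_ord i; lia.
by rewrite rho_edge.1 rho_edge.2 addr0 addrC.
Qed.

End truncation.

Section induction_step.
Context {R : realType}.
Local Notation C := R[i].
Variables (v : int -> C) (r : int -> R).
Hypothesis v_real : forall n, v n = ((r n)%:C)%C.
Variables (gamma eps sigma CV delta : R).
Hypothesis gamma_gt0 : 0 < gamma.
Hypothesis eps_ge0 : 0 <= eps.
Hypothesis sigma_ge0 : 0 <= sigma.
Variables (Lf : R -> R) (I : nat -> R -> zitv) (Nst : nat).
Local Notation ev N j := (eigval v (symm N) j).

(** [localization] with [omega] and [x] frozen. [Lf] is the Lyapunov exponent as a function of the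
    energy; the tower construction uses it only through lower bounds. *)
Definition localized (N : nat) : Prop := forall j : nat, (j < N.*2.+1)%N ->
  gamma < Lf (ev N j) ->
  [/\ zset (I N (ev N j)) `<=` zset (symm N),
      (0 < zlen (I N (ev N j)))%N /\
        (zlen (I N (ev N j)))%:R < expR (logbar N `^ (5 * eps)),
      forall psi, unit_eigvec v (symm N) (ev N j) psi ->
        forall m, zset (symm N) m ->
        ((expR (logbar N `^ (2 * eps * sigma)))%:E < zdist m (zset (I N (ev N j))))%E ->
        cabs (psi m) < expR (- (gamma / 4) * fine (zdist m (zset (I N (ev N j))))) &
      forall k : nat, (k < N.*2.+1)%N -> k != j ->
        expR (- CV * (zlen (I N (ev N j)))%:R) < `|ev N k - ev N j|].

Hypothesis loc : forall N, (Nst <= N)%N -> localized N.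
Hypothesis good : forall N, (Nst <= N)%N -> good_scale gamma eps sigma CV delta N.

Definition centered (N j : nat) (c : R) : Prop :=
  forall m, zset (I N (ev N j)) m -> (`|m|)%:~R <= c.

Lemma interval_nonempty N j : (Nst <= N)%N -> (j < N.*2.+1)%N -> gamma < Lf (ev N j) ->
  zset (I N (ev N j)) !=set0.
Proof.
move=> hN hj hL; have [_ [h _] _ _] := loc hN hj hL.
by exists (zlo (I N (ev N j))); rewrite /zset /=; lia.
Qed.

Lemma decay_away N j psi (n : int) (D : R) : (Nst <= N)%N -> (j < N.*2.+1)%N ->
  gamma < Lf (ev N j) -> unit_eigvec v (symm N) (ev N j) psi ->
  expR (logbar N `^ (2 * eps * sigma)) < D ->
  (forall m, zset (I N (ev N j)) m -> D <= (`|n - m|)%:~R) ->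
  cabs (psi n) <= expR (- (gamma / 4 * fine (zdist (R := R) n (zset (I N (ev N j)))))).
Proof.
move=> hN hj hL hu hD hm.
have hne := interval_nonempty hN hj hL.
have [_ _ h3 _] := loc hN hj hL.
have hz := zdist_ge hne hm.
have [hn|hn] := pselect (zset (symm N) n).
  apply: ltW; rewrite -mulNr; apply: (h3 psi hu n hn).
  by rewrite zdist_fineK // lte_fin; exact: lt_le_trans hz.
by case: hu => -> // _ _; rewrite cabs0 expR_ge0.
Qed.

Lemma decay_away' N j psi (n : int) (D : R) : (Nst <= N)%N -> (j < N.*2.+1)%N ->
  gamma < Lf (ev N j) -> unit_eigvec v (symm N) (ev N j) psi ->
  expR (logbar N `^ (2 * eps * sigma)) < D ->
  (forall m, zset (I N (ev N j)) m -> D <= (`|n - m|)%:~R) ->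
  cabs (psi n) <= expR (- (gamma / 4 * D)).
Proof.
move=> hN hj hL hu hD hm; apply: le_trans (decay_away hN hj hL hu hD hm) _.
have hz := zdist_ge (interval_nonempty hN hj hL) hm.
by rewrite ler_expR lerN2 ler_wpM2l // divr_ge0 // ltW.
Qed.

Lemma good_s N : (Nst <= N)%N -> expR (logbar N `^ (2 * eps * sigma)) <= N%:R / 100.
Proof.
move=> hN; apply: le_trans (gs_s (good hN)); apply: logbar_mono.
  by rewrite expnS expn1 leq_pmull //; have := gs_4 (good hN); lia.
by rewrite !mulr_ge0.
Qed.

Lemma good_l N : (Nst <= N)%N -> expR (logbar N `^ (5 * eps)) <= N%:R / 100.
Proof.
move=> hN; apply: le_trans (gs_l (good hN)); apply: logbar_mono.
  by rewrite expnS expn1 leq_pmull //; have := gs_4 (good hN); lia.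
by rewrite !mulr_ge0.
Qed.

Let int_dist (n m : int) (a b : R) : (`|m|)%:~R <= a -> b <= (`|n|)%:~R ->
  b - a <= (`|n - m|)%:~R.
Proof.
move=> h1 h2.
have : (`|n|)%:~R <= (`|n - m|)%:~R + (`|m|)%:~R :> R.
  by rewrite -intrD ler_int; lia.
lra.
Qed.

(* If the new localization interval met the complement of [-3N/5, 3N/5], then psi
   would be of size exp(- gamma N / 100) on all of [-N, N], contradicting norm 1. *)
Lemma step N j psi : (Nst <= N)%N -> (j < N.*2.+1)%N ->
  unit_eigvec v (symm N) (ev N j) psi -> gamma < Lf (ev N j) ->
  centered N j (N%:R / 2) ->
  (forall E', `|E' - ev N j| <= 1 / 4 * expR (- (gamma * N%:R / 10)) -> gamma < Lf E') ->
  exists (j' : nat) (psi' : int -> C),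
  [/\ (j' < (N ^ 2).*2.+1)%N,
      unit_eigvec v (symm (N ^ 2)) (ev (N ^ 2) j') psi',
      `|ev (N ^ 2) j' - ev N j| <= 1 / 4 * expR (- (gamma * N%:R / 10)),
      l2norm (fun n => psi' n - psi n) <= 1 / 4 * expR (- (gamma * N%:R / 10)) &
      centered (N ^ 2) j' (3 / 5 * N%:R)].
Proof.
move=> hN hj hu hL hc hLf.
have gN := good hN.
have N4 := gs_4 gN.
have hN2 : (Nst <= N ^ 2)%N by nia.
have N2N : (N.+1 <= N ^ 2)%N by nia.
have Npos : 0 < N%:R :> R by rewrite ltr0n; lia.
have [supp heq h1] := (unit_eigvecP v N _ _).1 hu.
set x := gamma * N%:R; have x1000 : 1000 <= x := gs_big gN.
(* The ends of [-N, N] are at distance at least N/2 from the localization interval, where the rate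
   gamma/4 gives exp(-x/8); the factor 2 covers both ends. *)
pose dl := 2 * expR (- (x / 8)).
have dl0 : 0 <= dl by rewrite mulr_ge0 ?expR_ge0.
have dl1 : dl <= 1 / 4 * expR (- (x / 10)).
  have := @expR_gap R (- (x / 8)) (- (x / 10)); rewrite /dl.
  have q := expR_ge0 (- (x / 8)); move=> h; have {}h := h ltac:(lra).
  move: q h; move: (expR _) (expR _) => a b; lra.
have bd (n : int) : `|n| = N%:Z -> cabs (psi n) <= expR (- (x / 8)).
  move=> hn.
  have := @decay_away' N j psi n (N%:R / 2) hN hj hL hu.
  rewrite (_ : gamma / 4 * (N%:R / 2) = x / 8); last by rewrite /x; field.
  apply; first by apply: le_lt_trans (good_s hN) _; move: Npos; move: (N%:R : R) => a; lra.
  move=> m hm; have := @int_dist n m (N%:R / 2) N%:R (hc m hm).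
  rewrite hn => /(_ (lexx _)); move: (N%:R : R) (`|n - m|%:~R : R) => a b; lra.
pose rho n := schrodinger v psi n - ((ev N j)%:C)%C * psi n.
have hres : nrm (N ^ 2) rho <= dl.
  rewrite nrm_le // -nrm_sq (truncation_defect supp heq N2N).
  have b1 : cabs (psi N%:Z) <= expR (- (x / 8)) by apply: bd; exact: (absz_ends N).1.
  have b2 : cabs (psi (- N%:Z)) <= expR (- (x / 8)) by apply: bd; exact: (absz_ends N).2.
  have q1 : cabs (psi N%:Z) ^+ 2 <= expR (- (x / 8)) ^+ 2.
    by rewrite ler_sqr ?nnegrE ?cabs_ge0 ?expR_ge0.
  have q2 : cabs (psi (- N%:Z)) ^+ 2 <= expR (- (x / 8)) ^+ 2.
    by rewrite ler_sqr ?nnegrE ?cabs_ge0 ?expR_ge0.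
  rewrite /dl exprMn; move: q1 q2 (sqr_ge0 (expR (- (x / 8)))).
  move: (_ ^+ 2) (cabs _ ^+ 2) (expR _ ^+ 2) => a b d; lra.
have supp2 (n : int) : (N ^ 2)%:Z < `|n| -> psi n = 0.
  by move=> hn; apply: supp; exact: outside_square hn.
have unit2 : nrm (N ^ 2) psi = 1.
  by rewrite -(l2_finsupp supp2).2; case: hu.
have [j' hj'] := approx_eigenvalue v_real supp2 unit2 dl0 hres.
have hE : `|ev (N ^ 2) j' - ev N j| <= 1 / 4 * expR (- (x / 10)) by exact: le_trans dl1.
have hL' := hLf _ hE.
have [l1 [l2 l3] l4 l5] := loc hN2 (ltn_ord j') hL'.
set s := expR (- CV * _) in l5.
have s0 : 0 < s by exact: expR_gt0.
have ratio : 4 * dl / s <= 1 / 4 * expR (- (x / 10)).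
  apply: (separation_ratio (n := `|CV| * expR (logbar (N ^ 2) `^ (5 * eps)))).
  - by rewrite ler_wpM2r // ler_norm.
  - by rewrite ler_wpM2l // ltW.
  - exact: gs_sep gN.
have ratio1 : 4 * dl <= s.
  rewrite -[leRHS]mul1r -ler_pdivrMr //; apply: (le_trans ratio).
  have : expR (- (x / 10)) <= 1 by rewrite expR_le1; lra.
  move: (expR _) => y; lra.
have [psi' hu' hd] := approx_eigenvector v_real supp2 unit2 dl0 hres s0 ratio1 hj' l5.
have hd' := le_trans hd ratio.
exists j', psi'; split=> //.
move=> m0 hm0; rewrite leNgt; apply/negP => hm.
(* The interval is no longer than N/100, so one point beyond 3N/5 places all of it beyond
   59N/100. *)
have far m : zset (I (N ^ 2) (ev (N ^ 2) j')) m -> 59 / 100 * N%:R <= (`|m|)%:~R :> R.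
  move=> hm1; have h3 : (`|m0 - m|)%:~R <= N%:R / 100 :> R.
    apply: le_trans (gs_l gN); apply: le_trans (ltW l3).
    by rewrite [leRHS]pmulrn ler_int; exact: zset_dist hm0 hm1.
  have := @int_dist m0 (m0 - m) (N%:R / 100) (3 / 5 * N%:R).
  rewrite subKr => /(_ h3 (ltW hm)).
  move: (N%:R : R) (`|m|%:~R : R) => a b; lra.
have small (n : int) : cabs (psi n) <= 2 * expR (- (x / 100)).
  have e0 := expR_ge0 (- (x / 100)).
  (* The threshold 55/100 lies between the two localization regions: below it [n] is 4N/100 away
     from the interval of [psi'], above it 5N/100 away from that of [psi]. *)
  have [hn|hn] := leP (`|n|%:~R) (55 / 100 * N%:R : R).
    have b1 : cabs (psi' n) <= expR (- (gamma / 4 * (4 / 100 * N%:R))).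
      apply: (decay_away' hN2 (ltn_ord j') hL' hu').
        by apply: le_lt_trans (gs_s gN) _; move: Npos; move: (N%:R : R) => a; lra.
      move=> m /far hmf; have := @int_dist m n _ _ hn hmf; rewrite distrC.
      move: (N%:R : R) (`|m - n|%:~R : R) => a b; lra.
    rewrite (_ : gamma / 4 * (4 / 100 * N%:R) = x / 100) in b1; last by rewrite /x; field.
    have b2 : cabs (psi' n - psi n) <= 1 / 4 * expR (- (x / 10)).
      apply: le_trans hd'; apply: (l2_entry (phi := fun n => psi' n - psi n)).
      exact: (l2B (unit_eigvec_l2 hu') (unit_eigvec_l2 hu)).1.
    have b3 : expR (- (x / 10)) <= expR (- (x / 100)) by rewrite ler_expR; lra.
    have := cabsD (psi' n) (psi n - psi' n); rewrite addrC subrK cabsB.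
    move: b1 b2 b3 e0; move: (cabs _) (cabs _) (cabs _) (expR _) (expR _) => a b d e f; lra.
  have b1 : cabs (psi n) <= expR (- (gamma / 4 * (5 / 100 * N%:R))).
    apply: (decay_away' hN hj hL hu).
      by apply: le_lt_trans (good_s hN) _; move: Npos; move: (N%:R : R) => a; lra.
    move=> m /hc hmf; have := @int_dist n m _ _ hmf (ltW hn).
    move: (N%:R : R) (`|n - m|%:~R : R) => a b; lra.
  have b3 : expR (- (gamma / 4 * (5 / 100 * N%:R))) <= expR (- (x / 100)).
    rewrite (_ : gamma / 4 * (5 / 100 * N%:R) = x / 80); last by rewrite /x; field.
    by rewrite ler_expR; move: x1000; move: (x) => y; lra.
  move: (le_trans b1 b3) e0; move: (cabs _) (expR _) => a b; lra.
have : nrm N psi ^+ 2 <= (N.*2.+1)%:R * (4 * expR (- (x / 50))).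
  rewrite nrm_sq; apply: (@le_trans _ _ (wsum (fun=> 4 * expR (- (x / 50))) N)).
    apply: ler_wsum => n _.
    have -> : 4 * expR (- (x / 50)) = (2 * expR (- (x / 100))) ^+ 2.
      rewrite exprMn [expR _ ^+ 2]expr2 -expRD; congr (_ * expR _); [ring|lra].
    by rewrite ler_sqr ?nnegrE ?cabs_ge0 ?mulr_ge0 ?expR_ge0.
  by rewrite /wsum sumr_const card_ord [leRHS]mulr_natl.
rewrite h1 expr1n => h; have := le_lt_trans h (gs_mass gN).
by rewrite ltxx.
Qed.

End induction_step.

Section halving.
Context {R : realType}.
Local Notation C := R[i].
Variable e : nat -> R.
Hypothesis e_gt0 : forall k, 0 < e k.
Hypothesis e_le1 : e 0%N <= 1.
Hypothesis e_half : forall k, e k.+1 <= 1 / 2 * e k.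

Lemma halving_harmonic k : e k <= k.+1%:R^-1.
Proof.
rewrite -[leRHS]mul1r ler_pdivlMr ?ltr0n //.
elim: k => [|k IH]; first by rewrite mulr1.
apply: le_trans IH; apply: (@le_trans _ _ (1 / 2 * e k * k.+2%:R)).
  by rewrite ler_wpM2r.
rewrite mulrAC [leRHS]mulrC; apply: ler_wpM2r; first exact: ltW.
have : (k.+2%:R : R) <= 2 * k.+1%:R by rewrite -natrM ler_nat; lia.
lra.
Qed.

Lemma halving_small (eta : R) : 0 < eta -> exists k0, forall k, (k0 <= k)%N -> e k <= eta.
Proof.
move=> h0; exists (Num.truncn eta^-1).+1 => k hk.
apply: le_trans (halving_harmonic k) _; rewrite invf_ple ?posrE ?ltr0n //.
apply/ltW/(lt_le_trans (truncnS_gt _)); rewrite ler_nat; exact: leqW.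
Qed.

(** This replaces passages to the limit: an error term proportional to [e k] may be dropped from any
    inequality that holds for all large [k]. *)
Lemma halving_le0 (x K : R) (k0 : nat) :
  (forall k, (k0 <= k)%N -> x <= K * e k) -> x <= 0.
Proof.
move=> h; rewrite leNgt; apply/negP => x0.
have K1 : 0 < `|K| + 1 by rewrite ltr_wpDl.
have [k1 hk1] : exists k1, forall k, (k1 <= k)%N -> e k <= x / 2 / (`|K| + 1).
  by apply: halving_small; rewrite !divr_gt0.
have := h (maxn k0 k1) (leq_maxl _ _); have := hk1 (maxn k0 k1) (leq_maxr _ _).
rewrite ler_pdivlMr // => h1 h2.
have h3 : K * e (maxn k0 k1) <= e (maxn k0 k1) * (`|K| + 1).
  rewrite mulrC ler_wpM2l ?ltW //; have := ler_norm K; lra.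
lra.
Qed.

(** [D l + 1/2 * e l] does not increase with [l]: a step adds 1/4 of [e l] to [D], and halving frees
    as much of the reserve. *)
Lemma halving_telescope (D : nat -> R) (k m : nat) : D k = 0 ->
  (forall l, (k <= l)%N -> D l.+1 <= D l + 1 / 4 * e l) ->
  D (k + m)%N + 1 / 2 * e (k + m)%N <= 1 / 2 * e k.
Proof.
move=> h0 hs; elim: m => [|m IH]; first by rewrite addn0 h0 add0r.
rewrite addnS; have := hs _ (leq_addr m k); have := e_half (k + m)%N; lra.
Qed.

Lemma halving_cvg (u : nat -> R) :
  (forall k k', (k <= k')%N -> `|u k' - u k| <= 1 / 2 * e k) ->
  exists2 l, u @ \oo --> l & forall k, `|l - u k| <= 1 / 2 * e k.
Proof.
move=> hu; have hc : cvgn u.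
  apply/cauchy_cvgP/cauchy_exP => /= eps eps0.
  have [k0 hk0] := halving_small eps0.
  exists (u k0); exists k0 => // k /= hk; rewrite -ball_normE /ball_ /= distrC.
  apply: le_lt_trans (hu _ _ hk) _.
  have := hk0 k0 (leqnn _); have := e_gt0 k0; lra.
exists (limn u) => // k.
have h1 : (fun m => u m - u k) @ \oo --> limn u - u k by apply: cvgB => //; exact: cvg_cst.
have h2 : (fun m => `|u m - u k|) @ \oo --> `|limn u - u k| by exact: cvg_norm.
have h3 : (fun m => `|u (m + k)%N - u k|) @ \oo --> `|limn u - u k|.
  by move: h2; rewrite -(cvg_shiftn k).
by apply: (cvg_le_const h3) => m; apply: hu; exact: leq_addl.
Qed.

Variables (v : int -> C) (psis : nat -> int -> C).
Hypothesis psis_l2 : forall k, l2 (psis k).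
Hypothesis psis_unit : forall k, l2norm (psis k) = 1.
Hypothesis psis_cauchy : forall k k', (k <= k')%N ->
  l2norm (fun n => psis k' n - psis k n) <= 1 / 2 * e k.

(** The limit is built site by site from real and imaginary parts, whose two errors add up to [e k].
    The norm estimate keeps the factor 1/2: on a fixed window the pointwise error of a later term
    tends to zero, so only the Cauchy bound remains. *)
Lemma halving_l2_cvg : exists psi : int -> C,
  [/\ forall n, (fun k => psis k n) @ \oo --> (psi n : C^o),
      forall k n, cabs (psi n - psis k n) <= e k,
      l2 psi, l2norm psi = 1 &
      forall k, l2norm (fun n => psi n - psis k n) <= 1 / 2 * e k].
Proof.
have hcabs k k' n : (k <= k')%N -> cabs (psis k' n - psis k n) <= 1 / 2 * e k.
  move=> hk; apply: le_trans (psis_cauchy hk).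
  by apply: (l2_entry (phi := fun n => psis k' n - psis k n)); exact: (l2B _ _).1.
have hRe n : exists2 l, (fun k => complex.Re (psis k n)) @ \oo --> l &
    forall k, `|l - complex.Re (psis k n)| <= 1 / 2 * e k.
  apply: halving_cvg => k k' hk; apply: le_trans (hcabs _ _ n hk).
  by rewrite -raddfB; exact: Re_le_cabs.
have hIm n : exists2 l, (fun k => complex.Im (psis k n)) @ \oo --> l &
    forall k, `|l - complex.Im (psis k n)| <= 1 / 2 * e k.
  apply: halving_cvg => k k' hk; apply: le_trans (hcabs _ _ n hk).
  by rewrite -raddfB; exact: Im_le_cabs.
have [fR hfR] := choice (fun n => (exists2P _ _).1 (hRe n)).
have [fI hfI] := choice (fun n => (exists2P _ _).1 (hIm n)).
pose psi n : C := Complex (fR n) (fI n).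
have hpt k n : cabs (psi n - psis k n) <= e k.
  apply: (le_trans (cabs_le_ReIm _)); rewrite !raddfB /=.
  have := (hfR n).2 k; have := (hfI n).2 k; lra.
have hnrm k N : nrm N (fun n => psi n - psis k n) <= 1 / 2 * e k.
  rewrite -subr_le0; apply: (halving_le0 (K := (N.*2.+1)%:R) (k0 := k)) => k' hk.
  rewrite lerBlDl.
  have -> : (fun n => psi n - psis k n) =
      (fun n => (psis k' n - psis k n) + (psi n - psis k' n)).
    by apply/funext => n; ring.
  apply: (le_trans (nrmD _ _ _)); apply: lerD.
    by apply: le_trans (nrm_le_l2norm _ _) (psis_cauchy hk); exact: (l2B _ _).1.
  rewrite nrm_le; last by rewrite mulr_ge0 // ltW.
  apply: (@le_trans _ _ (wsum (fun=> e k' ^+ 2) N)).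
    by apply: ler_wsum => n _; rewrite ler_sqr ?nnegrE ?cabs_ge0 ?(ltW (e_gt0 _)).
  rewrite /wsum sumr_const card_ord -[leLHS]mulr_natl exprMn ler_wpM2r ?sqr_ge0 //.
  by rewrite expr2 ler_peMr ?ler1n // ler0n.
have hdiff k := l2_bound (hnrm k).
have hl : l2 psi.
  have := (l2D (hdiff 0%N).1 (psis_l2 0)).1.
  by congr l2; apply/funext => n; rewrite subrK.
exists psi; split=> //.
- move=> n; apply: cvg_complex; [exact: (hfR n).1|exact: (hfI n).1].
- apply/eqP; rewrite -subr_eq0 -normr_le0; apply: (halving_le0 (K := 1 / 2) (k0 := 0%N)) => k _.
  have [h1 h2] := hdiff k.
  have t1 := (l2D h1 (psis_l2 k)).2; have t2 := (l2B hl h1).2.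
  have e1 : (fun n => psi n - psis k n + psis k n) = psi by apply/funext => n; rewrite subrK.
  have e2 : (fun n => psi n - (psi n - psis k n)) = psis k by apply/funext => n; rewrite subKr.
  rewrite e1 psis_unit in t1; rewrite e2 psis_unit in t2.
  by rewrite ler_norml; apply/andP; split; lra.
- by move=> k; exact: (hdiff k).2.
Qed.

Lemma halving_eigen (psi : int -> C) (Es : nat -> R) (E : R) :
  (forall k n, cabs (psi n - psis k n) <= e k) ->
  (forall k, `|E - Es k| <= 1 / 2 * e k) ->
  (forall n : int, exists k0, forall k, (k0 <= k)%N ->
    schrodinger v (psis k) n = ((Es k)%:C)%C * psis k n) ->
  schrodinger v psi = fun n => (E%:C)%C * psi n.
Proof.
move=> hpsi hE hH; apply/funext => n; have [k0 hk0] := hH n.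
apply/eqP; rewrite -subr_eq0; apply/eqP/cabs_eq0/eqP; rewrite eq_le cabs_ge0 andbT.
apply: (halving_le0 (K := 3 + cabs (v n) + `|E|) (k0 := k0)) => k hk.
have -> : schrodinger v psi n - (E%:C)%C * psi n =
  (- (psi (n + 1) - psis k (n + 1))) + (- (psi (n - 1) - psis k (n - 1)))
  + v n * (psi n - psis k n) + (- ((E%:C)%C * (psi n - psis k n)))
  + (- (((E - Es k)%:C)%C * psis k n)).
  have := hk0 _ hk; rewrite rmorphB /= /schrodinger => h.
  transitivity (- psi (n + 1) - psi (n - 1) + v n * psi n - (E%:C)%C * psi n
    - (- psis k (n + 1) - psis k (n - 1) + v n * psis k n - ((Es k)%:C)%C * psis k n)).
    by rewrite h subrr subr0.
  ring.
have b1 := hpsi k (n + 1); have b2 := hpsi k (n - 1); have b3 := hpsi k n.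
have b4 : cabs (psis k n) <= 1 by rewrite -(psis_unit k); exact: l2_entry.
have b5 := hE k; have e0 := e_gt0 k.
have c3 : cabs (v n * (psi n - psis k n)) <= cabs (v n) * e k.
  by rewrite cabsM ler_wpM2l ?cabs_ge0.
have c4 : cabs ((E%:C)%C * (psi n - psis k n)) <= `|E| * e k.
  by rewrite cabsM cabs_real ler_wpM2l.
have c5 : cabs (((E - Es k)%:C)%C * psis k n) <= 1 / 2 * e k.
  rewrite cabsM cabs_real -[leRHS]mulr1; apply: ler_pM => //; exact: cabs_ge0.
apply: (@le_trans _ _ (e k + e k + cabs (v n) * e k + `|E| * e k + 1 / 2 * e k)).
  do 4![apply: (le_trans (cabsD _ _)); apply: lerD; last by rewrite ?cabsN].
  by rewrite cabsN.
move: e0; move: (cabs (v n)) (`|E|) (e k) => x y z; lra.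
Qed.

End halving.

Lemma scaleS (N k : nat) : scale N k.+1 = (scale N k ^ 2)%N.
Proof. by rewrite /scale expnSr expnM. Qed.

Lemma scale_mono (N k l : nat) : (0 < N)%N -> (k <= l)%N -> (scale N k <= scale N l)%N.
Proof. by move=> N0 kl; rewrite leq_pexp2l // leq_pexp2l. Qed.

Lemma scale_ge (N k : nat) : (0 < N)%N -> (N <= scale N k)%N.
Proof. by move=> N0; exact: (@scale_mono N 0 k). Qed.

Section decay_arithmetic.
Context {R : realType}.
Implicit Types g n M N K D a b : R.

(** The region [|n| <= 5N/4], where the first eigenvector [a] still decides. There [D <= 7N/4], so
    the approximation error exp(-gN/10) is below the claim, 7/80 being less than 1/10. *)
Lemma decay_near g N D a b : 0 < g -> 1000 <= g * N -> N / 4 <= D -> D <= 7 / 4 * N ->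
  a <= expR (- (g / 4 * D)) -> b <= 1 / 2 * expR (- (g * N / 10)) ->
  a + b <= 1 / 2 * expR (- (g / 20 * D)).
Proof.
move=> g0 h1 h2 h3 ha hb.
have h4 : g * N <= 4 * (g * D) by rewrite mulrCA ler_pM2l // -ler_pdivrMl // mulrC.
have h5 : 4 * (g * D) <= 7 * (g * N).
  by rewrite !(mulrCA _ g) ler_pM2l // -ler_pdivlMl // mulrA [4^-1 * 7]mulrC.
have e1 : 32 * expR (- (g / 4 * D)) <= expR (- (g / 20 * D)).
  apply: expR_gap; rewrite !(mulrAC g _ D); move: h1 h4; move: (g * D) (g * N) => x y; lra.
have e2 : 32 * expR (- (g * N / 10)) <= expR (- (g / 20 * D)).
  apply: expR_gap; rewrite !(mulrAC g _ D); move: h1 h5; move: (g * D) (g * N) => x y; lra.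
have := expR_gt0 (- (g / 20 * D)).
move: ha hb e1 e2; move: (expR _) (expR _) (expR _) => x y z; lra.
Qed.

(** [M] and [K] are consecutive scales. From [n >= 5M/4] the decay exponent is at least 0.13 g n,
    from [n <= 5K/4] the error exponent is at least 0.08 g n, and the claim asks for at most 0.07 g
    n. *)
Lemma decay_far g n M N K D a b : 0 < g -> 1000 <= g * N -> N <= M -> 4 * M <= K ->
  5 / 4 * M <= n -> n <= 5 / 4 * K -> D <= n + N / 2 ->
  a <= expR (- (g / 4 * (n - 3 / 5 * M))) -> b <= 1 / 2 * expR (- (g * K / 10)) ->
  a + b <= 1 / 2 * expR (- (g / 20 * D)).
Proof.
move=> g0 h1 h2 h3 h4 h5 h6 ha hb.
have k2 : g * N <= g * M by rewrite ler_pM2l.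
have k3 : g * (4 * M) <= g * K by rewrite ler_pM2l.
have k4 : g * (5 / 4 * M) <= g * n by rewrite ler_pM2l.
have k5 : g * n <= g * (5 / 4 * K) by rewrite ler_pM2l.
have k6 : g * D <= g * (n + N / 2) by rewrite ler_pM2l.
rewrite mulrCA in k3; rewrite mulrCA in k4; rewrite mulrCA in k5.
rewrite mulrDr mulrA in k6.
have e1 : 32 * expR (- (g / 4 * (n - 3 / 5 * M))) <= expR (- (g / 20 * D)).
  have -> : g / 4 * (n - 3 / 5 * M) = g * n / 4 - 3 / 20 * (g * M) by field.
  have -> : g / 20 * D = g * D / 20 by field.
  apply: expR_gap.
  by move: h1 k2 k3 k4 k5 k6; move: (g * D) (g * N) (g * M) (g * n) (g * K) => x y z w t; lra.
have e2 : 32 * expR (- (g * K / 10)) <= expR (- (g / 20 * D)).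
  have -> : g / 20 * D = g * D / 20 by field.
  apply: expR_gap.
  by move: h1 k2 k3 k4 k5 k6; move: (g * D) (g * N) (g * M) (g * n) (g * K) => x y z w t; lra.
have := expR_gt0 (- (g / 20 * D)).
move: ha hb e1 e2; move: (expR _) (expR _) (expR _) => x y z; lra.
Qed.

End decay_arithmetic.

Section tower_construction.
Context {R : realType}.
Local Notation C := R[i].
Variables (v : int -> C) (r : int -> R).
Hypothesis v_real : forall n, v n = ((r n)%:C)%C.
Variables (gamma eps sigma CV delta : R).
Hypothesis gamma_gt0 : 0 < gamma.
Hypothesis eps_ge0 : 0 <= eps.
Hypothesis sigma_ge0 : 0 <= sigma.
Variables (Lf : R -> R) (I : nat -> R -> zitv) (Nst : nat).
Local Notation ev N j := (eigval v (symm N) j).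
Local Notation localized := (localized v gamma eps sigma CV Lf I).
Local Notation centered := (centered v I).
Hypothesis loc : forall N, (Nst <= N)%N -> localized N.
Hypothesis good : forall N, (Nst <= N)%N -> good_scale gamma eps sigma CV delta N.

Variables (N j0 : nat) (psi0 : int -> C).
Hypothesis hN : (Nst <= N)%N.
Hypothesis hj0 : (j0 < N.*2.+1)%N.
Hypothesis hu0 : unit_eigvec v (symm N) (ev N j0) psi0.
Hypothesis hcen : centered N j0 (N%:R / 2).
Hypothesis hLf : forall E', `|E' - ev N j0| <= expR (- (gamma * N%:R / 10)) -> gamma < Lf E'.
Local Notation I0 := (zset (I N (ev N j0))).
Local Notation S k := (scale N k).
Definition rate k : R := expR (- (gamma * (S k)%:R / 10)).

Let N4 : (4 <= N)%N := gs_4 (good hN).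
Let N0 : (0 < N)%N. Proof. exact: leq_trans N4. Qed.
Let hS k : (Nst <= S k)%N. Proof. exact: leq_trans hN (scale_ge k N0). Qed.
Let S4 k : (4 <= S k)%N. Proof. exact: leq_trans N4 (scale_ge k N0). Qed.

Lemma scale4 k : 4 * (S k)%:R <= (S k.+1)%:R :> R.
Proof. by rewrite -natrM ler_nat scaleS expnS expn1 leq_mul2r S4 orbT. Qed.

Lemma rate_gt0 k : 0 < rate k. Proof. exact: expR_gt0. Qed.

Lemma rate_le1 : rate 0 <= 1.
Proof. by rewrite expR_le1 oppr_le0 divr_ge0 ?mulr_ge0 ?(ltW gamma_gt0). Qed.

Lemma rate_half k : rate k.+1 <= 1 / 2 * rate k.
Proof.
have h : 32 * rate k.+1 <= rate k.
  apply: expR_gap; have h1 := gs_big (good (hS k)).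
  have : gamma * (4 * (S k)%:R) <= gamma * (S k.+1)%:R by rewrite ler_pM2l ?scale4.
  rewrite mulrCA; move: h1; move: (gamma * _) (gamma * _) => x y; lra.
by have := rate_gt0 k.+1; move: h; move: (rate _) (rate _) => x y; lra.
Qed.

(** The reserve [1 / 2 * rate k] in the last clause pays for all later drifts, so no energy of the
    tower leaves the neighbourhood on which [hLf] holds. *)
Definition tower_state k (st : nat * (int -> C)) : Prop :=
  [/\ (st.1 < (S k).*2.+1)%N, unit_eigvec v (symm (S k)) (ev (S k) st.1) st.2,
      centered (S k) st.1 ((S k)%:R / 2) &
      `|ev (S k) st.1 - ev N j0| + 1 / 2 * rate k <= 1 / 2 * rate 0].

Definition tower_link k (st st' : nat * (int -> C)) : Prop :=
  [/\ `|ev (S k.+1) st'.1 - ev (S k) st.1| <= 1 / 4 * rate k,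
      l2norm (fun n => st'.2 n - st.2 n) <= 1 / 4 * rate k &
      centered (S k.+1) st'.1 (3 / 5 * (S k)%:R)].

Lemma tower_state_lyap k st : tower_state k st -> gamma < Lf (ev (S k) st.1).
Proof.
move=> [_ _ _ h]; apply: hLf; apply: le_trans (_ : _ <= rate 0) => //.
by have := rate_gt0 k; have := rate_gt0 0; lra.
Qed.

Lemma tower_next k st : tower_state k st ->
  exists st', tower_state k.+1 st' /\ tower_link k st st'.
Proof.
move=> hst; have hL := tower_state_lyap hst.
case: hst => h1 h2 h3 h4.
have [|j' [psi' [a1 a2 a3 a4 a5]]] :=
  step v_real gamma_gt0 eps_ge0 sigma_ge0 loc good (hS k) h1 h2 hL h3.
  move=> E' hE'; apply: hLf; apply: le_trans (_ : _ <= rate 0) => //.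
  have := ler_distD (ev (S k) st.1) E' (ev N j0).
  have := rate_gt0 k; have := rate_gt0 0; have : `|E' - ev (S k) st.1| <= 1 / 4 * rate k by [].
  lra.
exists (j', psi'); rewrite -scaleS in a1 a2 a3 a5; split; split=> //=.
  move=> m hm; apply: le_trans (a5 m hm) _.
  have := scale4 k; have : 0 <= (S k)%:R :> R by [].
  move: ((S k)%:R : R) ((S k.+1)%:R : R) => x y; lra.
have := ler_distD (ev (S k) st.1) (ev (S k.+1) j') (ev N j0).
have := rate_half k; have : `|ev (S k.+1) j' - ev (S k) st.1| <= 1 / 4 * rate k by [].
lra.
Qed.

Lemma tower_chain : exists st : nat -> nat * (int -> C),
  [/\ st 0%N = (j0, psi0), forall k, tower_state k (st k) &
      forall k, tower_link k (st k) (st k.+1)].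
Proof.
(* Choice needs a total relation: outside [tower_state] any value will do. *)
have hall (p : nat * (nat * (int -> C))) : exists q, tower_state p.1 p.2 ->
    tower_state p.1.+1 q /\ tower_link p.1 p.2 q.
  have [/tower_next [q hq]|hp] := pselect (tower_state p.1 p.2); first by exists q.
  by exists (0%N, psi0).
have [next hnext] := choice hall.
pose st := fix st k := if k is k'.+1 then next (k', st k') else (j0, psi0).
have hst k : tower_state k (st k).
  elim: k => [|k IH]; last exact: (hnext (k, st k) IH).1.
  by split=> //=; rewrite subrr normr0 add0r.
exists st; split=> // k; exact: (hnext (k, st k) (hst k)).2.
Qed.

(** Non-strict bounds with a factor 1/2 pass to the limit; [half_expR_lt] recovers the strict ones.
    [td_decay] includes [k = 0] and sites outside the box, so it passes to the limit at every
    site. *)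
Record tower_data (js : nat -> nat) (psis : nat -> int -> C) (E : R) (psi : int -> C) :
  Prop := TowerData {
  td_js : forall k, (js k < (S k).*2.+1)%N ;
  td_psi : forall k, unit_eigvec v (symm (S k)) (ev (S k) (js k)) (psis k) ;
  td_val : forall k k', (k <= k')%N ->
    `|ev (S k') (js k') - ev (S k) (js k)| <= 1 / 2 * rate k ;
  td_vec : forall k k', (k <= k')%N ->
    l2norm (fun n => psis k' n - psis k n) <= 1 / 2 * rate k ;
  td_decay : forall k (n : int), 3 * N%:R / 4 <= (`|n|)%:~R :> R ->
    cabs (psis k n) <= 1 / 2 * expR (- (gamma / 20 * fine (zdist n I0))) ;
  td_cvgE : (fun k => ev (S k) (js k)) @ \oo --> E ;
  td_cvg : forall n, (fun k => psis k n) @ \oo --> (psi n : C^o) ;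
  td_l2 : l2 psi ;
  td_unit : l2norm psi = 1 ;
  td_limdecay : forall n : int, 3 * N%:R / 4 <= (`|n|)%:~R :> R ->
    cabs (psi n) <= 1 / 2 * expR (- (gamma / 20 * fine (zdist n I0))) ;
  td_eigen : schrodinger v psi = (fun n => (E%:C)%C * psi n) ;
  td_E0 : `|E - ev N j0| <= 1 / 2 * rate 0 ;
  td_psi0 : l2norm (fun n => psi n - psi0 n) <= 1 / 2 * rate 0
}.

Let absz_distD (n m : int) : (`|n - m|)%:~R <= (`|n|)%:~R + (`|m|)%:~R :> R.
Proof. by rewrite -intrD ler_int; exact: ler_normB. Qed.

Let absz_distB (n m : int) : (`|n|)%:~R - (`|m|)%:~R <= (`|n - m|)%:~R :> R.
Proof. by rewrite lerBlDr -intrD ler_int; have := ler_normD (n - m) m; rewrite subrK. Qed.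

Let hL0 : gamma < Lf (ev N j0).
Proof. by apply: hLf; rewrite subrr normr0 expR_ge0. Qed.

(* |n| is compared with the first scale N_l such that |n| <= 5/4 N_l: the
   localization interval at that scale lies in [-3/5 N_(l-1), 3/5 N_(l-1)]. *)
Lemma tower_decay (js : nat -> nat) (psis : nat -> int -> C) :
  psis 0%N = psi0 ->
  (forall k, tower_state k (js k, psis k)) ->
  (forall k, centered (S k.+1) (js k.+1) (3 / 5 * (S k)%:R)) ->
  (forall k k', (k <= k')%N -> forall n, cabs (psis k' n - psis k n) <= 1 / 2 * rate k) ->
  forall k (n : int), 3 * N%:R / 4 <= (`|n|)%:~R :> R ->
  cabs (psis k n) <= 1 / 2 * expR (- (gamma / 20 * fine (zdist n I0))).
Proof.
move=> e0 hst hc hd k n hn.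
have [m0 hm0] := interval_nonempty gamma_gt0 eps_ge0 sigma_ge0 loc hN hj0 hL0.
set D := fine _.
have Npos : 0 < N%:R :> R by rewrite ltr0n.
have D1 : D <= (`|n|)%:~R + N%:R / 2.
  apply: (le_trans (zdist_le n hm0)); apply: (le_trans (absz_distD n m0)).
  by rewrite lerD2l; exact: hcen.
have far0 m : I0 m -> N%:R / 4 <= (`|n - m|)%:~R :> R.
  move=> /hcen hm; have := absz_distB n m; move: hn hm.
  move: (N%:R : R) ((`|n|)%:~R : R) ((`|m|)%:~R : R) ((`|n - m|)%:~R : R) => x y z w; lra.
have D0 : N%:R / 4 <= D by apply: zdist_ge => //; exists m0.
have big := gs_big (good hN).
have split2 l : cabs (psis k n) <= cabs (psis l n) + cabs (psis k n - psis l n).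
  by have := cabsD (psis l n) (psis k n - psis l n); rewrite addrC subrK.
have [near|far] := leP ((`|n|)%:~R : R) (5 / 4 * N%:R).
  apply: (le_trans (split2 0%N)); apply: (decay_near (N := N%:R) (D := D)) => //.
  - move: D1 near; move: (N%:R : R) ((`|n|)%:~R : R) (D) => x y z; lra.
  - rewrite e0; apply: (decay_away gamma_gt0 eps_ge0 sigma_ge0 loc hN hj0 hL0 hu0 _ far0).
    apply: le_lt_trans (good_s gamma_gt0 eps_ge0 sigma_ge0 good hN) _.
    by move: Npos; move: (N%:R : R) => x; lra.
  - by rewrite (_ : gamma * N%:R / 10 = gamma * (S 0)%:R / 10) //; exact: hd.
pose P (l : nat) : bool := (`|n|)%:~R <= 5 / 4 * (S l)%:R :> R.
have exP : exists l, P l.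
  exists `|n|%N; rewrite /P.
  have h : (`|n|)%:~R <= (S `|n|)%:R :> R.
    rewrite [leRHS]pmulrn ler_int /scale.
    have h1 : (`|n| <= 2 ^ `|n|)%N by exact/ltnW/ltn_expl.
    have h2 : (2 ^ `|n| <= N ^ (2 ^ `|n|))%N by exact/ltnW/ltn_expl/(leq_trans _ N4).
    by rewrite -abszE lez_nat; exact: leq_trans h1 h2.
  by move: h; move: (_%:~R : R) (_%:R : R) (ler0n R (S `|n|)) => x y z; lra.
case: (ex_minnP exP) => l hl lmin.
case: l hl lmin => [|l] hl lmin.
  by have := le_lt_trans hl far; rewrite ltxx.
have far' : 5 / 4 * (S l)%:R < (`|n|)%:~R :> R.
  by rewrite ltNge; apply/negP => h; have := lmin l h; rewrite ltnn.
have Sl : 0 < (S l)%:R :> R by rewrite ltr0n; exact: leq_trans (S4 l).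
(* Boxes up to scale [l] do not reach [n], where their eigenvectors vanish; later eigenvectors are
   compared with the one at scale [l + 1]. *)
have [kl|lk] := ltnP k l.+1.
  have hk : (S k <= S l)%N by exact: scale_mono.
  case: (hst k) => _ /= hu _ _.
  rewrite (let: And3 h _ _ := (unit_eigvecP v (S k) _ _).1 hu in h n) ?cabs0.
    by rewrite mulr_ge0 ?expR_ge0.
  have : (S l)%:R < (`|n|)%:~R :> R by move: far' Sl; lra.
  by rewrite -(ler_nat R) in hk; move=> /(le_lt_trans hk); rewrite [ltLHS]pmulrn ltr_int.
have far1 m : zset (I (S l.+1) (ev (S l.+1) (js l.+1))) m ->
    (`|n|)%:~R - 3 / 5 * (S l)%:R <= (`|n - m|)%:~R :> R.
  move=> /hc hm; have := absz_distB n m; move: hm.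
  move: (3 / 5 * _ : R) ((`|n|)%:~R : R) ((`|m|)%:~R : R) ((`|n - m|)%:~R : R) => x y z w; lra.
apply: (le_trans (split2 l.+1)).
apply: (decay_far (N := N%:R) (n := (`|n|)%:~R) (M := (S l)%:R) (K := (S l.+1)%:R)) => //.
- by rewrite ler_nat; exact: scale_ge.
- exact: scale4.
- exact: ltW.
- case: (hst l.+1) => /= a1 a2 _ _.
  apply: (decay_away' gamma_gt0 eps_ge0 sigma_ge0 loc (hS _) a1 (tower_state_lyap (hst _)) a2 _ far1).
  rewrite scaleS; apply: le_lt_trans (gs_s (good (hS l))) _.
  by move: far' Sl; move: ((S l)%:R : R) ((`|n|)%:~R : R) => x y; lra.
- exact: hd.
Qed.

Lemma tower_exists (Bv : R) : (forall n, `|r n| <= Bv) ->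
  exists js psis E psi, [/\ js 0%N = j0, psis 0%N = psi0 & tower_data js psis E psi].
Proof.
move=> hB; have [st [h0 hst hl]] := tower_chain.
pose js k := (st k).1; pose psis k := (st k).2.
have hst' k : tower_state k (js k, psis k) by have := hst k; rewrite /js /psis; case: (st k).
have hu k : unit_eigvec v (symm (S k)) (ev (S k) (js k)) (psis k) by case: (hst k).
have hl2 k : l2 (psis k) by exact: unit_eigvec_l2 (hu k).
have hval k k' : (k <= k')%N -> `|ev (S k') (js k') - ev (S k) (js k)| <= 1 / 2 * rate k.
  move=> kk'; have := @halving_telescope R rate rate_half
    (fun l => `|ev (S l) (js l) - ev (S k) (js k)|) k (k' - k) _ _.
  rewrite subnKC // subrr normr0 => /(_ erefl) h.
  have := rate_gt0 k'; suff : `|ev (S k') (js k') - ev (S k) (js k)| + 1 / 2 * rate k'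
    <= 1 / 2 * rate k by lra.
  apply: h => l _; have [a _ _] := hl l.
  have := ler_distD (ev (S l) (js l)) (ev (S l.+1) (js l.+1)) (ev (S k) (js k)).
  move: a; rewrite -/(js _) -/(js _); lra.
have hvec k k' : (k <= k')%N -> l2norm (fun n => psis k' n - psis k n) <= 1 / 2 * rate k.
  move=> kk'; have := @halving_telescope R rate rate_half
    (fun l => l2norm (fun n => psis l n - psis k n)) k (k' - k) _ _.
  rewrite subnKC // (_ : (fun n => psis k n - psis k n) = fun=> 0); last first.
    by apply/funext => n; rewrite subrr.
  rewrite l20.2 => /(_ erefl) h.
  have := rate_gt0 k'; suff : l2norm (fun n => psis k' n - psis k n) + 1 / 2 * rate k'
    <= 1 / 2 * rate k by lra.
  apply: h => l _; have [_ a _] := hl l.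
  have := @l2norm_triangle _ (psis l.+1) (psis l) (psis k) (l2B (hl2 _) (hl2 _)).1
    (l2B (hl2 _) (hl2 _)).1.
  move: a; rewrite -/(psis _) -/(psis _); lra.
have hent k k' : (k <= k')%N -> forall n, cabs (psis k' n - psis k n) <= 1 / 2 * rate k.
  move=> kk' n; apply: le_trans (hvec _ _ kk').
  by apply: (l2_entry (phi := fun n => psis k' n - psis k n)); exact: (l2B _ _).1.
have e0 : psis 0%N = psi0 by rewrite /psis h0.
have hdec := tower_decay e0 hst' (fun k => let: And3 _ _ c := hl k in c) hent.
have [E cE bE] := halving_cvg rate_gt0 rate_le1 rate_half hval.
have hunit k : l2norm (psis k) = 1 by case: (hu k).
have [psi [c1 c2 c3 c4 c5]] := halving_l2_cvg rate_gt0 rate_le1 rate_half hl2 hunit hvec.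
exists js, psis, E, psi; split; rewrite /js ?h0 //.
split=> //.
- by move=> k; case: (hst k).
- move=> n hn; rewrite -subr_le0.
  apply: (halving_le0 rate_gt0 rate_le1 rate_half (K := 1) (k0 := 0%N)) => k _.
  have := hdec k n hn; have := c2 k n; have := cabsD (psi n - psis k n) (psis k n).
  rewrite subrK mul1r; lra.
- apply: (halving_eigen rate_gt0 rate_le1 rate_half hl2 hunit c2 bE) => n.
  exists `|n|%N => k hk; have [_ h _] := (unit_eigvecP v (S k) _ _).1 (hu k).
  apply: h; rewrite -abszE lez_nat; apply: (leq_trans hk); rewrite /scale.
  have h1 : (k <= 2 ^ k)%N by exact/ltnW/ltn_expl.
  by apply: (leq_trans h1); exact/ltnW/ltn_expl/(leq_trans _ N4).
- by have := bE 0%N; rewrite /js h0.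
- by have := c5 0%N; rewrite e0.
Qed.

End tower_construction.

(** * Spectral projections *)

Lemma integral_concentrated (R : realType) (d : measure_display) (T : measurableType d)
    (mu : {measure set T -> \bar R}) (J : set T) (f : T -> R) (lo hi m : R) :
  measurable J -> mu (~` J) = 0%E -> mu J = m%:E ->
  mu.-integrable setT (fun t => (f t)%:E) ->
  (forall t, J t -> lo <= f t <= hi) ->
  lo * m <= fine (\int[mu]_(t in setT) (f t)%:E)%E <= hi * m.
Proof.
move=> mJ m0 mJm hf hb.
have -> : (\int[mu]_(t in setT) (f t)%:E = \int[mu]_(t in J) (f t)%:E)%E.
  rewrite (negligible_integral (measurableC mJ) measurableT hf m0).
  by rewrite setTD setCK.
have iJ : mu.-integrable J (fun t => (f t)%:E).
  exact: (integrableS measurableT mJ (@subsetT _ J) hf).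
have icst (a : R) : mu.-integrable J (fun=> a%:E).
  apply/integrableP; split; first exact: measurable_cst.
  by rewrite integral_cst // mJm -EFinM ltry.
have b2 : (lo%:E * m%:E <= \int[mu]_(t in J) (f t)%:E)%E.
  rewrite -mJm -integral_cst //; apply: le_integral => //; first exact: icst.
  move=> t.
  by rewrite inE lee_fin => /hb /andP[].
have b3 : (\int[mu]_(t in J) (f t)%:E <= hi%:E * m%:E)%E.
  rewrite -mJm -integral_cst //; apply: le_integral => //; first exact: icst.
  move=> t.
  by rewrite inE lee_fin => /hb /andP[].
have fI := integrable_fin_num mJ iJ.
rewrite -(fineK fI) -EFinM lee_fin in b2; rewrite -(fineK fI) -EFinM lee_fin in b3.
by rewrite b2 b3.
Qed.

Section spectral_calculus.
Context {R : realType}.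
Local Notation C := R[i].
Variables (v : int -> C) (r : int -> R) (Bv : R).
Hypothesis v_real : forall n, v n = ((r n)%:C)%C.
Hypothesis v_bound : forall n, `|r n| <= Bv.
Local Notation H := (schrodinger v).
Variable P : set R -> (int -> C) -> int -> C.
Hypothesis hP : spectral_resolution H P.
Implicit Types (A B J : set R) (phi psi u w : int -> C).

Lemma proj_l2 A phi : measurable A -> l2 phi -> l2 (P A phi).
Proof. by move=> mA; have [h _ _ _] := hP.1 A mA; exact: h. Qed.

Lemma proj_comb A c phi psi : measurable A -> l2 phi -> l2 psi ->
  P A (fun n => c * phi n + psi n) = fun n => c * P A phi n + P A psi n.
Proof. by move=> mA; have [_ h _ _] := hP.1 A mA; exact: h. Qed.

Lemma proj_idem A phi : measurable A -> l2 phi -> P A (P A phi) = P A phi.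
Proof. by move=> mA; have [_ _ h _] := hP.1 A mA; exact: h. Qed.

Lemma proj_rip A phi psi : measurable A -> l2 phi -> l2 psi ->
  rip phi (P A psi) = rip (P A phi) psi.
Proof. by move=> mA h1 h2; have [_ _ _ h] := hP.1 A mA; rewrite /rip h. Qed.

Lemma proj_add A phi psi : measurable A -> l2 phi -> l2 psi ->
  P A (fun n => phi n + psi n) = fun n => P A phi n + P A psi n.
Proof.
move=> mA h1 h2; have := proj_comb 1 mA h1 h2.
rewrite (_ : (fun n => 1 * phi n + psi n) = fun n => phi n + psi n); last first.
  by apply/funext => n; rewrite mul1r.
by move=> ->; apply/funext => n; rewrite mul1r.
Qed.

Lemma proj0 A : measurable A -> P A (fun=> 0) = fun=> 0.
Proof.
move=> mA; have h := @l20 R; have := proj_add mA h.1 h.1.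
rewrite (_ : (fun n : int => (0 : C) + 0) = fun=> 0); last by apply/funext => n; rewrite addr0.
move=> e; apply/funext => n; have := congr1 (fun f => f n) e => /= /eqP.
by rewrite -subr_eq subrr eq_sym => /eqP.
Qed.

Lemma projZ A c phi : measurable A -> l2 phi ->
  P A (fun n => c * phi n) = fun n => c * P A phi n.
Proof.
move=> mA h1; have := proj_comb c mA h1 (@l20 R).1; rewrite proj0 //.
rewrite (_ : (fun n => c * phi n + 0) = fun n => c * phi n); last first.
  by apply/funext => n; rewrite addr0.
by move=> ->; apply/funext => n; rewrite addr0.
Qed.

Lemma proj_sub A phi psi : measurable A -> l2 phi -> l2 psi ->
  P A (fun n => phi n - psi n) = fun n => P A phi n - P A psi n.
Proof.
move=> mA h1 h2; have := proj_comb (-1) mA h2 h1.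
rewrite (_ : (fun n => -1 * psi n + phi n) = fun n => phi n - psi n); last first.
  by apply/funext => n; rewrite mulN1r addrC.
by move=> ->; apply/funext => n; rewrite mulN1r addrC.
Qed.

Lemma proj_sum A (I : Type) (s : seq I) (c : I -> C) (F : I -> int -> C) :
  measurable A -> (forall i, l2 (F i)) ->
  P A (fun n => \sum_(i <- s) c i * F i n) = fun n => \sum_(i <- s) c i * P A (F i) n.
Proof.
move=> mA hF; elim: s => [|i s IH].
  rewrite (_ : (fun n => _) = fun=> 0); last by apply/funext => n; rewrite big_nil.
  by rewrite proj0 //; apply/funext => n; rewrite big_nil.
rewrite (_ : (fun n => _) = fun n => c i * F i n + \sum_(i <- s) c i * F i n); last first.
  by apply/funext => n; rewrite big_cons.
rewrite proj_comb //; first by rewrite IH; apply/funext => n; rewrite big_cons.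
exact: (l2_sum s (fun i => (l2Z (c i) (hF i)).1)).1.
Qed.

Lemma spectral_measure phi : l2 phi ->
  exists mu : {measure set (measurableTypeR R) -> \bar R},
  [/\ forall A, measurable A -> mu A = (l2norm (P A phi) ^+ 2)%:E,
      mu.-integrable setT (fun t => t%:E) &
      rip phi (H phi) = fine (\int[mu]_(t in setT) t%:E)].
Proof.
move=> h; have [mu [h1 h2 h3]] := hP.2.2 phi h; exists mu; split=> //.
- by move=> A mA; rewrite h1 // l2norm_sqE //; exact: proj_l2.
- by rewrite /rip h3.
Qed.

Lemma proj_norm_sq A phi : measurable A -> l2 phi -> rip phi (P A phi) = l2norm (P A phi) ^+ 2.
Proof.
move=> mA h; rewrite -rip_self; last exact: proj_l2.
by rewrite -[in LHS](proj_idem mA h) proj_rip //; exact: proj_l2.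
Qed.

Lemma proj_pythagoras A phi : measurable A -> l2 phi ->
  l2norm (fun n => phi n - P A phi n) ^+ 2 = l2norm phi ^+ 2 - l2norm (P A phi) ^+ 2.
Proof.
move=> mA h; rewrite l2norm_sqB //; last exact: proj_l2.
by rewrite proj_norm_sq //; ring.
Qed.

Lemma proj_contract A phi : measurable A -> l2 phi -> l2norm (P A phi) <= l2norm phi.
Proof.
move=> mA h; rewrite -ler_sqr ?nnegrE ?l2norm_ge0 // -subr_ge0 -proj_pythagoras //.
exact: sqr_ge0.
Qed.

Lemma proj_fix A phi : measurable A -> l2 phi -> l2norm phi ^+ 2 <= l2norm (P A phi) ^+ 2 ->
  P A phi = phi.
Proof.
move=> mA h hn; have hl := (l2B h (proj_l2 mA h)).1.
have := proj_pythagoras mA h => e.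
have : l2norm (fun n => phi n - P A phi n) = 0.
  apply/eqP; rewrite -sqrf_eq0 eq_le sqr_ge0 andbT e subr_le0 //.
move=> /(l2norm_eq0 hl) /(congr1 (fun f => f _)) e'; apply/funext => n.
by have /eqP := e' n; rewrite subr_eq0 => /eqP.
Qed.

Lemma proj_addU A B phi : measurable A -> measurable B -> A `&` B = set0 -> l2 phi ->
  l2norm (P (A `|` B) phi) ^+ 2 = l2norm (P A phi) ^+ 2 + l2norm (P B phi) ^+ 2.
Proof.
move=> mA mB AB h; have [mu [h1 _ _]] := spectral_measure h.
have e : mu (A `|` B) = (mu A + mu B)%E by exact: measureU.
by move: e; rewrite !h1 //; [rewrite -EFinD; case|exact: measurableU].
Qed.

Lemma proj_normT phi : l2 phi -> P setT phi = phi.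
Proof. exact: hP.2.1. Qed.

Lemma proj_mono A B phi : measurable A -> measurable B -> A `<=` B -> l2 phi ->
  l2norm (P A phi) ^+ 2 <= l2norm (P B phi) ^+ 2.
Proof.
move=> mA mB AB h; have mBA := measurableD mB mA.
rewrite -[in leRHS](setDUK AB) proj_addU ?setDIK // lerDl.
exact: sqr_ge0.
Qed.

Lemma proj_normC A phi : measurable A -> l2 phi ->
  l2norm (P (~` A) phi) ^+ 2 = l2norm phi ^+ 2 - l2norm (P A phi) ^+ 2.
Proof.
move=> mA h; have := proj_addU mA (measurableC mA) (setICr A) h.
by rewrite setUv proj_normT // => ->; rewrite addrAC subrr add0r.
Qed.

Lemma proj_null A phi : measurable A -> l2 phi -> P A phi = phi -> P (~` A) phi = fun=> 0.
Proof.
move=> mA h e; apply: l2norm_eq0; first by apply: proj_l2 => //; exact: measurableC.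
by apply/eqP; rewrite -sqrf_eq0 proj_normC // e subrr.
Qed.

Lemma projC A phi : measurable A -> l2 phi -> P (~` A) phi = fun n => phi n - P A phi n.
Proof.
move=> mA h; have mA' := measurableC mA; have hA := proj_l2 mA h; have hA' := proj_l2 mA' h.
have e1 := proj_null mA hA (proj_idem mA h).
have e2 := proj_null mA' hA' (proj_idem mA' h); rewrite setCK in e2.
have hz1 := (l2B h hA).1; have hz := (l2B hz1 hA').1.
have z1 : P A (fun n => phi n - P A phi n - P (~` A) phi n) = fun=> 0.
  rewrite proj_sub // proj_sub // proj_idem // e2.
  by apply/funext => n; rewrite subrr subr0.
have z2 : P (~` A) (fun n => phi n - P A phi n - P (~` A) phi n) = fun=> 0.
  rewrite proj_sub // proj_sub // proj_idem // e1.
  by apply/funext => n; rewrite subr0 subrr.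
have := proj_normC mA hz; rewrite z1 z2 l20.2 expr0n /= subr0 => /esym/eqP.
rewrite sqrf_eq0 => /eqP /(l2norm_eq0 hz) /(congr1 (fun f => f _)) e; apply/funext => n.
by have /eqP := e n; rewrite subr_eq0 => /eqP ->.
Qed.

Lemma proj_nested A B u : measurable A -> measurable B -> A `<=` B -> l2 u ->
  P A u = u -> P B u = u.
Proof.
move=> mA mB AB h e; apply: proj_fix => //; rewrite -{1}e; exact: proj_mono.
Qed.

(** That projections of different sets commute is not part of [spectral_resolution]; it follows from
    additivity. The remainder [u2] of [u] off [A] intersected with [J] has no mass on that
    intersection and none outside [J], hence none on [A]. *)
Lemma proj_ran_stable A J u : measurable A -> measurable J -> l2 u -> P J u = u ->
  P J (P A u) = P A u.
Proof.
move=> mA mJ h e; have mAJ := measurableI _ _ mA mJ.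
have hAJ := proj_l2 mAJ h; pose u2 n := u n - P (A `&` J) u n.
have h2 : l2 u2 := (l2B h hAJ).1.
have n1 : P (A `&` J) u2 = fun=> 0.
  by rewrite /u2 proj_sub // proj_idem //; apply/funext => n; rewrite subrr.
have eAJ : P J (P (A `&` J) u) = P (A `&` J) u.
  by apply: (proj_nested mAJ mJ (@subIsetr _ A J)); rewrite ?proj_idem.
have n2 : P (~` J) u2 = fun=> 0.
  apply: proj_null => //; rewrite /u2 proj_sub // e eAJ //.
have mAD := measurableD mA mJ.
have n3 : P A u2 = fun=> 0.
  apply: l2norm_eq0; first exact: proj_l2.
  apply/eqP; rewrite -sqrf_eq0 eq_le sqr_ge0 andbT.
  have e3 : A = (A `&` J) `|` (A `\` J) by rewrite setUIDK.
  have d3 : (A `&` J) `&` (A `\` J) = set0 by rewrite setDE setIACA setICr setI0.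
  rewrite [in leLHS]e3 proj_addU // n1 l20.2 expr0n add0r.
  apply: le_trans (proj_mono mAD (measurableC mJ) _ h2) _; first by move=> t [].
  by rewrite n2 l20.2 expr0n.
have -> : P A u = P (A `&` J) u; last exact: eAJ.
have : P A u = P A (fun n => u2 n + P (A `&` J) u n).
  by congr (P A); apply/funext => n; rewrite subrK.
rewrite proj_add // n3 => ->.
rewrite (proj_nested mAJ mA (@subIsetl _ A J)) ?proj_idem //.
by apply/funext => n; rewrite add0r.
Qed.

Lemma rip0r phi : l2 phi -> rip phi (fun=> 0) = 0.
Proof.
move=> h; rewrite -[RHS](mul0r (rip phi phi)) -ripZr //; congr rip.
by apply/funext => n; rewrite mul0r.
Qed.

(** For each [A] the vectors [P A u] and [P A w] are orthogonal, since the first stays in the range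
    of [P J] and the second in that of its complement. The spectral measures therefore add, and so
    do their first moments. *)
Lemma spectral_form_add J u w : measurable J -> l2 u -> l2 w -> P J u = u ->
  P J w = (fun=> 0) ->
  rip (fun n => u n + w n) (H (fun n => u n + w n)) = rip u (H u) + rip w (H w).
Proof.
move=> mJ hu hw eu ew; have hs := (l2D hu hw).1; have mJ' := measurableC mJ.
have ew' : P (~` J) w = w by rewrite projC // ew; apply/funext => n; rewrite subr0.
have [m1 [a1 b1 c1]] := spectral_measure hu.
have [m2 [a2 b2 c2]] := spectral_measure hw.
have [m3 [a3 b3 c3]] := spectral_measure hs.
have hadd A : measurable A -> m3 A = (m1 A + m2 A)%E.
  move=> mA; rewrite a1 // a2 // a3 // -EFinD proj_add // l2norm_sqD; [|exact: proj_l2..].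
  suff -> : rip (P A u) (P A w) = 0 by rewrite mulr0 addr0.
  rewrite -(proj_ran_stable mA mJ hu eu) -proj_rip //; try exact: proj_l2.
  have := proj_null mJ' (proj_l2 mA hw) (proj_ran_stable mA mJ' hw ew').
  rewrite setCK => ->; apply: rip0r; exact: proj_l2.
rewrite c1 c2 c3.
have -> : (\int[m3]_(t in setT) t%:E = \int[measure_add m1 m2]_(t in setT) t%:E)%E.
  apply: eq_measure_integral => A mA _.
  exact: etrans (hadd A mA) (esym (measure_addE m1 m2 A)).
rewrite integral_measure_add // fineD //; exact: integrable_fin_num.
Qed.

Lemma spectral_form_cross J u w : measurable J -> l2 u -> l2 w -> P J u = u ->
  P J w = (fun=> 0) -> rip u (H w) = 0.
Proof.
move=> mJ hu hw eu ew; have := spectral_form_add mJ hu hw eu ew.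
have hHu := (l2_schrodinger v_real v_bound hu).1.
have hHw := (l2_schrodinger v_real v_bound hw).1.
have hs := (l2D hu hw).1.
rewrite schrodingerD ripDr // !ripDl //.
have -> : rip w (H u) = rip u (H w).
  by rewrite (schrodinger_selfadjoint v_real v_bound) // ripC.
lra.
Qed.

(** The form of H has no cross terms between the range of [P J] and its complement. Testing [H w]
    against its own projection, and likewise [H u], shows that H preserves both ranges. *)
Lemma proj_commute J phi : measurable J -> l2 phi -> P J (H phi) = H (P J phi).
Proof.
move=> mJ h; have mJ' := measurableC mJ.
have hH psi : l2 psi -> l2 (H psi) by move=> hp; exact: (l2_schrodinger v_real v_bound hp).1.
set u := P J phi; have hu : l2 u by exact: proj_l2.
have eu : P J u = u by exact: proj_idem.
pose w n := phi n - u n; have hw : l2 w := (l2B h hu).1.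
have ew : P J w = fun=> 0.
  by rewrite /w proj_sub // eu; apply/funext => n; rewrite subrr.
have ew' : P (~` J) w = w by rewrite projC // ew; apply/funext => n; rewrite subr0.
have k1 : P J (H w) = fun=> 0.
  apply: l2norm_eq0; first by apply: proj_l2 => //; exact: hH.
  have hp := proj_l2 mJ (hH _ hw).
  apply/eqP; rewrite -sqrf_eq0 -rip_self // -proj_rip // ?proj_idem //; [|exact: hH..].
  by rewrite proj_rip // ?(spectral_form_cross mJ) ?proj_idem //; exact: hH.
have k2 : P (~` J) (H u) = fun=> 0.
  have hp := proj_l2 mJ' (hH _ hu).
  apply: l2norm_eq0; first by [].
  apply/eqP; rewrite -sqrf_eq0 -rip_self //.
  have -> : rip (P (~` J) (H u)) (P (~` J) (H u)) = rip (P (~` J) (H u)) (H u).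
    by rewrite proj_rip //; [rewrite proj_idem //; exact: hH|exact: hH].
  apply/eqP; exact: (spectral_form_cross mJ' hp hu (proj_idem mJ' (hH _ hu)) (proj_null mJ hu eu)).
have e1 : H phi = fun n => H u n + H w n.
  by rewrite -schrodingerD; congr (H _); apply/funext => n; rewrite /w addrC subrK.
rewrite e1 proj_add //; [|exact: hH..].
rewrite k1; have := projC mJ (hH _ hu); rewrite k2 => /(congr1 (fun f => f _)) e.
by apply/funext => n; rewrite addr0; have /esym/eqP := e n; rewrite subr_eq0 => /eqP.
Qed.

Lemma spectral_form_bound c s u : l2 u ->
  let J := [set t : R | c - s <= t <= c + s] in
  P J u = u -> `|rip u (H u) - c * l2norm u ^+ 2| <= s * l2norm u ^+ 2.
Proof.
move=> hu J eu.
have eJ : J = `[c - s, c + s]%classic by apply/seteqP; split => t; rewrite /J /= in_itv.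
have mJ : measurable J by rewrite eJ; exact: measurable_itv.
have [mu [a1 b1 c1]] := spectral_measure hu.
have m0 : mu (~` J) = 0.
  by rewrite a1 ?(proj_null mJ) // ?l20.2 ?expr0n //; exact: measurableC.
have mJu : mu J = (l2norm u ^+ 2)%:E by rewrite a1 // eu.
rewrite c1.
have /andP[b2 b3] := @integral_concentrated R _ (measurableTypeR R) mu J id _ _ _
  mJ m0 mJu b1 (fun t (h : J t) => h).
rewrite /= in b2 b3.
move: b2 b3; move: (fine _) => q b2 b3.
by rewrite ler_norml; apply/andP; split; lra.
Qed.

End spectral_calculus.

(** * The polynomial energy filter *)

Section energy_filter.
Context {R : realType}.
Local Notation C := R[i].
Variables (v : int -> C) (r : int -> R) (Bv : R).
Hypothesis v_real : forall n, v n = ((r n)%:C)%C.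
Hypothesis v_bound : forall n, `|r n| <= Bv.
Local Notation H := (schrodinger v).
Variables (c M : R).

Definition shiftH (phi : int -> C) : int -> C := fun n => H phi n - (c%:C)%C * phi n.
(** A polynomial of degree two in the operator, so each application enlarges the support by at most
    two sites. [filter_symbol] is its eigenvalue at energy [E], largest at [E = c]. *)
Definition filterH (phi : int -> C) : int -> C :=
  fun n => ((M ^+ 2)%:C)%C * phi n - shiftH (shiftH phi) n.
Definition filter_symbol (E : R) : R := M ^+ 2 - (E - c) ^+ 2.

Lemma shiftH_l2 phi : l2 phi -> l2 (shiftH phi).
Proof.
move=> h; exact: (l2B (l2_schrodinger v_real v_bound h).1 (l2Z _ h).1).1.
Qed.

Lemma filterH_l2 phi : l2 phi -> l2 (filterH phi).
Proof. by move=> h; exact: (l2B (l2Z _ h).1 (shiftH_l2 (shiftH_l2 h))).1. Qed.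

Lemma iter_filterH_l2 k phi : l2 phi -> l2 (iter k filterH phi).
Proof. by move=> h; elim: k => //= k IH; exact: filterH_l2. Qed.

Lemma shiftHB phi psi : shiftH (fun n => phi n - psi n) = fun n => shiftH phi n - shiftH psi n.
Proof. by apply/funext => n; rewrite /shiftH schrodingerB; ring. Qed.

Lemma filterHB phi psi :
  filterH (fun n => phi n - psi n) = fun n => filterH phi n - filterH psi n.
Proof. by apply/funext => n; rewrite /filterH !shiftHB; ring. Qed.

Lemma iter_filterHB k phi psi : iter k filterH (fun n => phi n - psi n) =
  fun n => iter k filterH phi n - iter k filterH psi n.
Proof. by elim: k => //= k ->; rewrite filterHB. Qed.

Lemma shiftH_sum (I : finType) (a : I -> C) (e : I -> int -> C) :
  shiftH (fun n => \sum_j a j * e j n) = fun n => \sum_j a j * shiftH (e j) n.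
Proof.
apply/funext => n; rewrite /shiftH schrodinger_sum mulr_sumr -sumrB.
by apply: eq_bigr => j _; ring.
Qed.

Lemma filterH_sum (I : finType) (a : I -> C) (e : I -> int -> C) :
  filterH (fun n => \sum_j a j * e j n) = fun n => \sum_j a j * filterH (e j) n.
Proof.
apply/funext => n; rewrite /filterH !shiftH_sum mulr_sumr -sumrB.
by apply: eq_bigr => j _; ring.
Qed.

Lemma iter_filterH_sum k (I : finType) (a : I -> C) (e : I -> int -> C) :
  iter k filterH (fun n => \sum_j a j * e j n) = fun n => \sum_j a j * iter k filterH (e j) n.
Proof. by elim: k => //= k ->; rewrite filterH_sum. Qed.

Lemma shiftH_eigen psi E : H psi = (fun n => (E%:C)%C * psi n) ->
  shiftH psi = fun n => ((E - c)%:C)%C * psi n.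
Proof. by move=> e; apply/funext => n; rewrite /shiftH e rmorphB /= mulrBl. Qed.

Lemma shiftHZ z phi : shiftH (fun n => z * phi n) = fun n => z * shiftH phi n.
Proof. by apply/funext => n; rewrite /shiftH schrodingerZ; ring. Qed.

Lemma filterHZ z phi : filterH (fun n => z * phi n) = fun n => z * filterH phi n.
Proof. by apply/funext => n; rewrite /filterH !shiftHZ; ring. Qed.

Lemma iter_filterH_eigen k psi E : H psi = (fun n => (E%:C)%C * psi n) ->
  iter k filterH psi = fun n => ((filter_symbol E ^+ k)%:C)%C * psi n.
Proof.
move=> e; elim: k => [|k IH] /=.
  by apply/funext => n; rewrite expr0 mul1r.
rewrite IH filterHZ; apply/funext => n; rewrite /filterH (shiftH_eigen e) shiftHZ.
rewrite (shiftH_eigen e).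
have -> : ((filter_symbol E ^+ k.+1)%:C)%C = ((filter_symbol E ^+ k)%:C)%C *
    (((M ^+ 2)%:C)%C - ((E - c)%:C)%C * ((E - c)%:C)%C).
  rewrite exprSr [LHS]rmorphM; congr (_ * _).
  by rewrite /filter_symbol [(E - c) ^+ 2]expr2 [LHS]rmorphB; congr (_ - _); rewrite [LHS]rmorphM.
ring.
Qed.

Section projected.
Variable P : set R -> (int -> C) -> int -> C.
Hypothesis hP : spectral_resolution H P.
Variable s : R.
Hypothesis s_ge0 : 0 <= s.
Hypothesis sM : s <= M.
Let J : set R := [set t | c - s <= t <= c + s].

Let mJ : measurable J.
Proof.
have -> : J = `[c - s, c + s]%classic by apply/seteqP; split => t; rewrite /J /= in_itv.
exact: measurable_itv.
Qed.

Lemma proj_shiftH phi : l2 phi -> P J (shiftH phi) = shiftH (P J phi).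
Proof.
move=> h; rewrite (proj_sub hP mJ (l2_schrodinger v_real v_bound h).1 (l2Z _ h).1).
by rewrite (proj_commute v_real v_bound hP mJ h) (projZ hP _ mJ h).
Qed.

Lemma proj_filterH phi : l2 phi -> P J (filterH phi) = filterH (P J phi).
Proof.
move=> h; rewrite (proj_sub hP mJ (l2Z _ h).1 (shiftH_l2 (shiftH_l2 h))).
by rewrite (projZ hP _ mJ h) !proj_shiftH //; exact: shiftH_l2.
Qed.

Lemma proj_iter_filterH k phi : l2 phi -> P J (iter k filterH phi) = iter k filterH (P J phi).
Proof.
move=> h; elim: k => //= k IH; rewrite proj_filterH ?IH //.
exact: iter_filterH_l2.
Qed.

Lemma shiftH_sym phi psi : l2 phi -> l2 psi -> rip phi (shiftH psi) = rip psi (shiftH phi).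
Proof.
move=> h1 h2; have k1 := (l2_schrodinger v_real v_bound h1).1.
have k2 := (l2_schrodinger v_real v_bound h2).1.
rewrite ripBr ?ripZr //; last exact: (l2Z _ h2).1.
rewrite ripBr ?ripZr //; last exact: (l2Z _ h1).1.
rewrite (schrodinger_selfadjoint v_real v_bound h1 h2) (ripC k1 h2).
by rewrite (ripC h1 h2).
Qed.

Lemma shiftH_form u : l2 u -> P J u = u -> `|rip u (shiftH u)| <= s * l2norm u ^+ 2.
Proof.
move=> h e; have k := (l2_schrodinger v_real v_bound h).1.
rewrite ripBr ?ripZr //; last exact: (l2Z _ h).1.
by rewrite rip_self //; exact: (spectral_form_bound hP h e).
Qed.

(* A symmetric form bounded by s on the range of P J bounds the operator:
   polarize with y = (H - c) u and the vectors |u| y + |y| u, |u| y - |y| u. *)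
Lemma shiftH_contract u : l2 u -> P J u = u -> l2norm (shiftH u) <= s * l2norm u.
Proof.
move=> hu eu; set y := shiftH u; have hy : l2 y := shiftH_l2 hu.
have ey : P J y = y by rewrite /y proj_shiftH // eu.
have [u0|un0] := eqVneq (l2norm u) 0.
  have e0 : shiftH u = fun=> 0.
    apply/funext => n; rewrite /shiftH /schrodinger (l2norm_eq0 hu u0).
    by rewrite !mulr0 !oppr0 !addr0.
  by rewrite /y e0 l20.2 u0 mulr0.
have [y0|yn0] := eqVneq (l2norm y) 0.
  by rewrite y0 mulr_ge0 // l2norm_ge0.
have u_gt0 : 0 < l2norm u by rewrite lt_neqAle eq_sym un0 l2norm_ge0.
have y_gt0 : 0 < l2norm y by rewrite lt_neqAle eq_sym yn0 l2norm_ge0.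
pose y' n := ((l2norm u)%:C)%C * y n; pose u' n := ((l2norm y)%:C)%C * u n.
have hy' : l2 y' := (l2Z _ hy).1; have hu' : l2 u' := (l2Z _ hu).1.
have ey' : P J y' = y' by rewrite (projZ hP _ mJ hy) ey.
have eu' : P J u' = u' by rewrite (projZ hP _ mJ hu) eu.
have hp := (l2D hy' hu').1; have hm := (l2B hy' hu').1.
have ep : P J (fun n => y' n + u' n) = fun n => y' n + u' n.
  by rewrite (proj_add hP mJ hy' hu') ey' eu'.
have em : P J (fun n => y' n - u' n) = fun n => y' n - u' n.
  by rewrite (proj_sub hP mJ hy' hu') ey' eu'.
have bp := shiftH_form hp ep; have bm := shiftH_form hm em.
have sy := shiftH_l2 hy'; have su := shiftH_l2 hu'.
have ny : l2norm y' = l2norm u * l2norm y.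
  by rewrite (l2Z _ hy).2 cabs_real ger0_norm // l2norm_ge0.
have nu : l2norm u' = l2norm y * l2norm u.
  by rewrite (l2Z _ hu).2 cabs_real ger0_norm // l2norm_ge0.
have shiftHD phi psi : shiftH (fun n => phi n + psi n) = fun n => shiftH phi n + shiftH psi n.
  by apply/funext => n; rewrite /shiftH schrodingerD; ring.
have cross : rip y' (shiftH u') = l2norm u * l2norm y * l2norm y ^+ 2.
  rewrite /u' shiftHZ -/y (ripZr _ hy' hy) /y' (ripZl _ hy hy) rip_self //.
  by rewrite mulrA [l2norm y * _]mulrC.
have fp : rip (fun n => y' n + u' n) (shiftH (fun n => y' n + u' n)) =
    rip y' (shiftH y') + 2 * rip y' (shiftH u') + rip u' (shiftH u').
  rewrite shiftHD ripDr // !ripDl // (shiftH_sym hu' hy'); ring.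
have fm : rip (fun n => y' n - u' n) (shiftH (fun n => y' n - u' n)) =
    rip y' (shiftH y') - 2 * rip y' (shiftH u') + rip u' (shiftH u').
  rewrite shiftHB ripBr // !ripBl // (shiftH_sym hu' hy'); ring.
rewrite fp l2norm_sqD // in bp; rewrite fm l2norm_sqB // in bm.
move: bp bm; rewrite !ler_norml => /andP[_ b1] /andP[b2 _].
have : 4 * (l2norm u * l2norm y * l2norm y ^+ 2) <=
    s * (4 * (l2norm u * l2norm y) ^+ 2).
  rewrite -cross; rewrite ny nu [l2norm y * l2norm u]mulrC in b1 b2.
  move: b1 b2; move: (rip _ _) (rip _ _) (rip _ _) (rip _ _) (_ ^+ 2) => x1 x2 x3 x4 x5; lra.
have -> : 4 * (l2norm u * l2norm y * l2norm y ^+ 2) =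
  (4 * (l2norm u * l2norm y ^+ 2)) * l2norm y by ring.
have -> : s * (4 * (l2norm u * l2norm y) ^+ 2) =
  (4 * (l2norm u * l2norm y ^+ 2)) * (s * l2norm u) by ring.
by rewrite ler_pM2l // !mulr_gt0 ?exprn_gt0.
Qed.

Lemma filterH_expand u : l2 u -> P J u = u ->
  (M ^+ 2 - s ^+ 2) * l2norm u <= l2norm (filterH u).
Proof.
move=> hu eu; have h1 := shiftH_l2 hu; have h2 := shiftH_l2 h1.
have e1 : P J (shiftH u) = shiftH u by rewrite proj_shiftH // eu.
have b1 := shiftH_contract hu eu; have b2 := shiftH_contract h1 e1.
have b3 : l2norm (shiftH (shiftH u)) <= s ^+ 2 * l2norm u.
  by apply: (le_trans b2); rewrite expr2 -mulrA ler_wpM2l.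
have := (l2D (filterH_l2 hu) h2).2.
rewrite (_ : (fun n => _) = fun n => ((M ^+ 2)%:C)%C * u n); last first.
  by apply/funext => n; rewrite /filterH subrK.
rewrite (l2Z _ hu).2 cabs_real ger0_norm ?sqr_ge0 // mulrBl; lra.
Qed.

Lemma iter_filterH_expand k u : l2 u -> P J u = u ->
  (M ^+ 2 - s ^+ 2) ^+ k * l2norm u <= l2norm (iter k filterH u).
Proof.
move=> hu eu; elim: k => [|k IH]; first by rewrite expr0 mul1r.
have e : P J (iter k filterH u) = iter k filterH u by rewrite proj_iter_filterH // eu.
apply: le_trans (filterH_expand (iter_filterH_l2 k hu) e).
rewrite exprS -mulrA ler_wpM2l // subr_ge0 ler_sqr ?nnegrE //; exact: le_trans sM.
Qed.

Lemma proj_eigen_energy psi E : l2 psi -> l2norm psi = 1 -> P J psi = psi ->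
  H psi = (fun n => (E%:C)%C * psi n) -> M ^+ 2 - s ^+ 2 <= filter_symbol E.
Proof.
move=> h1 h2 h3 h4; have := shiftH_contract h1 h3.
rewrite (shiftH_eigen h4) (l2Z _ h1).2 h2 !mulr1 cabs_real => hE.
by rewrite /filter_symbol lerD2l lerN2 -[leLHS]real_normK ?num_real // ler_sqr ?nnegrE.
Qed.

(** [P J psi] solves the same eigenvalue equation, so by simplicity it is [z * psi]; idempotence
    leaves only 0 and 1 for [z]. *)
Lemma proj_eigen_dichotomy psi E : l2 psi -> l2norm psi = 1 ->
  H psi = (fun n => (E%:C)%C * psi n) -> P J psi = psi \/ P J psi = fun=> 0.
Proof.
move=> h1 h2 h3; have hp := proj_l2 hP mJ h1.
have nz : psi <> fun=> 0.
  by move=> e; move: h2; rewrite e l20.2 => /eqP; rewrite eq_sym oner_eq0.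
have e1 : H (P J psi) = fun n => (E%:C)%C * P J psi n.
  by rewrite -(proj_commute v_real v_bound hP mJ h1) h3 (projZ hP _ mJ h1).
have [z ez] := eigen_simple h1 hp nz h3 e1.
have e2 := proj_idem hP mJ h1; rewrite ez (projZ hP _ mJ h1) ez in e2.
have [k hk] : exists k, psi k != 0.
  apply: contrapT => hn; apply: nz; apply/funext => k; apply/eqP/negPn/negP => hk.
  by apply: hn; exists k.
have : z * (z - 1) = 0.
  have := congr1 (fun f => f k) e2 => /= e3.
  have : (z * (z - 1)) * psi k = 0 by rewrite mulrBr mulr1 mulrBl -mulrA e3 subrr.
  by move=> /eqP; rewrite mulf_eq0 (negbTE hk) orbF => /eqP.
move=> /eqP; rewrite mulf_eq0 subr_eq0 => /orP[] /eqP hz; [right|left].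
  by rewrite ez hz; apply/funext => n; rewrite mul0r.
by rewrite ez hz; apply/funext => n; rewrite mul1r.
Qed.

End projected.

End energy_filter.

Section box_expansion.
Context {R : realType}.
Local Notation C := R[i].
Variables (v : int -> C) (c M : R) (N : nat).
Variables (E : 'I_(N.*2.+1) -> R) (e : 'I_(N.*2.+1) -> int -> C).
Hypothesis he : forall j, unit_eigvec v (symm N) (E j) (e j).
Local Notation shiftHc := (shiftH v c).
Local Notation filterHc := (filterH v c M).
Local Notation symbol := (filter_symbol c M).

Definition supported (s : nat) (phi : int -> C) : Prop :=
  forall n : int, s%:Z < `|n| -> phi n = 0.

Lemma supported_shiftH s phi : supported s phi -> supported s.+1 (shiftHc phi).
Proof.
move=> h n hn; have [h1 [h2 h3]] : s%:Z < `|n| /\ s%:Z < `|n + 1| /\ s%:Z < `|n - 1| by lia.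
by rewrite /shiftH /schrodinger !h // !mulr0 !oppr0 !addr0.
Qed.

(** An individual [e j] can violate the eigenvalue equation just outside the box. The combination
    vanishes near the boundary, so these defects cancel in the sum; no condition on the single terms
    is needed there. *)
Lemma shiftH_box s (a : 'I_(N.*2.+1) -> C) : (s < N)%N ->
  supported s (fun n => \sum_j a j * e j n) ->
  shiftHc (fun n => \sum_j a j * e j n) = fun n => \sum_j (a j * ((E j - c)%:C)%C) * e j n.
Proof.
move=> sN hs; apply/funext => n; have [hn|hn] := leP `|n| N%:Z.
  rewrite shiftH_sum; apply: eq_bigr => j _; rewrite -mulrA; congr (_ * _).
  have [_ h _] := (unit_eigvecP v N _ _).1 (he j).
  by rewrite /shiftH h // rmorphB /= mulrBl.
rewrite (supported_shiftH hs); last by apply: le_lt_trans hn; rewrite lez_nat.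
rewrite big1 // => j _; have [h _ _] := (unit_eigvecP v N _ _).1 (he j).
by rewrite h ?mulr0.
Qed.

Lemma filterH_box s (a : 'I_(N.*2.+1) -> C) : (s.+1 < N)%N ->
  supported s (fun n => \sum_j a j * e j n) ->
  filterHc (fun n => \sum_j a j * e j n) = (fun n => \sum_j (a j * ((symbol (E j))%:C)%C) * e j n)
  /\ supported s.+2 (filterHc (fun n => \sum_j a j * e j n)).
Proof.
move=> sN hs; have h1 := shiftH_box (ltnW sN) hs.
have s1 := supported_shiftH hs; have s2 := supported_shiftH s1.
have h2 := s1; rewrite h1 in h2; have {}h2 := shiftH_box sN h2.
split; last first.
  move=> n hn; rewrite /filterH s2 // hs ?mulr0 ?subr0 //.
  by apply: lt_trans hn; rewrite ltz_nat; lia.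
apply/funext => n; rewrite /filterH h1 h2 mulr_sumr -sumrB; apply: eq_bigr => j _.
have -> : ((symbol (E j))%:C)%C = ((M ^+ 2)%:C)%C - ((E j - c)%:C)%C * ((E j - c)%:C)%C.
  by rewrite /filter_symbol [(E j - c) ^+ 2]expr2 [LHS]rmorphB; congr (_ - _); rewrite [LHS]rmorphM.
ring.
Qed.

Lemma iter_filterH_box k s (a : 'I_(N.*2.+1) -> C) phi : (s + k.*2 < N)%N ->
  supported s phi -> phi = (fun n => \sum_j a j * e j n) ->
  iter k filterHc phi = (fun n => \sum_j (a j * ((symbol (E j) ^+ k)%:C)%C) * e j n) /\
  supported (s + k.*2) (iter k filterHc phi).
Proof.
move=> + hs ephi; elim: k => [|k IH] hk /=.
  split; last by rewrite addn0.
  by rewrite ephi; apply/funext => n; apply: eq_bigr => j _; rewrite expr0 mulr1.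
have [|h1 h2] := IH; first by lia.
rewrite h1 in h2 *; have [|k1 k2] := @filterH_box (s + k.*2)%N _ _ h2; first by lia.
rewrite doubleS !addnS; split=> //.
rewrite k1; apply/funext => n; apply: eq_bigr => j _; congr (_ * _).
by rewrite exprSr -mulrA; congr (_ * _); rewrite -[LHS]rmorphM.
Qed.

End box_expansion.

(** * Approximation of the spectral projection by limits of towers *)

Section projection_approx.
Context {R : realType}.
Local Notation C := R[i].
Variables (v : int -> C) (r : int -> R) (Bv : R).
Hypothesis v_real : forall n, v n = ((r n)%:C)%C.
Hypothesis v_bound : forall n, `|r n| <= Bv.
Local Notation H := (schrodinger v).
Local Notation ev N j := (eigval v (symm N) j).
Variable P : set R -> (int -> C) -> int -> C.
Hypothesis hP : spectral_resolution H P.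
Variables (c s rad gam : R) (Nst : nat).
Hypothesis s_ge0 : 0 <= s.
Hypothesis s_rad : s < rad.
Hypothesis gam_gt0 : 0 < gam.
Let J : set R := [set t | c - s <= t <= c + s].

Variable lim_pair : R -> (int -> C) -> Prop.
Hypothesis lim_pairP : forall E psi, lim_pair E psi ->
  [/\ l2 psi, l2norm psi = 1 & H psi = fun n => (E%:C)%C * psi n].
Hypothesis box_dichotomy : forall (N j : nat) (psi : int -> C),
  (Nst <= N)%N -> (j < N.*2.+1)%N -> unit_eigvec v (symm N) (ev N j) psi ->
  `|ev N j - c| <= rad ->
  (exists E psi', lim_pair E psi' /\
     l2norm (fun n => psi n - psi' n) <= expR (- (gam * N%:R))) \/
  (forall m : int, (`|m|)%:~R <= N%:R / 10 :> R -> cabs (psi m) <= expR (- (gam * N%:R))).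

(** [2 + Bv] bounds all energies, so the symbol is nonnegative on them; the term [rad] makes
    [M ^+ 2 - rad ^+ 2] nonnegative as well. *)
Let M : R := 2 + Bv + `|c| + rad.
Local Notation filterHc := (filterH v c M).
Local Notation symbol := (filter_symbol c M).

Let Bv_ge0 : 0 <= Bv. Proof. exact: le_trans (v_bound 0). Qed.
Let rad_gt0 : 0 < rad. Proof. exact: le_lt_trans s_rad. Qed.
Let M_gt_rad : rad < M. Proof. by have := normr_ge0 c; have := Bv_ge0; rewrite /M; lra. Qed.
Let sM : s <= M. Proof. by apply: ltW; exact: lt_trans M_gt_rad. Qed.
Let M_gt0 : 0 < M. Proof. exact: lt_trans M_gt_rad. Qed.

Lemma symbol_bounds (E : R) : `|E| <= 2 + Bv -> 0 <= symbol E <= M ^+ 2.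
Proof.
move=> hE; rewrite /filter_symbol subr_ge0 gerBl sqr_ge0 andbT.
rewrite -[leLHS]real_normK ?num_real // ler_sqr ?nnegrE ?(ltW M_gt0) //.
have := ler_normB E c; rewrite /M; have := rad_gt0; lra.
Qed.

Lemma symbol_far (E : R) : rad < `|E - c| -> symbol E <= M ^+ 2 - rad ^+ 2.
Proof.
move=> hE; rewrite /filter_symbol lerD2l lerN2 -[leRHS]real_normK ?num_real //.
by rewrite ler_sqr ?nnegrE ?(ltW rad_gt0) //; exact: ltW.
Qed.

(* The first term bounds the energies outside [c - rad, c + rad]; the second one the
   eigenvectors localized far from the support of phi, and the replacement of the
   remaining ones by elements of lim_pair. *)
Lemma box_estimate (m N k : nat) (phi : int -> C) : (Nst <= N)%N ->
  supported m phi -> m%:R <= N%:R / 10 :> R -> (m + k.*2 < N)%N ->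
  exists (p : nat) (q : 'I_p -> C) (Es : 'I_p -> R) (psis : 'I_p -> int -> C),
    (forall i, lim_pair (Es i) (psis i)) /\
    l2norm (fun n => iter k filterHc phi n - \sum_i q i * psis i n) <=
      (M ^+ 2 - rad ^+ 2) ^+ k * l2norm phi +
      ((N.*2.+1)%:R * expR (- (gam / 2 * N%:R))) ^+ 2 * (2 * (M ^+ 2) ^+ k * l2norm phi).
Proof.
move=> hN hs hm hk.
have mN : (m <= N)%N := leq_trans (leq_addr _ _) (ltnW hk).
have hs' (n : int) : N%:Z < `|n| -> phi n = 0.
  by move=> hn; apply: hs; apply: le_lt_trans hn; rewrite lez_nat.
have [hl hnorm] := l2_finsupp hs'.
have [e [he hexp hpar]] := finite_eigenbasis v_real N.
pose a j : C := wsum (fun k => (e j k)^* * phi k) N.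
have ephi : phi = fun n => \sum_j a j * e j n by apply/funext => n; exact: hexp.
have [eG sG] := iter_filterH_box c M he hk hs ephi.
pose g j : R := symbol (ev N (j : 'I_(N.*2.+1))) ^+ k.
pose far (j : 'I_(N.*2.+1)) := rad < `|ev N j - c|.
have hE j := eigval_bound v_real v_bound (he j).
have hg j : 0 <= g j <= (M ^+ 2) ^+ k.
  have /andP[h1 h2] := symbol_bounds (hE j).
  by rewrite exprn_ge0 //= lerXn2r ?nnegrE ?sqr_ge0.
have hpa : \sum_(j < N.*2.+1) cabs (a j) ^+ 2 = l2norm phi ^+ 2.
  by rewrite -hpar -ephi hnorm.
have ha j : cabs (a j) <= l2norm phi.
  rewrite -ler_sqr ?nnegrE ?cabs_ge0 ?l2norm_ge0 // -hpa (bigD1 j) //= lerDl.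
  by apply: sumr_ge0 => i _; exact: sqr_ge0.
(* The boolean records the alternative of [box_dichotomy]: [true] for an eigenvector close to a
   member of [lim_pair], [false] for one small near the origin. Far energies receive an irrelevant
   default. *)
have [w hw] : exists w : 'I_(N.*2.+1) -> R * (int -> C) * bool, forall j, ~~ far j ->
    if (w j).2 then lim_pair (w j).1.1 (w j).1.2 /\
       l2norm (fun n => e j n - (w j).1.2 n) <= expR (- (gam * N%:R))
    else forall m : int, (`|m|)%:~R <= N%:R / 10 :> R -> cabs (e j m) <= expR (- (gam * N%:R)).
  have hall (j : 'I_(N.*2.+1)) : exists w : R * (int -> C) * bool, ~~ far j ->
    if w.2 then lim_pair w.1.1 w.1.2 /\
       l2norm (fun n => e j n - w.1.2 n) <= expR (- (gam * N%:R))
    else forall m : int, (`|m|)%:~R <= N%:R / 10 :> R -> cabs (e j m) <= expR (- (gam * N%:R)).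
    have [hf|hf] := boolP (far j); first by exists (0, e j, true).
    have [|[E [psi' h]]|h] := box_dichotomy hN (ltn_ord j) (he j); first by rewrite leNgt.
      by exists (E, psi', true).
    by exists (0, e j, false).
  have [w hw] := choice hall; by exists w.
pose S := [set j | ~~ far j && (w j).2]%SET.
have hS j : j \in S -> lim_pair (w j).1.1 (w j).1.2 /\
       l2norm (fun n => e j n - (w j).1.2 n) <= expR (- (gam * N%:R)).
  by rewrite inE => /andP[/hw + h2]; rewrite h2.
pose K : R := (N.*2.+1)%:R; have K1 : 1 <= K by rewrite ler1n.
pose xi := expR (- (gam * N%:R)).
have xi0 : 0 <= xi by exact: expR_ge0.
have M2k : 0 <= (M ^+ 2) ^+ k by apply: exprn_ge0; exact: sqr_ge0.
have Mk : 0 <= (M ^+ 2) ^+ k * l2norm phi by apply: mulr_ge0 => //; exact: l2norm_ge0.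
have Kxi : 0 <= K * xi by apply: mulr_ge0.
exists #|S|, (fun i => a (enum_val i) * ((g (enum_val i))%:C)%C), (fun i => (w (enum_val i)).1.1),
  (fun i => (w (enum_val i)).1.2).
split; first by move=> i; exact: (hS _ (enum_valP i)).1.
(* [b] collects the far energies, bounded together by Parseval; each [d j] is exponentially small by
   itself and can be summed crudely. *)
pose b j : C := if far j then a j * ((g j)%:C)%C else 0.
pose d j n : C := if far j then 0 else
  if (w j).2 then (a j * ((g j)%:C)%C) * (e j n - (w j).1.2 n) else (a j * ((g j)%:C)%C) * e j n.
have split3 : (fun n => iter k filterHc phi n -
    \sum_(i < #|S|) a (enum_val i) * ((g (enum_val i))%:C)%C * (w (enum_val i)).1.2 n) =
  fun n => \sum_j b j * e j n + \sum_j d j n.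
  apply/funext => n.
  have <- : \sum_(j in S) a j * ((g j)%:C)%C * (w j).1.2 n = \sum_(i < #|S|)
      a (enum_val i) * ((g (enum_val i))%:C)%C * (w (enum_val i)).1.2 n.
    by rewrite big_enum_val.
  rewrite eG.
  rewrite [X in _ - X]big_mkcond /= -sumrB -big_split /=; apply: eq_bigr => j _.
  rewrite inE /b /d -/(g j); case: (far j) => /=; first by rewrite subr0 addr0.
  by case: (w j).2 => /=; rewrite mul0r add0r ?subr0 // mulrBr.
have hb : l2 (fun n => \sum_j b j * e j n) /\ l2norm (fun n => \sum_j b j * e j n) <=
    (M ^+ 2 - rad ^+ 2) ^+ k * l2norm phi.
  have hsupp : forall n : int, N%:Z < `|n| -> \sum_j b j * e j n = 0.
    move=> n hn; rewrite big1 // => j _; have [h _ _] := (unit_eigvecP v N _ _).1 (he j).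
    by rewrite h ?mulr0.
  have [h1 ->] := l2_finsupp hsupp; split=> //.
  have hr : 0 <= M ^+ 2 - rad ^+ 2.
    by rewrite subr_ge0 ler_sqr ?nnegrE ?(ltW M_gt0) ?(ltW rad_gt0) // ltW.
  rewrite -ler_sqr ?nnegrE ?nrm_ge0 ?mulr_ge0 ?exprn_ge0 ?l2norm_ge0 //.
  rewrite hpar exprMn -hpa mulr_sumr; apply: ler_sum => j _; rewrite /b.
  case: ifPn => hf; last by rewrite cabs0 expr0n /= mulr_ge0 ?sqr_ge0.
  rewrite cabsM cabs_real exprMn mulrC ler_wpM2r ?sqr_ge0 //.
  have /andP[h2 h3] := hg j; rewrite ger0_norm // ler_sqr; [|by rewrite nnegrE|by rewrite nnegrE exprn_ge0].
  have /andP[s0 _] := symbol_bounds (hE j).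
  by apply: lerXn2r; rewrite ?nnegrE //; exact: symbol_far.
have hd (j : 'I_(N.*2.+1)) : l2 (d j) /\ l2norm (d j) <= K * xi * ((M ^+ 2) ^+ k * l2norm phi).
  have /andP[g0 g1] := hg j.
  have [hf|hf] := boolP (far j).
    have -> : d j = fun=> 0 by apply/funext => n; rewrite /d hf.
    by have [h1 h2] := @l20 R; split=> //; rewrite h2; exact: mulr_ge0.
  have he2 := unit_eigvec_l2 (he j).
  have [hf2|hf2] := boolP (w j).2.
    have -> : d j = fun n => (a j * ((g j)%:C)%C) * (e j n - (w j).1.2 n).
      by apply/funext => n; rewrite /d (negbTE hf) hf2.
    have [|h1 h2] := hS j; first by rewrite inE hf hf2.
    have [h3 _ _] := lim_pairP h1; have h4 := (l2B he2 h3).1.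
    have [h5 h6] := l2Z (a j * ((g j)%:C)%C) h4; split=> //; rewrite h6 cabsM cabs_real ger0_norm //.
    rewrite mulrC; apply: (@le_trans _ _ (xi * ((M ^+ 2) ^+ k * l2norm phi))).
      apply: ler_pM => //; [exact: l2norm_ge0|by rewrite mulr_ge0 ?cabs_ge0|].
      by rewrite mulrC; apply: ler_pM => //; exact: cabs_ge0.
    by rewrite ler_wpM2r // ler_peMl.
  have -> : d j = fun n => (a j * ((g j)%:C)%C) * e j n.
    by apply/funext => n; rewrite /d (negbTE hf) (negbTE hf2).
  have [h5 h6] := l2Z (a j * ((g j)%:C)%C) he2; split=> //; rewrite h6 cabsM cabs_real ger0_norm //.
  have [_ _ ->] := he j; rewrite mulr1.
  (* The coefficient is the product of [e j] with [phi], whose support lies where [e j] is at most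
     [xi]. *)
  have hsm : cabs (a j) <= K * xi * l2norm phi.
    apply: (le_trans (cabs_sum _ _ _)).
    have hwj := hw j hf; rewrite (negbTE hf2) in hwj.
    apply: (@le_trans _ _ (\sum_(i < N.*2.+1) xi * l2norm phi)); last first.
      by rewrite sumr_const card_ord -[leLHS]mulr_natl mulrA.
    apply: ler_sum => i _; rewrite cabsM cabs_conj.
    set n := (_ - _ : int); have [hn|hn] := leP `|n| m%:Z.
      apply: ler_pM; rewrite ?cabs_ge0 //; last exact: l2_entry.
      apply: hwj; apply: le_trans hm; by rewrite [leRHS]pmulrn ler_int.
    by rewrite hs // cabs0 mulr0 mulr_ge0 // l2norm_ge0.
  apply: (@le_trans _ _ (K * xi * l2norm phi * (M ^+ 2) ^+ k)).
    by apply: ler_pM => //; exact: cabs_ge0.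
  by rewrite -mulrA [_ * (M ^+ 2) ^+ k]mulrC.
have [hd1 hd2] := l2_sum (index_enum _) (fun j => (hd j).1).
rewrite split3; apply: (le_trans (l2D hb.1 hd1).2); apply: lerD; first exact: hb.2.
apply: (le_trans hd2); apply: (@le_trans _ _ (\sum_(j < N.*2.+1) K * xi * ((M ^+ 2) ^+ k * l2norm phi))).
  by apply: ler_sum => j _; exact: (hd j).2.
rewrite sumr_const card_ord -[leLHS]mulr_natl -/K.
have -> : (K * expR (- (gam / 2 * N%:R))) ^+ 2 = K * (K * xi).
  rewrite exprMn expr2 -mulrA; congr (_ * (_ * _)); rewrite expr2 -expRD; congr expR.
  by field.
rewrite [leLHS]mulrA; apply: ler_wpM2l; first by apply: mulr_ge0 => //; apply: le_trans K1.
by rewrite -[leRHS]mulrA; move: Mk; move: (_ * l2norm phi) => z; lra.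
Qed.

Let mJ : measurable J.
Proof.
have -> : J = `[c - s, c + s]%classic by apply/seteqP; split => t; rewrite /J /= in_itv.
exact: measurable_itv.
Qed.

(** The power [k] comes first, from the ratio [th < 1] of the two filter bounds. The box is chosen
    afterwards, large enough for its exponential to beat the factor [(M ^+ 2) ^+ k]. *)
Lemma box_parameters (m : nat) (A eta : R) : 0 <= A -> 0 < eta ->
  exists N k : nat, [/\ (Nst <= N)%N, m%:R <= N%:R / 10 :> R, (m + k.*2 < N)%N &
    (M ^+ 2 - rad ^+ 2) ^+ k * A +
      ((N.*2.+1)%:R * expR (- (gam / 2 * N%:R))) ^+ 2 * (2 * (M ^+ 2) ^+ k * A)
    <= (M ^+ 2 - s ^+ 2) ^+ k * (eta / 2)].
Proof.
move=> A0 eta0.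
have d1 : 0 <= M ^+ 2 - rad ^+ 2.
  by rewrite subr_ge0 ler_sqr ?nnegrE ?(ltW M_gt0) ?(ltW rad_gt0) // ltW.
have d2 : M ^+ 2 - rad ^+ 2 < M ^+ 2 - s ^+ 2.
  by rewrite ltrD2l ltrN2 ltr_sqr ?nnegrE ?(ltW rad_gt0).
have d3 : 0 < M ^+ 2 - s ^+ 2 := le_lt_trans d1 d2.
pose th := (M ^+ 2 - rad ^+ 2) / (M ^+ 2 - s ^+ 2).
have th0 : 0 <= th by rewrite divr_ge0 // ltW.
have th1 : th < 1 by rewrite ltr_pdivrMr // mul1r.
have A1 : 0 < A + 1 by rewrite ltr_wpDl.
have [k hk] : exists k, th ^+ k * (A + 1) <= eta / 4.
  have hc : th ^+ n @[n --> \oo] --> 0 by apply: cvg_expr; rewrite ger0_norm.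
  have e0 : 0 < eta / 4 / (A + 1) by rewrite !divr_gt0.
  have /cvgrPdist_le /(_ _ e0) [k _ hk] := hc.
  exists k; have := hk k (leqnn k); rewrite /= sub0r normrN ger0_norm ?exprn_ge0 //.
  by rewrite ler_pdivlMr.
pose D := (M ^+ 2 - s ^+ 2) ^+ k; have D0 : 0 < D by exact: exprn_gt0.
pose Z := 2 * (M ^+ 2) ^+ k * A.
have Z0 : 0 <= Z by rewrite !mulr_ge0 // exprn_ge0 // sqr_ge0.
(* The single condition [(1 + Y) * ka <= 1] yields both [ka <= 1] and [Y * ka <= 1], hence
   [ka ^+ 2 * Z <= D * (eta / 4)]. *)
pose Y := Z / (D * (eta / 4)).
have Y0 : 0 <= Y by rewrite divr_ge0 // mulr_ge0 ?divr_ge0 ?(ltW D0) ?(ltW eta0).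
have [n0 hn0] := mul_expN_small (3 * (1 + Y)) (divr_gt0 gam_gt0 (@ltr0Sn R 1)).
pose N := (n0 + Nst + 10 * m + k.*2 + 1)%N.
have [N1 [N2 [N3 [N4 N5]]]] : (n0 <= N)%N /\ (Nst <= N)%N /\ (m * 10 <= N)%N /\
    (m + k.*2 < N)%N /\ (N.*2.+1 <= 3 * N)%N by rewrite /N; clear; lia.
exists N, k; split=> //; first by rewrite ler_pdivlMr // -natrM ler_nat.
pose ka := (N.*2.+1)%:R * expR (- (gam / 2 * N%:R)).
have ka0 : 0 <= ka by rewrite mulr_ge0 ?expR_ge0.
have ka1 : (1 + Y) * ka <= 1.
  have q := hn0 N N1.
  have e : 3 * (1 + Y) * N%:R * expR (- (gam / 2 * N%:R)) =
      (1 + Y) * (3 * N%:R * expR (- (gam / 2 * N%:R))) by ring.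
  rewrite e in q; apply: le_trans q; apply: ler_wpM2l; first exact: addr_ge0.
  by apply: ler_wpM2r; [exact: expR_ge0|rewrite -natrM ler_nat].
have ka2 : ka <= 1.
  by apply: le_trans ka1; rewrite mulrDl mul1r lerDl mulr_ge0.
have e1 : ka ^+ 2 * Z <= D * (eta / 4).
  have hY : Y * ka <= 1 by apply: le_trans ka1; rewrite mulrDl mul1r lerDr.
  have DE : 0 < D * (eta / 4) by rewrite mulr_gt0 // divr_gt0.
  have -> : Z = Y * (D * (eta / 4)) by rewrite /Y divfK // gt_eqF.
  rewrite mulrA -[leRHS]mul1r ler_wpM2r ?(ltW DE) //.
  have : ka * (Y * ka) <= 1 by apply: mulr_ile1 => //; exact: mulr_ge0.
  by rewrite expr2 mulrA mulrAC.
have e2 : (M ^+ 2 - rad ^+ 2) ^+ k * A <= D * (eta / 4).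
  have -> : (M ^+ 2 - rad ^+ 2) ^+ k = D * th ^+ k.
    by rewrite /D -exprMn /th mulrC divfK // gt_eqF.
  rewrite -mulrA ler_wpM2l ?(ltW D0) //; apply: le_trans hk.
  by rewrite ler_wpM2l ?exprn_ge0 // lerDl.
rewrite -/ka -/Z -/D; move: (lerD e2 e1).
have -> : D * (eta / 4) + D * (eta / 4) = D * (eta / 2) by field.
by [].
Qed.

(** Filtering the error [x] yields [P J] of the error in [box_estimate], which is small compared
    with [(M ^+ 2 - s ^+ 2) ^+ k]. On the range of [P J] the filter expands norms by at least that
    factor, so [x] itself is small. *)
Lemma projection_approx (m : nat) (phi : int -> C) (eta : R) : supported m phi -> 0 < eta ->
  exists (p : nat) (a : 'I_p -> C) (Es : 'I_p -> R) (psis : 'I_p -> int -> C),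
    (forall i, lim_pair (Es i) (psis i) /\ P J (psis i) = psis i) /\
    l2norm (fun n => P J phi n - \sum_i a i * psis i n) < eta.
Proof.
move=> hs eta0.
have hphi : l2 phi by exact: (l2_finsupp hs).1.
have [N [k [hN hm hk herr]]] := box_parameters m (l2norm_ge0 phi) eta0.
have [p [q [Es [psis [hlim hest]]]]] := box_estimate hN hs hm hk.
have hl i := lim_pairP (hlim i).
have hl2 i : l2 (psis i) by have [] := hl i.
pose good i := `[< P J (psis i) = psis i >].
pose S := [set i | good i]%SET.
(* Vectors annihilated by [P J] are dropped. For the others the factor produced by the filter is
   divided out; [proj_eigen_energy] keeps it away from zero. *)
pose a i : C := if good i then q i * ((symbol (Es i) ^+ k)^-1%:C)%C else 0.
have D0 : 0 < M ^+ 2 - s ^+ 2.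
  by rewrite subr_gt0 ltr_sqr ?nnegrE ?(ltW M_gt0) //; exact: lt_trans M_gt_rad.
have hu : l2 (P J phi) := proj_l2 hP mJ hphi.
have hsum (b : 'I_p -> C) : l2 (fun n => \sum_i b i * psis i n).
  exact: (l2_sum (index_enum _) (fun i => (l2Z (b i) (hl2 i)).1)).1.
pose x n := P J phi n - \sum_i a i * psis i n.
have hx : l2 x := (l2B hu (hsum a)).1.
have ex : P J x = x.
  rewrite /x (proj_sub hP mJ hu (hsum a)) (proj_idem hP mJ hphi) (proj_sum hP _ a mJ hl2).
  apply/funext => n; congr (_ - _); apply: eq_bigr => i _; rewrite /a.
  by case: ifPn => [/asboolP ->|_] //; rewrite !mul0r.
have eF : iter k filterHc x =
    P J (fun n => iter k filterHc phi n - \sum_i q i * psis i n).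
  rewrite (proj_sub hP mJ (iter_filterH_l2 v_real v_bound c M k hphi) (hsum q)).
  rewrite (proj_sum hP _ q mJ hl2) (proj_iter_filterH v_real v_bound c M hP s k hphi).
  rewrite /x iter_filterHB iter_filterH_sum; apply/funext => n; congr (_ - _).
  apply: eq_bigr => i _; have [h1 h2 h3] := hl i; rewrite /a /good; case: ifPn => [/asboolP hi|/asboolP hi].
    rewrite (iter_filterH_eigen c M k h3) hi mulrA; congr (_ * _).
    rewrite -mulrA -[RHS]mulr1; congr (_ * _); rewrite -[LHS]rmorphM /= mulVf //.
    rewrite expf_neq0 // gt_eqF //; apply: lt_le_trans D0 _.
    exact: (proj_eigen_energy v_real v_bound M hP s_ge0 h1 h2 hi h3).
  have [//|->] := proj_eigen_dichotomy v_real v_bound c hP s h1 h2 h3.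
  by rewrite mul0r mulr0.
have nx : l2norm x <= eta / 2.
  rewrite -(ler_pM2l (exprn_gt0 k D0)).
  apply: le_trans (iter_filterH_expand v_real v_bound hP s_ge0 sM k hx ex) _.
  rewrite eF; apply: le_trans (proj_contract hP mJ _) _.
    exact: (l2B (iter_filterH_l2 v_real v_bound c M k hphi) (hsum q)).1.
  exact: le_trans hest herr.
exists #|S|, (fun i => a (enum_val i)), (fun i => Es (enum_val i)), (fun i => psis (enum_val i)).
split=> [i|].
  by split; [exact: hlim|have := enum_valP i; rewrite inE => /asboolP].
have -> : (fun n => P J phi n - \sum_(i < #|S|) a (enum_val i) * psis (enum_val i) n) = x.
  apply/funext => n; rewrite /x; congr (_ - _).
  have <- : \sum_(j in S) a j * psis j n = \sum_(i < #|S|) a (enum_val i) * psis (enum_val i) n.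
    by rewrite big_enum_val.
  rewrite big_mkcond; apply: eq_bigr => i _; rewrite inE /a.
  by case: (good i) => //=; rewrite mul0r.
by apply: le_lt_trans nx _; lra.
Qed.

End projection_approx.

Section truncation_density.
Context {R : realType}.
Local Notation C := R[i].

Lemma l2_truncate (phi : int -> C) (eta : R) : l2 phi -> 0 < eta ->
  exists m phi0, supported m phi0 /\ l2norm (fun n => phi n - phi0 n) <= eta.
Proof.
move=> h eta0; set A := l2norm phi; have A0 : 0 <= A by exact: l2norm_ge0.
have A1 : 0 < 2 * A + 1 by lra.
(* If [t] is the norm on the window, the squared tail is at most
   [A ^+ 2 - t ^+ 2 <= (A - t) * (2 * A + 1)]. *)
have e0 : 0 < eta ^+ 2 / (2 * A + 1) by rewrite divr_gt0 ?exprn_gt0.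
have /cvgrPdist_le /(_ _ e0) [m _ hm] := l2norm_cvg h.
have {hm} := hm m (leqnn m); rewrite -/A /= => hm.
pose phi0 n : C := if `|n| <= m%:Z then phi n else 0.
have s0 : supported m phi0 by move=> n hn; rewrite /phi0 leNgt hn.
exists m, phi0; split=> //; apply: (l2_bound _).2 => N.
apply: (le_trans (nrm_mono _ (leq_maxl N m))).
rewrite -ler_sqr ?nnegrE ?nrm_ge0 ?(ltW eta0) //.
have e1 : nrm (maxn N m) (fun n => phi n - phi0 n) ^+ 2 + nrm m phi ^+ 2 =
    nrm (maxn N m) phi ^+ 2.
  have -> : nrm m phi ^+ 2 = nrm (maxn N m) phi0 ^+ 2.
    rewrite !nrm_sq (wsum_stable (leq_maxr N m)); last by move=> n /s0 ->; rewrite cabs0 expr0n.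
    by apply: eq_wsum => n hn; rewrite /phi0 hn.
  rewrite !nrm_sq -wsumD; apply: eq_wsum => n _; rewrite /phi0.
  by case: ifP => _; rewrite ?subrr ?subr0 cabs0 expr0n ?add0r ?addr0.
have e2 : nrm (maxn N m) phi <= A by exact: nrm_le_l2norm.
have e3 : nrm m phi <= A by exact: nrm_le_l2norm.
have e4 : nrm (maxn N m) phi ^+ 2 <= A ^+ 2 by rewrite ler_sqr ?nnegrE ?nrm_ge0.
have e5 : A - nrm m phi <= eta ^+ 2 / (2 * A + 1) by apply: le_trans (ler_norm _) hm.
have e6 : (A - nrm m phi) * (2 * A + 1) <= eta ^+ 2 by rewrite -ler_pdivlMr.
have e8 : A ^+ 2 - nrm m phi ^+ 2 <= eta ^+ 2.
  apply: le_trans e6; rewrite subr_sqr; apply: ler_wpM2l; first by rewrite subr_ge0.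
  by move: e3 A0; move: (nrm m phi) (A) => y z; lra.
by rewrite -(lerD2r (nrm m phi ^+ 2)) e1; apply: le_trans e4 _; rewrite -lerBlDr.
Qed.

End truncation_density.

(** * Pure point spectrum on the spectral subspace *)

Section spectral_subspace.
Context {R : realType}.
Local Notation C := R[i].
Variables (v : int -> C) (r : int -> R) (Bv : R).
Hypothesis v_real : forall n, v n = ((r n)%:C)%C.
Hypothesis v_bound : forall n, `|r n| <= Bv.
Local Notation H := (schrodinger v).
Local Notation ev N j := (eigval v (symm N) j).
Variable P : set R -> (int -> C) -> int -> C.
Hypothesis hP : spectral_resolution H P.
Variable J : set R.
Hypothesis mJ : measurable J.
Variable lim_pair : R -> (int -> C) -> Prop.
Hypothesis lim_pairP : forall E psi, lim_pair E psi ->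
  [/\ l2 psi, l2norm psi = 1 & H psi = fun n => (E%:C)%C * psi n].
Hypothesis approx : forall m phi eta, supported m phi -> 0 < eta ->
  exists (p : nat) (a : 'I_p -> C) (Es : 'I_p -> R) (psis : 'I_p -> int -> C),
    (forall i, lim_pair (Es i) (psis i) /\ P J (psis i) = psis i) /\
    l2norm (fun n => P J phi n - \sum_i a i * psis i n) < eta.
Local Notation K := (P J @` l2).
Local Notation PHP := (fun phi => P J (H (P J phi))).

Lemma approx_range phi eta : l2 phi -> P J phi = phi -> 0 < eta ->
  exists (p : nat) (a : 'I_p -> C) (Es : 'I_p -> R) (psis : 'I_p -> int -> C),
    (forall i, lim_pair (Es i) (psis i) /\ P J (psis i) = psis i) /\
    l2norm (fun n => phi n - \sum_i a i * psis i n) < eta.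
Proof.
move=> h e eta0; have e0 : 0 < eta / 2 by lra.
have [m [phi0 [s0 d0]]] := l2_truncate h e0.
have h0 : l2 phi0 by exact: (l2_finsupp s0).1.
have [p [a [Es [psis [hl hd]]]]] := approx s0 e0.
exists p, a, Es, psis; split=> //.
have hl2 i : l2 (psis i) by have [] := lim_pairP (hl i).1.
have hs : l2 (fun n => \sum_i a i * psis i n).
  exact: (l2_sum (index_enum _) (fun i => (l2Z (a i) (hl2 i)).1)).1.
have hp := proj_l2 hP mJ h0.
have hc : l2norm (fun n => phi n - P J phi0 n) <= eta / 2.
  apply: le_trans d0; rewrite -{1}e -(proj_sub hP mJ h h0).
  exact: (proj_contract hP mJ (l2B h h0).1).
have := l2norm_triangle (l2B h hp).1 (l2B hp hs).1; move: hc hd.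
by move: (l2norm _) (l2norm _) (l2norm _) => x y z; lra.
Qed.

Lemma spectral_pure_point : pure_point K PHP.
Proof.
move=> _ [phi hphi <-] eta eta0.
have [p [a [Es [psis [hl hd]]]]] :=
  approx_range (proj_l2 hP mJ hphi) (proj_idem hP mJ hphi) eta0.
exists p, a, psis; split=> // i; exists (Es i).
have [h1 h2 h3] := lim_pairP (hl i).1; have e := (hl i).2.
split=> //; first by exists (psis i).
by rewrite e h3 (projZ hP _ mJ h1) e.
Qed.

Lemma eigen_orthogonal E E' psi psi' : l2 psi -> l2 psi' -> E != E' ->
  H psi = (fun n => (E%:C)%C * psi n) -> H psi' = (fun n => (E'%:C)%C * psi' n) ->
  rip psi psi' = 0.
Proof.
move=> h h' neq e e'; have := schrodinger_selfadjoint v_real v_bound h h'.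
rewrite e e' ripZr // ripZl // => /eqP; rewrite -subr_eq0 -mulrBl mulf_eq0 subr_eq0.
by rewrite eq_sym (negbTE neq) => /eqP.
Qed.

(** Approximation within 1 suffices: if no approximating vector had energy [E], the unit vector
    [psi] would be orthogonal to their span and so at distance at least 1 from it. *)
Lemma spectral_eigenpair E psi : eigenpair K PHP E psi ->
  exists z psi', [/\ lim_pair E psi', cabs z = 1 & psi = fun n => z * psi' n].
Proof.
move=> [[phi hphi ephi] hpsi hE].
have hl : l2 psi by rewrite -ephi; exact: (proj_l2 hP mJ hphi).
have ep : P J psi = psi by rewrite -ephi (proj_idem hP mJ hphi).
have hH : H psi = fun n => (E%:C)%C * psi n.
  by rewrite -hE /= ep (proj_commute v_real v_bound hP mJ hl) ep.
have [p [a [Es [psis [hlim hd]]]]] := approx_range hl ep (@ltr01 R).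
have [[i hi]|hn] := pselect (exists i, Es i = E).
  have [h1 h2 h3] := lim_pairP (hlim i).1; rewrite hi in h3.
  have nz : psis i <> fun=> 0.
    by move=> e; move: h2; rewrite e l20.2 => /eqP; rewrite eq_sym oner_eq0.
  have [z ez] := eigen_simple h1 hl nz h3 hH.
  exists z, (psis i); split=> //; first by have := (hlim i).1; rewrite hi.
  by move: hpsi; rewrite ez (l2Z z h1).2 h2 mulr1.
exfalso; have hl2 i : l2 (psis i) by have [] := lim_pairP (hlim i).1.
have hsum (s : seq 'I_p) : l2 (fun n => \sum_(i <- s) a i * psis i n) /\
    rip psi (fun n => \sum_(i <- s) a i * psis i n) = 0.
  elim: s => [|i s [IH1 IH2]].
    have -> : (fun n => \sum_(i <- [::]) a i * psis i n) = fun=> 0.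
      by apply/funext => n; rewrite big_nil.
    by split; [exact: l20.1|exact: rip0r].
  have -> : (fun n => \sum_(i <- i :: s) a i * psis i n) =
      fun n => a i * psis i n + \sum_(i <- s) a i * psis i n.
    by apply/funext => n; rewrite big_cons.
  have hi := (l2Z (a i) (hl2 i)).1; split; first exact: (l2D hi IH1).1.
  rewrite ripDr // IH2 addr0.
  have [_ _ h3] := lim_pairP (hlim i).1.
  apply: (eigen_orthogonal (E := E) (E' := Es i)) => //.
    by apply/eqP => e; apply: hn; exists i.
  by rewrite schrodingerZ h3; apply/funext => n; ring.
have [h1 h2] := hsum (index_enum 'I_p).
have := l2norm_sqB hl h1; rewrite h2 hpsi => e.
move: hd; rewrite ltNge => /negP; apply.
rewrite -ler_sqr ?nnegrE ?l2norm_ge0 // e mulr0 subr0 lerDl.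
exact: sqr_ge0.
Qed.

End spectral_subspace.

Lemma absz_triangle3 (m0 m1 m : int) : `|m0| <= `|m0 - m1| + `|m - m1| + `|m|.
Proof. lia. Qed.

Section localized_boxes.
Context {R : realType}.
Local Notation C := R[i].
Variables (v : int -> C) (r : int -> R) (Bv : R).
Hypothesis v_real : forall n, v n = ((r n)%:C)%C.
Hypothesis v_bound : forall n, `|r n| <= Bv.
Variables (gamma eps sigma CV delta : R).
Hypothesis gamma_gt0 : 0 < gamma.
Hypothesis eps_ge0 : 0 <= eps.
Hypothesis sigma_ge0 : 0 <= sigma.
Variables (Lf : R -> R) (I : nat -> R -> zitv) (Nst : nat).
Local Notation ev N j := (eigval v (symm N) j).
Hypothesis loc : forall N, (Nst <= N)%N -> localized v gamma eps sigma CV Lf I N.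
Hypothesis good : forall N, (Nst <= N)%N -> good_scale gamma eps sigma CV delta N.
Hypothesis Lf_lsc : forall E E', `|E| <= 2 + Bv -> `|E - E'| <= delta ->
  2 * gamma < Lf E -> gamma < Lf E'.

Lemma tower_of_box (N j : nat) (psi : int -> C) : (Nst <= N)%N -> (j < N.*2.+1)%N ->
  unit_eigvec v (symm N) (ev N j) psi -> 2 * gamma < Lf (ev N j) ->
  centered v I N j (N%:R / 2) ->
  exists js psis E psi', [/\ js 0%N = j, psis 0%N = psi &
    tower_data v gamma I N j psi js psis E psi'].
Proof.
move=> hN hj hu hL hc.
apply: (tower_exists v_real gamma_gt0 eps_ge0 sigma_ge0 loc good hN hj hu hc _ v_bound).
move=> E' hE'; apply: (Lf_lsc _ _ hL); first exact: (eigval_bound v_real v_bound hu).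
rewrite distrC; apply: le_trans hE' _; apply: le_trans (gs_delta (good hN)).
by rewrite (_ : gamma * N%:R / 10 = gamma / 10 * N%:R) //; ring.
Qed.

Definition tower_pair (E : R) (psi : int -> C) : Prop :=
  exists N j psi0 js psis, [/\ (Nst <= N)%N, (j < N.*2.+1)%N, 2 * gamma < Lf (ev N j),
    centered v I N j (N%:R / 2) & js 0%N = j /\ tower_data v gamma I N j psi0 js psis E psi].

(** If the localization interval leaves [-N/2, N/2], its length below N/100 keeps it at distance
    more than N/4 from [-N/10, N/10], where the rate gamma/4 gives exp(-gamma N/16). Otherwise a
    tower starts from this box, and its limit is close to [psi]. *)
Lemma box_tower_or_decay (c rad : R) : (forall E, `|E - c| <= rad -> 2 * gamma < Lf E) ->
  forall (N j : nat) (psi : int -> C),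
  (Nst <= N)%N -> (j < N.*2.+1)%N -> unit_eigvec v (symm N) (ev N j) psi ->
  `|ev N j - c| <= rad ->
  (exists E psi', tower_pair E psi' /\
     l2norm (fun n => psi n - psi' n) <= expR (- (gamma / 20 * N%:R))) \/
  (forall m : int, (`|m|)%:~R <= N%:R / 10 :> R ->
     cabs (psi m) <= expR (- (gamma / 20 * N%:R))).
Proof.
move=> hLf N j psi hN hj hu hE; have hL := hLf _ hE.
have gN0 : 0 <= gamma * N%:R by rewrite mulr_ge0 // ltW.
have [hc|hc] := pselect (centered v I N j (N%:R / 2)).
  left; have [js [psis [E [psi' [h0 h1 td]]]]] := tower_of_box hN hj hu hL hc.
  exists E, psi'; split; first by exists N, j, psi, js, psis.
  have := td_psi0 td; have hd := l2B (td_l2 td) (unit_eigvec_l2 hu).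
  have := (l2N hd.1).2; rewrite (_ : (fun n => - _) = fun n => psi n - psi' n); last first.
    by apply/funext => n; rewrite opprB.
  move=> -> /le_trans; apply.
  have q : expR (- (gamma * N%:R / 10)) <= expR (- (gamma / 20 * N%:R)).
    rewrite (_ : gamma / 20 * N%:R = gamma * N%:R / 20); last by field.
    by rewrite ler_expR; move: gN0; move: (gamma * N%:R) => y; lra.
  rewrite /rate; have := expR_ge0 (- (gamma * (scale N 0)%:R / 10)).
  move: q; rewrite (_ : scale N 0 = N) //; move: (expR _) (expR _) => y z; lra.
right => m hm.
have [m0 hm0 far0] : exists2 m0, zset (I N (ev N j)) m0 & N%:R / 2 < (`|m0|)%:~R :> R.
  apply: contrapT => hn; apply: hc => m0 hm0; rewrite leNgt; apply/negP => hlt.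
  by apply: hn; exists m0.
have hg : gamma < Lf (ev N j) by move: hL gamma_gt0; move: (Lf _) => y; lra.
have Npos : 0 < N%:R :> R by rewrite ltr0n; apply: leq_trans (gs_4 (good hN)).
have hlen : (zlen (I N (ev N j)))%:R <= N%:R / 100 :> R.
  have [_ [_ h] _ _] := loc hN hj hg; apply: le_trans (ltW h) _.
  exact: (good_l gamma_gt0 eps_ge0 sigma_ge0 good hN).
apply: le_trans (decay_away' gamma_gt0 eps_ge0 sigma_ge0 loc (D := N%:R / 4) hN hj hg hu _ _) _.
- apply: le_lt_trans (good_s gamma_gt0 eps_ge0 sigma_ge0 good hN) _.
  by move: Npos; move: (N%:R : R) => y; lra.
- move=> m1 hm1.
  have k1 : (`|m0 - m1|)%:~R <= N%:R / 100 :> R.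
    by apply: le_trans hlen; rewrite [leRHS]pmulrn ler_int; exact: zset_dist hm0 hm1.
  have k2 : (`|m0|)%:~R <= (`|m0 - m1|)%:~R + (`|m - m1|)%:~R + (`|m|)%:~R :> R.
    by rewrite -!intrD ler_int; exact: absz_triangle3.
  move: k1 k2 hm far0 Npos; move: (N%:R : R) ((`|m0|)%:~R : R) ((`|m|)%:~R : R).
  move: ((`|m0 - m1|)%:~R : R) ((`|m - m1|)%:~R : R) => x y z w t; lra.
rewrite ler_expR (_ : gamma / 4 * (N%:R / 4) = gamma * N%:R / 16); last by field.
rewrite (_ : gamma / 20 * N%:R = gamma * N%:R / 20); last by field.
by move: gN0; move: (gamma * N%:R) => y; lra.
Qed.

End localized_boxes.

(** * From towers to the statement *)

Lemma cvg_phase (R : realType) (f : nat -> R[i]) (a z : R[i]) : cabs z = 1 ->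
  (f : nat -> R[i]^o) @ \oo --> (a : R[i]^o) ->
  ((fun k => z * f k) : nat -> R[i]^o) @ \oo --> (z * a : R[i]^o).
Proof.
move=> z1 /cvgrPdist_lt h; apply/cvgrPdist_lt => e e0; have := h e e0.
by apply: filterS => k; rewrite -mulrBr !cabsE cabsM z1 mul1r.
Qed.

Section tower_records.
Context {R : realType} {d : nat}.
Local Notation C := R[i].
Variables (V : 'rV[R]_d -> R) (gamma : R) (omega x : 'rV[R]_d).
Local Notation v := (potential V omega x).

Lemma half_expR_lt (a y : R) : 1 / 2 * expR (- (a * y)) < expR (- a * y).
Proof. rewrite mulNr; have := expR_gt0 (- (a * y)); move: (expR _) => z; lra. Qed.

Lemma half_rate_lt (N k : nat) :
  1 / 2 * rate gamma N k < expR (- (gamma / 10) * (scale N k)%:R).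
Proof.
rewrite /rate (_ : gamma * (scale N k)%:R / 10 = gamma / 10 * (scale N k)%:R); last by field.
exact: half_expR_lt.
Qed.

Lemma tower_of_data (I : nat -> R -> zitv) N j psi0 js psis E psi :
  js 0%N = j -> tower_data v gamma I N j psi0 js psis E psi ->
  tower V gamma omega x N (I N (eigval v (symm N) j)) js psis.
Proof.
move=> h0 td; split.
- exact: (td_js td).
- exact: (td_psi td).
- move=> k _; exact: le_lt_trans (td_val td (leq0n k)) (half_rate_lt N 0).
- move=> k _; exact: le_lt_trans (td_vec td (leq0n k)) (half_rate_lt N 0).
- move=> k _ n hn _; exact: le_lt_trans (td_decay td k hn) (half_expR_lt _ _).
- move=> k k' hk; exact: le_lt_trans (td_val td hk) (half_rate_lt N k).
- move=> k k' hk; exact: le_lt_trans (td_vec td hk) (half_rate_lt N k).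
Qed.

(** In (b) an eigenvector equals the limit of a tower only up to a unimodular factor, which is
    distributed over the whole tower. *)
Lemma tower_phase (L : zitv) N js psis (z : C) : cabs z = 1 ->
  tower V gamma omega x N L js psis ->
  tower V gamma omega x N L js (fun k n => z * psis k n).
Proof.
move=> z1 [t1 t2 t3 t4 t5 t6 t7].
have hl k : l2 (psis k) by exact: unit_eigvec_l2 (t2 k).
have e k k' : l2norm (fun n => z * psis k' n - z * psis k n) =
    l2norm (fun n => psis k' n - psis k n).
  rewrite -[RHS]mul1r -z1 -(l2Z z (l2B (hl k') (hl k)).1).2.
  by congr l2norm; apply/funext => n; rewrite mulrBr.
split=> //.
- by move=> k; exact: unit_eigvec_phase.
- by move=> k hk; rewrite e; exact: t4.
- by move=> k hk n h1 h2; rewrite cabsM z1 mul1r; exact: t5.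
- by move=> k k' hk; rewrite e; exact: t7.
Qed.

Lemma tower_limit_phase N js psis E psi (z : C) : cabs z = 1 ->
  tower_limit V omega x N js psis E psi ->
  tower_limit V omega x N js (fun k n => z * psis k n) E (fun n => z * psi n).
Proof.
move=> z1 [h1 h2]; split; first exact: h1.
move=> n; exact: cvg_phase.
Qed.

End tower_records.

(** [E1] is the point of the interval nearest to [E]; at this point the lower bound on the Lyapunov
    exponent is known. *)
Lemma dist_clamp (R : realType) (l u E e : R) : 0 <= e -> l <= u ->
  `|E - (l + u) / 2| <= (u - l) / 2 + e ->
  exists E1, [/\ l <= E1 <= u, `|E1| <= `|l| + `|u| & `|E1 - E| <= e].
Proof.
move=> e0 lu hE.
have hb E1 : l <= E1 <= u -> `|E1| <= `|l| + `|u|.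
  move=> /andP[h1 h2]; rewrite ler_norml.
  have := ler_norm (- l); have := ler_norm u; rewrite normrN.
  have := normr_ge0 l; have := normr_ge0 u.
  by move: (`|l|) (`|u|) => y z *; apply/andP; split; lra.
move: hE; rewrite ler_norml => /andP[h1 h2].
have [El|lE] := leP E l.
  by exists l; split; [lra|apply: hb; lra|rewrite ler_norml; apply/andP; split; lra].
have [uE|Eu] := leP u E.
  by exists u; split; [lra|apply: hb; lra|rewrite ler_norml; apply/andP; split; lra].
by exists E; split; [lra|apply: hb; lra|by rewrite subrr normr0].
Qed.

Theorem theoremC (R : realType) (d : nat) (hd : (1 <= d)%N)
  (V : 'rV[R]_d -> R) (rho : R) (W : 'rV[R[i]]_d -> R[i])
  (hV : analytic_potential V rho W)
  (a b : R) (ha : 0 < a) (hb : d%:R < b)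
  (sigma tau : R) (hsigma : 0 < sigma < 1) (htau : 0 < tau < 1)
  (hLDT : LDT W rho a b sigma tau)
  (eps gamma : R) (heps : 0 < eps < 1 / 5) (hgamma : 0 < gamma)
  (CV : R) (N1 : nat) :
  exists C0 : nat,
  forall (Omega : nat -> set 'rV[R]_d) (B : nat -> 'rV[R]_d -> set 'rV[R]_d)
         (I : nat -> 'rV[R]_d -> 'rV[R]_d -> R -> zitv),
  exceptional_sets V a b gamma eps sigma tau CV N1 Omega B I ->
  forall Nstar : nat, (C0 <= Nstar)%N ->
  forall omega : 'rV[R]_d, diophantine a b omega ->
    ~ (\bigcup_(N in [set N | (Nstar <= N)%N]) Omega N) omega ->
  forall x : 'rV[R]_d, torus x ->
    ~ (\bigcup_(N in [set N | (Nstar <= N)%N]) B N omega) x ->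
  (* (a) *)
  (forall N : nat, (Nstar <= N)%N ->
   forall j : nat,
   let E0 := eigval (potential V omega x) (symm N) j in
   admissible V gamma omega x N j (I N x omega E0) ->
   forall psi0 : int -> R[i],
   unit_eigvec (potential V omega x) (symm N) E0 psi0 ->
   exists (js : nat -> nat) (psis : nat -> int -> R[i]),
     [/\ js 0%N = j, psis 0%N = psi0,
         tower V gamma omega x N (I N x omega E0) js psis &
         exists (E : R) (psi : int -> R[i]),
           [/\ tower_limit V omega x N js psis E psi,
               l2 psi, l2norm psi = 1 &
               forall n : int, 3 * N%:R / 4 <= (`|n|)%:~R :> R ->
                 ComplexField.Normc.normc (psi n)
                   < expR (- (gamma / 20)
                           * fine (zdist n (zset (I N x omega E0))))]]) /\
  (* (b) *)
  (forall P : set R -> (int -> R[i]) -> int -> R[i],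
   spectral_resolution (schrodinger (potential V omega x)) P ->
   forall E' E'' : R,
   (forall E : R, E' <= E <= E'' ->
      3 * gamma < Lyap (potential V omega) E%:C%C) ->
   let J := [set E : R | E' <= E <= E''] in
   let K := P J @` l2 in
   let PHP := fun phi => P J (schrodinger (potential V omega x) (P J phi)) in
   pure_point K PHP /\
   forall (E : R) (psi : int -> R[i]), eigenpair K PHP E psi ->
   exists (N j : nat) (js : nat -> nat) (psis : nat -> int -> R[i]),
     let E0 := eigval (potential V omega x) (symm N) j in
     [/\ (Nstar <= N)%N,
         admissible V gamma omega x N j (I N x omega E0),
         js 0%N = j,
         tower V gamma omega x N (I N x omega E0) js psis &
         tower_limit V omega x N js psis E psi]).
Proof.
have [Mv M0 hM] := potential_bounded hV.
have g2 : 0 < 2 * gamma by rewrite mulr_gt0.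
have g3 : 0 < 3 * gamma by rewrite mulr_gt0.
(* All box eigenvalues are bounded by [2 + Mv]. Three quarters of 2 gamma still exceed gamma. *)
have [delta delta0 hlsc] := lyap_lsc hV hsigma htau hLDT (2 + Mv) g2.
have [C1 hC1] := good_scale_exists CV hgamma heps hsigma delta0.
exists (maxn N1 C1) => Omega B I hES Nstar; rewrite geq_max => /andP[hN1 hC] omega homega.
move=> hOm x hx hB.
pose v := potential V omega x; pose r n := V (x + omega *~ n).
pose Lf (E : R) := Lyap (potential V omega) E%:C%C.
pose I' N E := I N x omega E.
have v_real n : v n = ((r n)%:C)%C by [].
have v_bound n : `|r n| <= Mv by exact: hM.
have eps0 : 0 <= eps by have /andP[/ltW] := heps.
have sigma0 : 0 <= sigma by have /andP[/ltW] := hsigma.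
have loc N : (Nstar <= N)%N -> localized v gamma eps sigma CV Lf I' N.
  move=> hN; apply: (es_loc hES (leq_trans hN1 hN) homega _ hx).
    by move=> h; apply: hOm; exists N.
  by move=> h; apply: hB; exists N.
have good N : (Nstar <= N)%N -> good_scale gamma eps sigma CV delta N.
  by move=> hN; apply: hC1; exact: leq_trans hN.
have lsc E E' : `|E| <= 2 + Mv -> `|E - E'| <= delta -> 2 * gamma < Lf E -> gamma < Lf E'.
  move=> h1 h2 h3; have := hlsc omega homega E E' h1 h2 h3; rewrite -/(Lf E').
  by apply: lt_le_trans; move: hgamma; clear; lra.
split.
- move=> N hN j E0 [hj hL hc] psi0 hu.
  have [js [psis [E [psi [h0 h1 td]]]]] :=
    tower_of_box v_real v_bound hgamma eps0 sigma0 loc good lsc hN hj hu hL hc.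
  exists js, psis; split=> //; first exact: tower_of_data td.
  exists E, psi; split.
  + by split; [exact: td_cvgE td|exact: td_cvg td].
  + exact: td_l2 td.
  + exact: td_unit td.
  + by move=> n hn; exact: le_lt_trans (td_limdecay td hn) (half_expR_lt _ _).
move=> P hP E' E'' hL J K PHP.
have eJ : J = `[E', E'']%classic by apply/seteqP; split => t; rewrite /J /= in_itv.
have mJ : measurable J by rewrite eJ; exact: measurable_itv.
pose lim_pair := tower_pair v gamma Lf I' Nstar.
have lim_pairP E psi : lim_pair E psi ->
    [/\ l2 psi, l2norm psi = 1 & schrodinger v psi = fun n => (E%:C)%C * psi n].
  by move=> [N [j [psi0 [js [psis [_ _ _ _ [_ td]]]]]]]; split; case: td.
have approx m phi eta : supported m phi -> 0 < eta ->
    exists (p : nat) (a : 'I_p -> R[i]) (Es : 'I_p -> R) (psis : 'I_p -> int -> R[i]),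
    (forall i, lim_pair (Es i) (psis i) /\ P J (psis i) = psis i) /\
    l2norm (fun n => P J phi n - \sum_i a i * psis i n) < eta.
  move=> hs eta0; have hphi : l2 phi := (l2_finsupp hs).1.
  (* For [E'' < E'] the set [J] is empty, so [P J phi] vanishes and the empty sum approximates
     it. *)
  have [lt_E|le_E] := ltP E'' E'.
    have J0 : J = set0.
      by apply/seteqP; split=> t // /andP[h1 h2]; have := lt_le_trans lt_E (le_trans h1 h2); rewrite ltxx.
    exists 0%N, (fun=> 0), (fun=> 0), (fun _ _ => 0); split; first by case.
    have -> : (fun n => P J phi n - \sum_(i < 0) 0 * 0) = P J phi.
      by apply/funext => n; rewrite big_ord0 subr0.
    have e : l2norm (P J phi) = 0.
      apply/eqP; rewrite -sqrf_eq0 J0 -setCT (proj_normC hP measurableT hphi).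
      by rewrite (proj_normT hP hphi) subrr.
    by rewrite e.
  pose c := (E' + E'') / 2; pose s := (E'' - E') / 2.
  have eJ2 : J = [set t | c - s <= t <= c + s].
    rewrite (_ : c - s = E'); last by rewrite /c /s; field.
    by rewrite (_ : c + s = E''); last by rewrite /c /s; field.
  (* Three quarters of 3 gamma exceed 2 gamma, so the hypothesis of (a) holds up to distance [d1]
     outside [J]. This margin is the room that the filter needs between [s] and its outer radius. *)
  have [d1 d10 hd1] := lyap_lsc hV hsigma htau hLDT (`|E'| + `|E''|) g3.
  have hrad E : `|E - c| <= s + d1 -> 2 * gamma < Lf E.
    move=> hE; have [E1 [b1 b2 b3]] := dist_clamp (ltW d10) le_E hE.
    have := hd1 omega homega E1 E b2 b3 (hL E1 b1); rewrite -/(Lf E).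
    by apply: lt_le_trans; move: hgamma; clear; lra.
  have s0 : 0 <= s by rewrite divr_ge0 // subr_ge0.
  have srad : s < s + d1 by rewrite ltrDl.
  have g20 : 0 < gamma / 20 by rewrite divr_gt0.
  rewrite eJ2; apply: (projection_approx v_real v_bound hP s0 srad g20 lim_pairP _ hs eta0).
  exact: (box_tower_or_decay v_real v_bound hgamma eps0 sigma0 loc good lsc hrad).
split; first exact: (spectral_pure_point hP mJ lim_pairP approx).
move=> E psi hpsi.
have [z [psi' [[N [j [psi0 [js [psis [h1 h2 h3 h4 [h5 td]]]]]]] z1 ->]]] :=
  spectral_eigenpair v_real v_bound hP mJ lim_pairP approx hpsi.
exists N, j, js, (fun k n => z * psis k n); split=> //.
- by apply: tower_phase => //; exact: tower_of_data td.
- by apply: tower_limit_phase => //; split; [exact: td_cvgE td|exact: td_cvg td].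
Qed.
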